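(* The functions $S=\sin^2\phi$, $C=\cos^2\phi$ and $D=\cos^2\psi$ are not elliptic; that is, none of them admits an extension from a small disc about $0$ to an elliptic (doubly periodic meromorphic) function on $\mathbb{C}$.
   Context: Let $0<\kappa<1$ and $\lambda=\sqrt{1-\kappa^2}\in(0,1)$. Let $F(\tfrac16,\tfrac56;\tfrac12;\cdot)$ denote the Gauss hypergeometric function. Define $u$ as a function of $\phi$ near $0$ by $u=\int_0^{\sin\phi}F(\tfrac16,\tfrac56;\tfrac12;\kappa^2t^2)\,\frac{dt}{\sqrt{1-t^2}}$; near the origin (fixing $0$) this inverts to a holomorphic function $u\mapsto\phi(u)$ with $\phi(0)=0$. Let $\psi$ be the holomorphic function near $0$ with $\psi(0)=0$ and $\sin\psi=\kappa\sin\phi$. All functions are regarded as functions of $u$ on a small disc about $0$. *)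

(* Defs.v *)
From Stdlib Require Import Reals Factorial.
From Coquelicot Require Import Coquelicot.
Open Scope R_scope.

Fixpoint poch (a : R) (n : nat) : R :=
  match n with
  | O => 1
  | S m => poch a m * (a + INR m)
  end.

Definition hypc (n : nat) : R :=
  poch (1/6) n * poch (5/6) n / (poch (1/2) n * INR (Factorial.fact n)).

(* F(1/6,5/6;1/2; x) for complex x (|x| < 1): the sum of the power series,
   computed componentwise (the coefficients are real). *)
Definition hypF (x : C) : C :=
  (Series (fun n => hypc n * Re (Cpow x n)), Series (fun n => hypc n * Im (Cpow x n))).

Definition csin (z : C) : C := (sin (Re z) * cosh (Im z), cos (Re z) * sinh (Im z)).
Definition ccos (z : C) : C := (cos (Re z) * cosh (Im z), - (sin (Re z) * sinh (Im z))).

(* U k w = int_0^w F(1/6,5/6;1/2; k^2 sin^2 theta) d theta, along the segment [0,w].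
   By the substitution t = sin theta this is
   int_0^{sin w} F(1/6,5/6;1/2; k^2 t^2) dt / sqrt(1 - t^2)  (w near 0). *)
Definition U (k : R) (w : C) : C :=
  @RInt C_R_CompleteNormedModule
    (fun s : R => (w * hypF (RtoC (k ^ 2) * (csin (RtoC s * w)) ^ 2))%C) 0 1.

Definition cdiff (f : C -> C) (z : C) : Prop := ex_derive (K := C_AbsRing) (V := C_NormedModule) f z.

(* f is meromorphic on C with pole set P: P is discrete and closed (every point has a
   punctured neighbourhood free of P), f is holomorphic off P, and |f| -> +oo at each
   point of P. *)
Definition meromorphic_with_poles (f : C -> C) (P : C -> Prop) : Prop :=
  (forall z : C, exists r : R, 0 < r /\
     forall w : C, 0 < Cmod (w - z) < r -> ~ P w) /\
  (forall z : C, ~ P z -> cdiff f z) /\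
  (forall p : C, P p -> forall M : R, exists r : R, 0 < r /\
     forall w : C, 0 < Cmod (w - p) < r -> M < Cmod (f w)).

Definition is_period (f : C -> C) (P : C -> Prop) (w : C) : Prop :=
  forall z : C, (P z <-> P (z + w)%C) /\ (~ P z -> f (z + w)%C = f z).

Definition elliptic (f : C -> C) : Prop :=
  exists P : C -> Prop, meromorphic_with_poles f P /\
  exists w1 w2 : C,
    (forall a b : R, (RtoC a * w1 + RtoC b * w2)%C = 0%C -> a = 0 /\ b = 0) /\
    is_period f P w1 /\ is_period f P w2.

Definition extends_to_elliptic (g : C -> C) : Prop :=
  exists (f : C -> C) (eps : R), 0 < eps /\ elliptic f /\
    forall z : C, Cmod z < eps -> f z = g z.

(* Main.v *)
(* Since F(1/6, 5/6; 1/2; sin(psi)^2) = cos(2 psi / 3) / cos(psi), putting sin(psi) = kappa sin(phi) and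
   p = exp(i psi / 3) turns u into the integral of
     - 3 i (p^4 + 1) / sqrt ((1 - omega p^6) (1 - conj(omega) p^6)),   |omega| = 1,
   which is holomorphic on the unit disc, while sin(phi)^2 = (2 - p^6 - p^-6) / (4 kappa^2).  If sin(phi)^2
   extended to a meromorphic function f of u, the identity f(u(p)) = sin(phi)^2 would propagate along the
   chord from p = 1 to p = exp(i pi / 4).  At that end point the numerator p^4 + 1 vanishes, so u has a
   critical point there (or a branch point of exponent 3/2, when kappa^2 = 1/2), whereas sin(phi)^2 has
   nonzero derivative in p: f cannot be differentiable there. *)

Require Import Defs.
From Stdlib Require Import Reals Lra Lia Psatz Classical.
From Coquelicot Require Import Coquelicot.
Open Scope R_scope.

(** * Complex differentiability *)


(** Real values of [phi] correspond to [|p| = 1], so the identity is known at first only on an arc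
    of the boundary of the disc; a reflection argument carries it inside. From there the path stays
    in the open disc: the branch points [p^6 = omega], [p^6 = conj omega] and the zeros of [p^4 + 1]
    all lie on the circle, so inside it [u] is holomorphic with nonzero derivative. That derivative
    also settles the poles of [f]: where [u] meets one, [f (u p)] would be unbounded and
    [sin(phi)^2] is not, unless [u] were locally constant. The end point is suitable because
    [p^6 + p^-6] has a critical point only if [p^12 = 1], while [zeta8^12 = -1]. As [zeta8] may be a
    branch point, [u] is not differentiated there: the decay of its derivative along the chord gives
    [u - u0 = o(p - zeta8)]. The closed form of [F] comes from an ODE: [cos t * F(sin^2 t)] is an
    oscillator of frequency 2/3. Finally, [phi] is an arbitrary holomorphic solution; that it is
    real on the real axis rests on local injectivity of [U]. *)

Definition ccont (f : C -> C) (z : C) : Prop :=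
  forall eps : R, 0 < eps -> exists d : R, 0 < d /\
    forall w : C, Cmod (w - z) < d -> Cmod (f w - f z) < eps.

Definition cderiv (f : C -> C) (z l : C) : Prop :=
  forall eps : R, 0 < eps -> exists d : R, 0 < d /\
    forall w : C, Cmod (w - z) < d ->
      Cmod (f w - f z - l * (w - z)) <= eps * Cmod (w - z).

Definition cderivable (f : C -> C) (z : C) : Prop := exists l, cderiv f z l.

(** Componentwise, so that the real derivative rules and [auto_derive] apply to curves in the
    plane. *)
Definition rderiv (g : R -> C) (t : R) (v : C) : Prop :=
  is_derive (fun s => Re (g s)) t (Re v) /\ is_derive (fun s => Im (g s)) t (Im v).

Lemma Cmod_sub_sym (a b : C) : Cmod (a - b) = Cmod (b - a).
Proof. rewrite <- Cmod_opp. f_equal. ring. Qed.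

Lemma Cmod_tri (a b c : C) : Cmod (a - c) <= Cmod (a - b) + Cmod (b - c).
Proof. replace (a - c)%C with ((a - b) + (b - c))%C by ring. apply Cmod_triangle. Qed.

Lemma Cmod_sub_le (a b : C) : Cmod (a - b) <= Cmod a + Cmod b.
Proof.
  unfold Cminus. eapply Rle_trans. apply Cmod_triangle. rewrite Cmod_opp. lra.
Qed.

Lemma Cmod_ge_sub (a b : C) : Cmod a - Cmod b <= Cmod (a - b).
Proof.
  assert (H := Cmod_triangle (a - b) b).
  replace (a - b + b)%C with a in H by ring. lra.
Qed.

Lemma Csub_0_eq (a b : C) : (a - b)%C = 0%C -> a = b.
Proof. intros H. replace a with ((a - b) + b)%C by ring. rewrite H. ring. Qed.

Lemma Cmod_sub_pos (a b : C) : a <> b -> 0 < Cmod (a - b).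
Proof. intros H. apply Cmod_gt_0. intros K. apply H, Csub_0_eq, K. Qed.

Lemma Cmod_zero_eq (a b : C) : Cmod (a - b) <= 0 -> a = b.
Proof.
  intros H. apply Csub_0_eq, Cmod_eq_0. assert (H1 := Cmod_ge_0 (a - b)). lra.
Qed.

Lemma Cmod_self (z : C) : Cmod (z - z) = 0.
Proof. replace (z - z)%C with (RtoC 0) by ring. apply Cmod_0. Qed.

Lemma Cmod_le_ReIm (z : C) : Cmod z <= Rabs (Re z) + Rabs (Im z).
Proof.
  destruct z as [x y]. unfold Cmod; simpl.
  assert (Hx := Rabs_pos x). assert (Hy := Rabs_pos y).
  rewrite <- (sqrt_Rsqr (Rabs x + Rabs y)) by lra.
  apply sqrt_le_1_alt. unfold Rsqr.
  assert (Rabs x * Rabs x = x * x) by (rewrite <- Rabs_mult; apply Rabs_pos_eq; nra).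
  assert (Rabs y * Rabs y = y * y) by (rewrite <- Rabs_mult; apply Rabs_pos_eq; nra).
  nra.
Qed.

Lemma im_le_Cmod (z : C) : Rabs (Im z) <= Cmod z.
Proof.
  eapply Rle_trans; [ | apply Rmax_Cmod ]. apply Rmax_r.
Qed.

Lemma C_ext (a b : C) : Re a = Re b -> Im a = Im b -> a = b.
Proof. destruct a, b; simpl; intros; subst; reflexivity. Qed.

Lemma Cmod_sqr (z : C) : Cmod z * Cmod z = Re z * Re z + Im z * Im z.
Proof. assert (H := Cmod2_alt z). nra. Qed.

Lemma ccont_const (c z : C) : ccont (fun _ => c) z.
Proof. intros e He. exists 1. split; [lra|]. intros w _. rewrite Cmod_self. lra. Qed.

Lemma ccont_id (z : C) : ccont (fun w => w) z.
Proof. intros e He. exists e. split; [lra|]. auto. Qed.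

Lemma ccont_plus (f g : C -> C) (z : C) :
  ccont f z -> ccont g z -> ccont (fun w => f w + g w)%C z.
Proof.
  intros Hf Hg e He.
  destruct (Hf (e/2)) as [d1 [H1 K1]]; [lra|].
  destruct (Hg (e/2)) as [d2 [H2 K2]]; [lra|].
  exists (Rmin d1 d2). split; [apply Rmin_pos; lra|]. intros w Hw.
  assert (A := K1 w ltac:(eapply Rlt_le_trans; [exact Hw | apply Rmin_l])).
  assert (B := K2 w ltac:(eapply Rlt_le_trans; [exact Hw | apply Rmin_r])).
  replace (f w + g w - (f z + g z))%C with ((f w - f z) + (g w - g z))%C by ring.
  eapply Rle_lt_trans; [apply Cmod_triangle|]. lra.
Qed.

Lemma ccont_mult (f g : C -> C) (z : C) :
  ccont f z -> ccont g z -> ccont (fun w => f w * g w)%C z.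
Proof.
  intros Hf Hg e He.
  assert (Hf0 := Cmod_ge_0 (f z)). assert (Hg0 := Cmod_ge_0 (g z)).
  set (m := Cmod (f z) + Cmod (g z) + 1 + e).
  assert (Hm : 0 < m) by (unfold m; lra).
  assert (Hem : 0 < e / m) by (apply Rdiv_lt_0_compat; lra).
  assert (Hem1 : e / m * m = e) by (field; lra).
  assert (Hem2 : e / m < 1) by (apply (Rmult_lt_reg_r m); [lra|]; rewrite Hem1; unfold m; lra).
  destruct (Hf (e/m) Hem) as [d1 [H1 K1]].
  destruct (Hg (e/m) Hem) as [d2 [H2 K2]].
  exists (Rmin d1 d2). split; [apply Rmin_pos; lra|]. intros w Hw.
  assert (A := K1 w ltac:(eapply Rlt_le_trans; [exact Hw | apply Rmin_l])).
  assert (B := K2 w ltac:(eapply Rlt_le_trans; [exact Hw | apply Rmin_r])).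
  replace (f w * g w - f z * g z)%C
    with ((f w - f z) * (g w - g z) + ((f w - f z) * g z + f z * (g w - g z)))%C by ring.
  eapply Rle_lt_trans; [apply Cmod_triangle|].
  eapply Rle_lt_trans; [apply Rplus_le_compat_l, Cmod_triangle|].
  rewrite !Cmod_mult.
  assert (A0 := Cmod_ge_0 (f w - f z)). assert (B0 := Cmod_ge_0 (g w - g z)).
  unfold m in *. nra.
Qed.

Lemma ccont_comp (f g : C -> C) (z : C) :
  ccont g z -> ccont f (g z) -> ccont (fun w => f (g w)) z.
Proof.
  intros Hg Hf e He. destruct (Hf e He) as [d1 [H1 K1]].
  destruct (Hg d1 H1) as [d2 [H2 K2]]. exists d2. split; auto.
Qed.

Lemma ccont_opp (f : C -> C) (z : C) : ccont f z -> ccont (fun w => - f w)%C z.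
Proof.
  intros Hf e He. destruct (Hf e He) as [d [Hd K]]. exists d. split; auto.
  intros w Hw. replace (- f w - - f z)%C with (- (f w - f z))%C by ring.
  rewrite Cmod_opp. auto.
Qed.

Lemma ccont_inv (f : C -> C) (z : C) :
  f z <> 0%C -> ccont f z -> ccont (fun w => / f w)%C z.
Proof.
  intros Hz Hf e He. assert (Hm := proj1 (Cmod_gt_0 _) Hz). set (m := Cmod (f z)) in *.
  destruct (Hf (Rmin (m/2) (e * (m * m / 2)))) as [d [Hd K]].
  { apply Rmin_pos; [lra|]. apply Rmult_lt_0_compat; nra. }
  exists d; split; auto. intros w Hw. specialize (K w Hw).
  assert (K1 := Rlt_le_trans _ _ _ K (Rmin_l _ _)).
  assert (K2 := Rlt_le_trans _ _ _ K (Rmin_r _ _)).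
  assert (Hw2 : m / 2 < Cmod (f w)).
  { assert (H := Cmod_ge_sub (f z) (f w)). rewrite Cmod_sub_sym in H. fold m in H. lra. }
  assert (Hfw : f w <> 0%C) by (apply Cmod_gt_0; lra).
  replace (/ f w - / f z)%C with (- (f w - f z) * / (f w * f z))%C by (field; auto).
  rewrite Cmod_mult, Cmod_opp, Cmod_inv, Cmod_mult by (apply Cmult_neq_0; auto).
  fold m. apply (Rmult_lt_reg_r (Cmod (f w) * m)); [nra|].
  rewrite Rmult_assoc, Rinv_l by nra.
  assert (e * m * (m / 2) <= e * m * Cmod (f w)) by (apply Rmult_le_compat_l; nra).
  nra.
Qed.

(** Caratheodory's form of the derivative: the slope is a function continuous at [z]. It reduces the
    sum, product, chain and inverse rules to rules for continuity, and supplies the difference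
    quotient used for Cauchy's formula. *)
Lemma cderiv_slope (f : C -> C) (z l : C) :
  cderiv f z l <->
  exists g, (forall w, f w = f z + g w * (w - z))%C /\ ccont g z /\ g z = l.
Proof.
  split.
  - intros H.
    exists (fun w => if Ceq_dec w z then l else ((f w - f z) / (w - z))%C).
    assert (E : (if Ceq_dec z z then l else ((f z - f z) / (z - z))%C) = l)
      by (destruct (Ceq_dec z z); congruence).
    split; [|split].
    + intros w. destruct (Ceq_dec w z) as [->|n]; [ring|].
      field. intros K. apply n, Csub_0_eq, K.
    + intros e He. destruct (H (e/2)) as [d [Hd K]]; [lra|]. exists d; split; auto.
      intros w Hw. rewrite E. destruct (Ceq_dec w z) as [->|n].
      * rewrite Cmod_self; lra.
      * specialize (K w Hw).
        assert (Hp : (w - z)%C <> 0%C) by (intros K1; apply n, Csub_0_eq, K1).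
        replace ((f w - f z) / (w - z) - l)%C with ((f w - f z - l * (w - z)) / (w - z))%C
          by (field; auto).
        rewrite Cmod_div by auto. assert (Hq := proj1 (Cmod_gt_0 _) Hp).
        apply Rle_lt_trans with (e/2); [|lra].
        apply (Rmult_le_reg_r (Cmod (w - z))); auto. unfold Rdiv at 1.
        rewrite Rmult_assoc, Rinv_l by lra. lra.
    + exact E.
  - intros [g [Hg [Hc <-]]] e He. destruct (Hc e He) as [d [Hd K]]. exists d; split; auto.
    intros w Hw. rewrite (Hg w).
    replace (f z + g w * (w - z) - f z - g z * (w - z))%C with ((g w - g z) * (w - z))%C by ring.
    rewrite Cmod_mult. specialize (K w Hw). apply Rmult_le_compat_r; [apply Cmod_ge_0|lra].
Qed.

Lemma cderiv_ccont (f : C -> C) (z l : C) : cderiv f z l -> ccont f z.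
Proof.
  intros H e He. destruct (H 1 Rlt_0_1) as [d [Hd K]].
  assert (Hl := Cmod_ge_0 l).
  exists (Rmin d (e / (Cmod l + 2))). split.
  { apply Rmin_pos; auto. apply Rdiv_lt_0_compat; lra. }
  intros w Hw. assert (K1 := K w ltac:(eapply Rlt_le_trans; [exact Hw | apply Rmin_l])).
  assert (K2 := Rlt_le_trans _ _ _ Hw (Rmin_r _ _)).
  apply (Rmult_lt_compat_r (Cmod l + 2)) in K2; [|lra].
  unfold Rdiv in K2. rewrite Rmult_assoc, Rinv_l in K2 by lra.
  replace (f w - f z)%C with ((f w - f z - l * (w - z)) + l * (w - z))%C by ring.
  eapply Rle_lt_trans; [apply Cmod_triangle|]. rewrite Cmod_mult.
  assert (Hq := Cmod_ge_0 (w - z)). nra.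
Qed.

Lemma cderivable_ccont (f : C -> C) (z : C) : cderivable f z -> ccont f z.
Proof. intros [l H]. exact (cderiv_ccont f z l H). Qed.

Lemma cderiv_loc (f g : C -> C) (z l : C) (r : R) :
  0 < r -> (forall w, Cmod (w - z) < r -> f w = g w) -> cderiv f z l -> cderiv g z l.
Proof.
  intros Hr E H e He. destruct (H e He) as [d [Hd K]]. exists (Rmin r d).
  split; [apply Rmin_pos; auto|]. intros w Hw.
  rewrite <- !E.
  - apply K. eapply Rlt_le_trans; [exact Hw | apply Rmin_r].
  - rewrite Cmod_self; lra.
  - eapply Rlt_le_trans; [exact Hw | apply Rmin_l].
Qed.

Lemma cderivable_loc (f g : C -> C) (z : C) (r : R) :
  0 < r -> (forall w, Cmod (w - z) < r -> f w = g w) -> cderivable f z -> cderivable g z.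
Proof. intros Hr E [l H]. exists l. exact (cderiv_loc f g z l r Hr E H). Qed.

Lemma cderiv_eq (f : C -> C) (z l m : C) : cderiv f z l -> l = m -> cderiv f z m.
Proof. now intros H <-. Qed.

Lemma rderiv_eq (g : R -> C) (t : R) (v w : C) : rderiv g t v -> v = w -> rderiv g t w.
Proof. now intros H <-. Qed.

Lemma cderiv_const (c z : C) : cderiv (fun _ => c) z 0.
Proof.
  apply cderiv_slope. exists (fun _ => 0%C). repeat split; [intros; ring | apply ccont_const].
Qed.

Lemma cderiv_id (z : C) : cderiv (fun w => w) z 1.
Proof.
  apply cderiv_slope. exists (fun _ => 1%C). repeat split; [intros; ring | apply ccont_const].
Qed.

Lemma cderiv_plus (f g : C -> C) (z l m : C) :
  cderiv f z l -> cderiv g z m -> cderiv (fun w => f w + g w)%C z (l + m).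
Proof.
  intros Hf Hg. apply cderiv_slope in Hf, Hg. apply cderiv_slope.
  destruct Hf as [p [Hp [Cp <-]]]. destruct Hg as [q [Hq [Cq <-]]].
  exists (fun w => p w + q w)%C. repeat split.
  - intros w. rewrite (Hp w), (Hq w). ring.
  - apply ccont_plus; auto.
Qed.

Lemma cderiv_mult (f g : C -> C) (z l m : C) :
  cderiv f z l -> cderiv g z m -> cderiv (fun w => f w * g w)%C z (l * g z + f z * m).
Proof.
  intros Hf Hg. assert (Cg := cderiv_ccont _ _ _ Hg).
  apply cderiv_slope in Hf, Hg. apply cderiv_slope.
  destruct Hf as [p [Hp [Cp <-]]]. destruct Hg as [q [Hq [Cq <-]]].
  exists (fun w => p w * g w + f z * q w)%C. repeat split.
  - intros w. rewrite (Hp w) at 1. rewrite (Hq w). ring.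
  - apply ccont_plus; apply ccont_mult; auto. apply ccont_const.
Qed.

Lemma cderiv_opp (f : C -> C) (z l : C) : cderiv f z l -> cderiv (fun w => - f w)%C z (- l).
Proof.
  intros Hf. apply cderiv_slope in Hf. apply cderiv_slope.
  destruct Hf as [p [Hp [Cp <-]]]. exists (fun w => - p w)%C. repeat split.
  - intros w. rewrite (Hp w). ring.
  - apply ccont_opp; auto.
Qed.

Lemma cderiv_minus (f g : C -> C) (z l m : C) :
  cderiv f z l -> cderiv g z m -> cderiv (fun w => f w - g w)%C z (l - m).
Proof. intros Hf Hg. apply cderiv_plus; auto. apply cderiv_opp; auto. Qed.

Lemma cderiv_comp (f g : C -> C) (z l m : C) :
  cderiv g z m -> cderiv f (g z) l -> cderiv (fun w => f (g w)) z (l * m).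
Proof.
  intros Hg Hf. assert (Cg := cderiv_ccont _ _ _ Hg).
  apply cderiv_slope in Hf, Hg. apply cderiv_slope.
  destruct Hf as [p [Hp [Cp <-]]]. destruct Hg as [q [Hq [Cq <-]]].
  exists (fun w => p (g w) * q w)%C. repeat split.
  - intros w. rewrite (Hp (g w)). rewrite (Hq w) at 2. ring.
  - apply ccont_mult; auto. apply (ccont_comp p g); auto.
Qed.

Lemma cderiv_inv (f : C -> C) (z l : C) :
  f z <> 0%C -> cderiv f z l -> cderiv (fun w => / f w)%C z (- l / (f z * f z)).
Proof.
  intros Hz Hf. assert (Cf := cderiv_ccont _ _ _ Hf).
  assert (Hm := proj1 (Cmod_gt_0 _) Hz).
  destruct (Cf _ Hm) as [d [Hd K]].
  assert (N : forall w, Cmod (w - z) < d -> f w <> 0%C).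
  { intros w Hw E. specialize (K w Hw). rewrite E in K.
    replace (0 - f z)%C with (- f z)%C in K by ring. rewrite Cmod_opp in K. lra. }
  apply cderiv_slope in Hf. destruct Hf as [p [Hp [Cp <-]]].
  apply cderiv_loc with (r := d) (f := fun w => (/ f z + (- p w / (f w * f z)) * (w - z))%C); auto.
  { intros w Hw. rewrite (Hp w) at 1 2. rewrite <- (Hp w).
    assert (E : f w = (f z + p w * (w - z))%C) by apply Hp.
    assert (f w <> 0%C) by auto.
    replace (- p w / (f w * f z) * (w - z))%C with ((f z - f w) / (f w * f z))%C.
    - field; auto.
    - rewrite E at 1. field; auto. }
  apply cderiv_slope. exists (fun w => (- p w / (f w * f z))%C). repeat split.
  - intros w. ring.
  - apply ccont_mult; [apply ccont_opp; auto|]. apply ccont_inv.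
    + apply Cmult_neq_0; auto.
    + apply ccont_mult; auto. apply ccont_const.
Qed.

Lemma cderivable_const (c z : C) : cderivable (fun _ => c) z.
Proof. eexists; apply cderiv_const. Qed.
Lemma cderivable_id (z : C) : cderivable (fun w => w) z.
Proof. eexists; apply cderiv_id. Qed.
Lemma cderivable_plus (f g : C -> C) (z : C) : cderivable f z -> cderivable g z -> cderivable (fun w => f w + g w)%C z.
Proof. intros [l H] [m K]. eexists; apply cderiv_plus; eauto. Qed.
Lemma cderivable_minus (f g : C -> C) (z : C) : cderivable f z -> cderivable g z -> cderivable (fun w => f w - g w)%C z.
Proof. intros [l H] [m K]. eexists; apply cderiv_minus; eauto. Qed.
Lemma cderivable_mult (f g : C -> C) (z : C) : cderivable f z -> cderivable g z -> cderivable (fun w => f w * g w)%C z.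
Proof. intros [l H] [m K]. eexists; apply cderiv_mult; eauto. Qed.
Lemma cderivable_comp (f g : C -> C) (z : C) : cderivable g z -> cderivable f (g z) -> cderivable (fun w => f (g w)) z.
Proof. intros [l H] [m K]. eexists; apply cderiv_comp; eauto. Qed.
Lemma cderivable_inv (f : C -> C) (z : C) : f z <> 0%C -> cderivable f z -> cderivable (fun w => / f w)%C z.
Proof. intros N [l H]. eexists; apply cderiv_inv; eauto. Qed.
Lemma cderivable_div (f g : C -> C) (z : C) :
  g z <> 0%C -> cderivable f z -> cderivable g z -> cderivable (fun w => f w / g w)%C z.
Proof. intros N F G. apply cderivable_mult; auto. apply cderivable_inv; auto. Qed.
Lemma cderivable_pow (f : C -> C) (n : nat) (z : C) : cderivable f z -> cderivable (fun w => f w ^ n)%C z.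
Proof.
  intros F. induction n as [|n IH]; [apply (cderivable_const 1)|].
  apply (cderivable_mult f (fun w => f w ^ n)%C); auto.
Qed.

(** [cdiff] only ever occurs as something given, so the filter derivative has to be unpacked but
    never rebuilt. *)
Lemma cdiff_cderivable (f : C -> C) (z : C) : cdiff f z -> cderivable f z.
Proof.
  intros [l [_ H]]. exists l. intros e He.
  specialize (H z (fun P HP => HP) (mkposreal e He)). 
  destruct (locally_le_locally_norm (V := AbsRing_NormedModule C_AbsRing) z _ H) as [d K].
  exists d. split; [apply cond_pos|]. intros w Hw. specialize (K w Hw).
  replace (l * (w - z))%C with ((w - z) * l)%C by ring. exact K.
Qed.

Lemma is_derive_eps (f : R -> R) (t l : R) :
  is_derive f t l <->
  forall eps, 0 < eps -> exists d, 0 < d /\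
    forall s, Rabs (s - t) < d -> Rabs (f s - f t - l * (s - t)) <= eps * Rabs (s - t).
Proof.
  split.
  - intros [_ H] e He. destruct (H t (fun P HP => HP) (mkposreal e He)) as [d K].
    exists d. split; [apply cond_pos|]. intros s Hs. specialize (K s Hs).
    replace (l * (s - t)) with ((s - t) * l) by ring. exact K.
  - intros H. split; [apply is_linear_scal_l|]. intros x Hx.
    apply (is_filter_lim_locally_unique (V := R_NormedModule)) in Hx. subst x.
    intros [e He]. destruct (H e He) as [d [Hd K]].
    exists (mkposreal d Hd). intros s Hs. specialize (K s Hs).
    replace (l * (s - t)) with ((s - t) * l) in K by ring. exact K.
Qed.

Lemma rderiv_eps (g : R -> C) (t : R) (v : C) :
  rderiv g t v <->
  forall eps, 0 < eps -> exists d, 0 < d /\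
    forall s, Rabs (s - t) < d ->
      Cmod (g s - g t - v * RtoC (s - t)) <= eps * Rabs (s - t).
Proof.
  assert (ER : forall s, Re (g s - g t - v * RtoC (s - t)) = Re (g s) - Re (g t) - Re v * (s - t))
    by (intros; destruct v, (g s), (g t); simpl; ring).
  assert (EI : forall s, Im (g s - g t - v * RtoC (s - t)) = Im (g s) - Im (g t) - Im v * (s - t))
    by (intros; destruct v, (g s), (g t); simpl; ring).
  split.
  - intros [HR HI] e He. rewrite is_derive_eps in HR, HI.
    destruct (HR (e/2)) as [d1 [H1 K1]]; [lra|].
    destruct (HI (e/2)) as [d2 [H2 K2]]; [lra|].
    exists (Rmin d1 d2). split; [apply Rmin_pos; lra|]. intros s Hs.
    assert (A := K1 s ltac:(eapply Rlt_le_trans; [exact Hs | apply Rmin_l])).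
    assert (B := K2 s ltac:(eapply Rlt_le_trans; [exact Hs | apply Rmin_r])).
    eapply Rle_trans; [apply Cmod_le_ReIm|]. rewrite ER, EI. lra.
  - intros H. split; apply is_derive_eps; intros e He;
      destruct (H e He) as [d [Hd K]]; exists d; (split; [auto|]); intros s Hs.
    + rewrite <- ER. eapply Rle_trans; [apply re_le_Cmod | auto].
    + rewrite <- EI. eapply Rle_trans; [apply im_le_Cmod | auto].
Qed.

Lemma rderiv_comp (f : C -> C) (g : R -> C) (t : R) (l v : C) :
  cderiv f (g t) l -> rderiv g t v -> rderiv (fun s => f (g s)) t (l * v).
Proof.
  intros Hf Hg. rewrite rderiv_eps in Hg. apply rderiv_eps. intros e He.
  assert (Hv := Cmod_ge_0 v). assert (Hl := Cmod_ge_0 l).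
  assert (He1 : 0 < e / 2 / (Cmod v + 1)) by (repeat apply Rdiv_lt_0_compat; lra).
  assert (He2 : 0 < e / 2 / (Cmod l + 1)) by (repeat apply Rdiv_lt_0_compat; lra).
  destruct (Hf _ He1) as [d1 [H1 K1]].
  destruct (Hg 1 Rlt_0_1) as [d2 [H2 K2]].
  destruct (Hg _ He2) as [d3 [H3 K3]].
  exists (Rmin (Rmin d2 d3) (d1 / (Cmod v + 1))). split.
  { repeat apply Rmin_pos; auto. apply Rdiv_lt_0_compat; lra. }
  intros s Hs.
  assert (S1 := Rlt_le_trans _ _ _ Hs (Rmin_r _ _)).
  assert (S23 := Rlt_le_trans _ _ _ Hs (Rmin_l _ _)).
  assert (A2 := K2 s (Rlt_le_trans _ _ _ S23 (Rmin_l _ _))).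
  assert (A3 := K3 s (Rlt_le_trans _ _ _ S23 (Rmin_r _ _))).
  assert (L : Cmod (g s - g t) <= (Cmod v + 1) * Rabs (s - t)).
  { replace (g s - g t)%C with ((g s - g t - v * RtoC (s - t)) + v * RtoC (s - t))%C by ring.
    eapply Rle_trans; [apply Cmod_triangle|]. rewrite (Cmod_mult v), Cmod_R. lra. }
  assert (S : Cmod (g s - g t) < d1).
  { eapply Rle_lt_trans; [exact L|].
    apply (Rmult_lt_compat_l (Cmod v + 1)) in S1; [|lra].
    replace ((Cmod v + 1) * (d1 / (Cmod v + 1))) with d1 in S1 by (field; lra). exact S1. }
  specialize (K1 _ S).
  replace (f (g s) - f (g t) - l * v * RtoC (s - t))%C
    with ((f (g s) - f (g t) - l * (g s - g t)) + l * (g s - g t - v * RtoC (s - t)))%C by ring.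
  eapply Rle_trans; [apply Cmod_triangle|]. rewrite (Cmod_mult l).
  assert (Q := Rabs_pos (s - t)).
  assert (B1 : Cmod (f (g s) - f (g t) - l * (g s - g t)) <= e / 2 * Rabs (s - t)).
  { eapply Rle_trans; [exact K1|].
    apply (Rmult_le_compat_l (e / 2 / (Cmod v + 1))) in L; [|lra].
    replace (e / 2 / (Cmod v + 1) * ((Cmod v + 1) * Rabs (s - t))) with (e / 2 * Rabs (s - t))
      in L by (field; lra). exact L. }
  assert (B2 : Cmod l * Cmod (g s - g t - v * RtoC (s - t)) <= e / 2 * Rabs (s - t)).
  { apply (Rmult_le_compat_l (Cmod l)) in A3; [|lra]. eapply Rle_trans; [exact A3|].
    replace (e / 2 * Rabs (s - t))
      with ((Cmod l + 1) * (e / 2 / (Cmod l + 1) * Rabs (s - t))) by (field; lra).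
    apply Rmult_le_compat_r; [|lra]. apply Rmult_le_pos; lra. }
  lra.
Qed.

Lemma rderiv_plus (f g : R -> C) (t : R) (v w : C) :
  rderiv f t v -> rderiv g t w -> rderiv (fun s => f s + g s)%C t (v + w).
Proof.
  intros [A B] [A' B']. split.
  - apply (is_derive_plus (K := R_AbsRing) _ _ _ _ _ A A').
  - apply (is_derive_plus (K := R_AbsRing) _ _ _ _ _ B B').
Qed.

Lemma rderiv_cmult (c : C) (g : R -> C) (t : R) (v : C) :
  rderiv g t v -> rderiv (fun s => c * g s)%C t (c * v).
Proof.
  intros H. apply (rderiv_comp (fun z => c * z)%C g t c v); auto.
  assert (K := cderiv_mult _ _ _ _ _ (cderiv_const c (g t)) (cderiv_id (g t))).
  apply (cderiv_eq _ _ _ _ K). simpl. ring.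
Qed.

Lemma rderiv_seg (p v : C) (t : R) : rderiv (fun s => p + RtoC s * v)%C t v.
Proof.
  apply rderiv_eps. intros e He. exists 1. split; [lra|]. intros s _.
  replace (p + s * v - (p + t * v) - v * (s - t)%R)%C with (RtoC 0) by (rewrite RtoC_minus; ring).
  rewrite Cmod_0. apply Rmult_le_pos; [lra | apply Rabs_pos].
Qed.

Lemma rderiv_ext (f g : R -> C) (t : R) (v : C) :
  (forall s, f s = g s) -> rderiv f t v -> rderiv g t v.
Proof.
  intros E [A B]. split.
  - eapply is_derive_ext; [|exact A]. intros s; simpl. now rewrite E.
  - eapply is_derive_ext; [|exact B]. intros s; simpl. now rewrite E.
Qed.

(* Apply the real mean value theorem to [Re (conj v * g)] with [v = g b - g a]. *)
Lemma mean_value_ineq (g g' : R -> C) (a b M : R) :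
  a <= b -> (forall t, a <= t <= b -> rderiv g t (g' t)) ->
  (forall t, a <= t <= b -> Cmod (g' t) <= M) ->
  Cmod (g b - g a) <= M * (b - a).
Proof.
  intros Hab Hd HM. set (v := (g b - g a)%C).
  set (h := fun t => Re v * Re (g t) + Im v * Im (g t)).
  set (h' := fun t => Re v * Re (g' t) + Im v * Im (g' t)).
  assert (Hh : forall t, a <= t <= b -> is_derive h t (h' t)).
  { intros t Ht. destruct (Hd t Ht) as [A B].
    apply (is_derive_plus (K := R_AbsRing) (fun s => Re v * Re (g s)) (fun s => Im v * Im (g s))).
    - apply (is_derive_scal (fun s => Re (g s)) t (Re v) (Re (g' t))). exact A.
    - apply (is_derive_scal (fun s => Im (g s)) t (Im v) (Im (g' t))). exact B. }
  destruct (MVT_gen h a b h') as [c [Hc E]].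
  { rewrite Rmin_left, Rmax_right by auto. intros t Ht. apply Hh. lra. }
  { rewrite Rmin_left, Rmax_right by auto. intros t Ht.
    apply derivable_continuous_pt. exists (h' t). apply is_derive_Reals, Hh. lra. }
  rewrite Rmin_left, Rmax_right in Hc by auto.
  assert (Ev : h b - h a = Cmod v * Cmod v).
  { rewrite Cmod_sqr. unfold h. unfold v at 5 6 7 8.
    destruct (g b), (g a). simpl. ring. }
  assert (Hcs : h' c <= Cmod v * Cmod (g' c)).
  { replace (h' c) with (Re (Cconj v * g' c)) by (unfold h'; destruct v, (g' c); simpl; ring).
    rewrite <- (Cmod_conj v), <- Cmod_mult.
    eapply Rle_trans; [apply Rle_abs | apply re_le_Cmod]. }
  assert (H1 := HM c Hc). assert (Hv := Cmod_ge_0 v).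
  destruct (Req_dec (Cmod v) 0) as [->|N].
  - apply Rmult_le_pos; [|lra]. eapply Rle_trans; [apply Cmod_ge_0 | exact H1].
  - apply (Rmult_le_reg_l (Cmod v)); [lra|]. rewrite <- Ev, E.
    apply Rle_trans with (Cmod v * Cmod (g' c) * (b - a)).
    + apply Rmult_le_compat_r; lra.
    + rewrite !Rmult_assoc. apply Rmult_le_compat_l; [lra|]. apply Rmult_le_compat_r; lra.
Qed.

Lemma rderiv_zero_const (g : R -> C) (a b : R) :
  a <= b -> (forall t, a <= t <= b -> rderiv g t 0) -> g b = g a.
Proof.
  intros Hab H. apply Cmod_zero_eq.
  assert (K := mean_value_ineq g (fun _ => 0%C) a b 0 Hab H).
  rewrite Rmult_0_l in K. apply K. intros t _. rewrite Cmod_0. lra.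
Qed.

(** * Goursat's theorem *)


Lemma continuous_eps (h : R -> R) (t : R) :
  (forall eps, 0 < eps -> exists d, 0 < d /\
     forall s, Rabs (s - t) < d -> Rabs (h s - h t) < eps) ->
  continuous h t.
Proof.
  intros H. apply filterlim_locally. intros [e He].
  destruct (H e He) as [d [Hd K]]. exists (mkposreal d Hd). intros s Hs. apply K, Hs.
Qed.

Lemma continuous_comp_seg (f : C -> C) (p v : C) (t : R) :
  ccont f (p + RtoC t * v)%C ->
  continuous (fun s => Re (f (p + RtoC s * v)%C)) t /\
  continuous (fun s => Im (f (p + RtoC s * v)%C)) t.
Proof.
  intros H.
  assert (K : forall eps, 0 < eps -> exists d, 0 < d /\ forall s, Rabs (s - t) < d ->
    Cmod (f (p + RtoC s * v)%C - f (p + RtoC t * v)%C) < eps).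
  { intros e He. destruct (H e He) as [d [Hd K]]. assert (Hv := Cmod_ge_0 v).
    exists (d / (Cmod v + 1)). split; [apply Rdiv_lt_0_compat; lra|]. intros s Hs. apply K.
    replace (p + s * v - (p + t * v))%C with (RtoC (s - t) * v)%C by (rewrite RtoC_minus; ring).
    rewrite Cmod_mult, Cmod_R. apply (Rmult_lt_compat_r (Cmod v + 1)) in Hs; [|lra].
    unfold Rdiv in Hs. rewrite Rmult_assoc, Rinv_l in Hs by lra.
    assert (Q := Rabs_pos (s - t)). nra. }
  split; apply continuous_eps; intros e He; destruct (K e He) as [d [Hd K']]; exists d;
    (split; [auto|]); intros s Hs; specialize (K' s Hs).
  - eapply Rle_lt_trans; [|exact K']. eapply Rle_trans; [|apply re_le_Cmod].
    right. f_equal.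
  - eapply Rle_lt_trans; [|exact K']. eapply Rle_trans; [|apply im_le_Cmod].
    right. f_equal.
Qed.

(** * Integrals along segments *)

Definition cint (g : R -> C) : C :=
  (RInt (fun t => Re (g t)) 0 1, RInt (fun t => Im (g t)) 0 1).

Definition seg_int (f : C -> C) (p q : C) : C :=
  ((q - p) * cint (fun t => f (p + RtoC t * (q - p))))%C.

Definition seg_cont (f : C -> C) (p q : C) : Prop :=
  forall t, 0 <= t <= 1 -> ccont f (p + RtoC t * (q - p))%C.

Lemma ex_RInt_01 (h : R -> R) :
  (forall t, 0 <= t <= 1 -> continuous h t) -> ex_RInt h 0 1.
Proof.
  intros H. apply (ex_RInt_continuous (V := R_CompleteNormedModule)).
  rewrite Rmin_left, Rmax_right by lra. exact H.
Qed.

Lemma seg_ex_RInt (f : C -> C) (p q : C) : seg_cont f p q ->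
  ex_RInt (fun t => Re (f (p + RtoC t * (q - p))%C)) 0 1 /\
  ex_RInt (fun t => Im (f (p + RtoC t * (q - p))%C)) 0 1.
Proof.
  intros H. split; apply ex_RInt_01; intros t Ht; apply (continuous_comp_seg f p (q - p)%C t), H, Ht.
Qed.

(** The arguments keep the shape [u * t + v] of [RInt_comp_lin], hence the term [+ 0]. *)
Lemma RInt_halves (h h1 h2 : R -> R) :
  ex_RInt h 0 1 ->
  (forall t, h1 t = h (/2 * t + 0)) -> (forall t, h2 t = h (/2 * t + /2)) ->
  RInt h 0 1 = /2 * (RInt h1 0 1 + RInt h2 0 1).
Proof.
  intros H E1 E2.
  assert (A : ex_RInt h 0 (/2)) by (apply (ex_RInt_Chasles_1 h 0 (/2) 1); auto; lra).
  assert (B : ex_RInt h (/2) 1) by (apply (ex_RInt_Chasles_2 h 0 (/2) 1); auto; lra).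
  rewrite <- (RInt_Chasles h 0 (/2) 1 A B).
  assert (P : forall (k : R -> R) v a b, ex_RInt h a b -> /2 * 0 + v = a -> /2 * 1 + v = b ->
     (forall t, k t = h (/2 * t + v)) -> RInt h a b = /2 * RInt k 0 1).
  { intros k v a b X Ea Eb Ek. subst a b.
    rewrite <- (RInt_comp_lin h (/2) v 0 1 X).
    rewrite (RInt_scal (V := R_CompleteNormedModule)) .
    - unfold scal; simpl; unfold mult; simpl. f_equal. apply RInt_ext. intros; auto.
    - apply (ex_RInt_comp_lin h (/2) v 0 1) in X.
      apply (ex_RInt_scal _ _ _ 2) in X. eapply ex_RInt_ext; [|exact X].
      intros x _. unfold scal; simpl; unfold mult; simpl. field. }
  rewrite (P h1 0 0 (/2)), (P h2 (/2) (/2) 1); auto; try lra.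
  unfold plus; simpl. ring.
Qed.

Lemma RInt_reverse (h h1 : R -> R) :
  ex_RInt h 0 1 -> (forall t, h1 t = h (-1 * t + 1)) -> RInt h1 0 1 = RInt h 0 1.
Proof.
  intros H E.
  assert (X : ex_RInt h (-1 * 0 + 1) (-1 * 1 + 1)).
  { replace (-1 * 0 + 1) with 1 by ring. replace (-1 * 1 + 1) with 0 by ring. now apply ex_RInt_swap. }
  assert (K := RInt_comp_lin h (-1) 1 0 1 X).
  replace (-1 * 0 + 1) with 1 in K by ring. replace (-1 * 1 + 1) with 0 in K by ring.
  rewrite <- (opp_RInt_swap h 0 1 ) in K by auto.
  assert (X' := ex_RInt_comp_lin h (-1) 1 0 1 X).
  rewrite (RInt_ext _ (fun y => opp (h1 y))) in K.
  - rewrite (RInt_opp (V := R_CompleteNormedModule) h1) in K.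
    + unfold opp in K; simpl in K. lra.
    + apply ex_RInt_opp in X'. eapply ex_RInt_ext; [|exact X'].
      intros x _. rewrite E. unfold opp, scal; simpl; unfold mult; simpl. ring.
  - intros x _. rewrite E. unfold opp, scal; simpl; unfold mult; simpl. ring.
Qed.

Lemma seg_int_mid (f : C -> C) (p q m : C) :
  m = ((p + q) / 2)%C -> seg_cont f p q ->
  seg_int f p q = (seg_int f p m + seg_int f m q)%C.
Proof.
  intros -> H. destruct (seg_ex_RInt f p q H) as [A B].
  unfold seg_int.
  replace ((p + q) / 2 - p)%C with ((q - p) / 2)%C by field.
  replace (q - (p + q) / 2)%C with ((q - p) / 2)%C by field.
  assert (E1 : forall t, (p + RtoC t * ((q - p) / 2) = p + RtoC (/2 * t + 0) * (q - p))%C).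
  { intros t. rewrite RtoC_plus, RtoC_mult, RtoC_inv by lra. field. }
  assert (E2 : forall t, ((p + q) / 2 + RtoC t * ((q - p) / 2) = p + RtoC (/2 * t + /2) * (q - p))%C).
  { intros t. rewrite RtoC_plus, RtoC_mult, RtoC_inv by lra. field. }
  assert (E : cint (fun t => f (p + RtoC t * (q - p))%C) =
    (/ 2 * (cint (fun t => f (p + RtoC t * ((q - p) / 2))%C) +
      cint (fun t => f ((p + q) / 2 + RtoC t * ((q - p) / 2))%C)))%C).
  { unfold cint.
    rewrite (RInt_halves _ (fun t => Re (f (p + RtoC t * ((q - p) / 2))%C))
       (fun t => Re (f ((p + q) / 2 + RtoC t * ((q - p) / 2))%C)) A)
      by (intros; now rewrite ?E1, ?E2).
    rewrite (RInt_halves _ (fun t => Im (f (p + RtoC t * ((q - p) / 2))%C))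
       (fun t => Im (f ((p + q) / 2 + RtoC t * ((q - p) / 2))%C)) B)
      by (intros; now rewrite ?E1, ?E2).
    apply C_ext; simpl; field. }
  rewrite E. field.
Qed.

Lemma seg_int_swap (f : C -> C) (p q : C) :
  seg_cont f p q -> seg_int f q p = (- seg_int f p q)%C.
Proof.
  intros H. destruct (seg_ex_RInt f p q H) as [A B]. unfold seg_int.
  assert (E : forall t, (q + RtoC t * (p - q) = p + RtoC (-1 * t + 1) * (q - p))%C).
  { intros t. replace (-1 * t + 1) with (1 - t) by ring. rewrite RtoC_minus. ring. }
  replace (cint (fun t => f (q + RtoC t * (p - q))%C)) with (cint (fun t => f (p + RtoC t * (q - p))%C)).
  { ring. }
  unfold cint. f_equal; symmetry; apply RInt_reverse; auto; intros; now rewrite E.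
Qed.

(** The factor 2 comes from bounding the real and imaginary parts separately; every use only needs a
    constant. *)
Lemma seg_int_bound (f : C -> C) (p q : C) (M : R) :
  seg_cont f p q ->
  (forall t, 0 <= t <= 1 -> Cmod (f (p + RtoC t * (q - p))%C) <= M) ->
  Cmod (seg_int f p q) <= 2 * M * Cmod (q - p).
Proof.
  intros H HM. destruct (seg_ex_RInt f p q H) as [A B]. unfold seg_int. rewrite Cmod_mult.
  assert (X : Cmod (cint (fun t => f (p + RtoC t * (q - p))%C)) <= 2 * M).
  { eapply Rle_trans; [apply Cmod_le_ReIm|]. unfold cint; simpl.
    assert (R1 := abs_RInt_le_const _ 0 1 M ltac:(lra) A).
    assert (R2 := abs_RInt_le_const _ 0 1 M ltac:(lra) B).
    assert (Rabs (RInt (fun t : R => Re (f (p + t * (q - p))%C)) 0 1) <= (1 - 0) * M).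
    { apply R1. intros t Ht. eapply Rle_trans; [apply re_le_Cmod | auto]. }
    assert (Rabs (RInt (fun t : R => Im (f (p + t * (q - p))%C)) 0 1) <= (1 - 0) * M).
    { apply R2. intros t Ht. eapply Rle_trans; [apply im_le_Cmod | auto]. }
    lra. }
  assert (Hq := Cmod_ge_0 (q - p)). nra.
Qed.

Lemma seg_int_minus (f g : C -> C) (p q : C) :
  seg_cont f p q -> seg_cont g p q ->
  seg_int (fun z => f z - g z)%C p q = (seg_int f p q - seg_int g p q)%C.
Proof.
  intros Hf Hg. destruct (seg_ex_RInt f p q Hf) as [A B].
  destruct (seg_ex_RInt g p q Hg) as [A' B']. unfold seg_int.
  assert (E : cint (fun t => f (p + RtoC t * (q - p)) - g (p + RtoC t * (q - p)))%C =
    (cint (fun t => f (p + RtoC t * (q - p))) - cint (fun t => g (p + RtoC t * (q - p))))%C).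
  { unfold cint. apply C_ext; simpl.
    - apply (RInt_minus (V := R_CompleteNormedModule) _ _ _ _ A A').
    - apply (RInt_minus (V := R_CompleteNormedModule) _ _ _ _ B B'). }
  rewrite E. ring.
Qed.

Lemma RInt_affine (a b : R) : RInt (fun t => a + t * b) 0 1 = a + b / 2.
Proof.
  apply is_RInt_unique.
  replace (a + b / 2) with (minus ((fun t => a * t + t * t * b / 2) 1) ((fun t => a * t + t * t * b / 2) 0))
    by (unfold minus, plus, opp; simpl; field).
  apply (is_RInt_derive (V := R_CompleteNormedModule) (fun t => a * t + t * t * b / 2)).
  - intros x _. auto_derive; auto. field.
  - intros x _. apply continuous_eps. intros e He. assert (Hb := Rabs_pos b).
    exists (e / (Rabs b + 1)). split; [apply Rdiv_lt_0_compat; lra|]. intros s Hs.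
    replace (a + s * b - (a + x * b)) with ((s - x) * b) by ring. rewrite Rabs_mult.
    apply (Rmult_lt_compat_r (Rabs b + 1)) in Hs; [|lra].
    unfold Rdiv in Hs. rewrite Rmult_assoc, Rinv_l in Hs by lra.
    assert (Q := Rabs_pos (s - x)). nra.
Qed.

(** The value is a difference of a primitive at [q] and at [p], so around a triangle the affine part
    of a function contributes nothing. *)
Lemma seg_int_affine (a b p q : C) :
  seg_int (fun z => a + b * z)%C p q = (a * (q - p) + b * (q * q - p * p) / 2)%C.
Proof.
  unfold seg_int.
  assert (E : cint (fun t => a + b * (p + RtoC t * (q - p)))%C = (a + b * p + b * (q - p) / 2)%C).
  { unfold cint. apply C_ext; simpl.
    - rewrite (RInt_ext _ (fun t => Re (a + b * p) + t * Re (b * (q - p)))).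
      + rewrite RInt_affine. destruct a, b, p, q; simpl. field.
      + intros x _. destruct a, b, p, q; simpl. ring.
    - rewrite (RInt_ext _ (fun t => Im (a + b * p) + t * Im (b * (q - p)))).
      + rewrite RInt_affine. destruct a, b, p, q; simpl. field.
      + intros x _. destruct a, b, p, q; simpl. ring. }
  rewrite E. field.
Qed.

Lemma geometric_cauchy_limit (s : nat -> R) :
  (forall n, Rabs (s (S n) - s n) <= (/2) ^ (S n)) ->
  exists l, forall n, Rabs (l - s n) <= (/2) ^ n.
Proof.
  intros H.
  (* Keeping the exact partial sum of the geometric series, not just [(/2) ^ n], is what lets the
     induction close. *)
  assert (K : forall n k, Rabs (s (n + k)%nat - s n) <= (/2) ^ n - (/2) ^ (n + k)).
  { intros n k. induction k as [|k IH].
    - rewrite Nat.add_0_r, !Rminus_diag, Rabs_R0. lra.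
    - rewrite Nat.add_succ_r.
      replace (s (S (n + k)) - s n) with ((s (S (n + k)) - s (n + k)%nat) + (s (n + k)%nat - s n)) by ring.
      eapply Rle_trans; [apply Rabs_triang|]. specialize (H (n + k)%nat). simpl in *. lra. }
  assert (Hpos : forall n, 0 < (/2) ^ n) by (intros; apply pow_lt; lra).
  assert (Hc : Cauchy_crit s).
  { intros e He. destruct (pow_lt_1_zero (/2) ltac:(rewrite Rabs_pos_eq; lra) (e/2) ltac:(lra)) as [N HN].
    exists N. intros n m Hn Hm. unfold Rdist.
    assert (A := HN N ltac:(lia)). rewrite Rabs_pos_eq in A by (left; auto).
    assert (B := K N (n - N)%nat). assert (B' := K N (m - N)%nat).
    replace (N + (n - N))%nat with n in B by lia. replace (N + (m - N))%nat with m in B' by lia.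
    assert (P1 := Hpos n). assert (P2 := Hpos m).
    replace (s n - s m) with ((s n - s N) - (s m - s N)) by ring.
    eapply Rle_lt_trans; [apply Rabs_triang|]. rewrite Rabs_Ropp. lra. }
  destruct (Rcomplete.R_complete s Hc) as [l Hl]. exists l. intros n.
  apply Rnot_lt_le. intros Hlt. destruct (Hl (Rabs (l - s n) - (/2) ^ n)) as [N HN]; [lra|].
  specialize (HN (n + N)%nat ltac:(lia)). specialize (K n N). assert (P1 := Hpos (n + N)%nat).
  unfold Rdist in HN.
  assert (Rabs (l - s n) <= Rabs (s (n + N)%nat - l) + Rabs (s (n + N)%nat - s n)).
  { replace (l - s n) with (- (s (n + N)%nat - l) + (s (n + N)%nat - s n)) by ring.
    eapply Rle_trans; [apply Rabs_triang|]. rewrite Rabs_Ropp. lra. }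
  lra.
Qed.

(** * Bisection of triangles *)

Definition tri_int (f : C -> C) (p q r : C) : C :=
  (seg_int f p q + seg_int f q r + seg_int f r p)%C.

(* The bisection acts on the parameters [(s, t, h)] of the triangle with vertices [tri_point s t],
   [tri_point (s + h) t], [tri_point s (t + h)], of signed size [h]: limits then stay in the closed triangle,
   even when it is degenerate. *)
Definition tri_point (a v w : C) (s t : R) : C := (a + RtoC s * v + RtoC t * w)%C.

Definition tri_param (f : C -> C) (a v w : C) (x : R * R * R) : C :=
  let '(s, t, h) := x in
  tri_int f (tri_point a v w s t) (tri_point a v w (s + h) t) (tri_point a v w s (t + h)).

(** The six inequalities place the three vertices in the standard simplex, for either sign of
    [h]. *)
Definition tri_valid (x : R * R * R) : Prop :=
  let '(s, t, h) := x in
  0 <= s /\ 0 <= t /\ s + t <= 1 /\ 0 <= s + h /\ 0 <= t + h /\ s + h + t <= 1.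

Lemma tri_point_seg (a v w : C) (s t s' t' x : R) :
  (tri_point a v w s t + RtoC x * (tri_point a v w s' t' - tri_point a v w s t))%C =
  tri_point a v w (s + x * (s' - s)) (t + x * (t' - t)).
Proof.
  unfold tri_point. rewrite !RtoC_plus, !RtoC_mult, !RtoC_minus. ring.
Qed.

Section Goursat.
Variables (f : C -> C) (a v w : C).
Hypothesis Hc : forall s t, 0 <= s -> 0 <= t -> s + t <= 1 -> ccont f (tri_point a v w s t).
Let pt := tri_point a v w.

Lemma tri_point_seg_cont (s t s' t' : R) :
  0 <= s -> 0 <= t -> s + t <= 1 -> 0 <= s' -> 0 <= t' -> s' + t' <= 1 ->
  seg_cont f (pt s t) (pt s' t').
Proof.
  intros H1 H2 H3 H4 H5 H6 x Hx. unfold pt. rewrite tri_point_seg. apply Hc; nra.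
Qed.

(** The last piece is the inverted middle triangle, of size [- (h / 2)]. Its sides are the inner
    sides of the other three traversed backwards, so they cancel and only the halved outer sides
    remain. *)
Lemma tri_param_split (s t h : R) : tri_valid (s, t, h) ->
  tri_param f a v w (s, t, h) =
  (tri_param f a v w (s, t, h / 2)%R + tri_param f a v w (s + h / 2, t, h / 2)%R +
   tri_param f a v w (s, t + h / 2, h / 2)%R + tri_param f a v w (s + h / 2, t + h / 2, - (h / 2))%R)%C.
Proof.
  unfold tri_valid. intros (H1 & H2 & H3 & H4 & H5 & H6). unfold tri_param, tri_int. fold pt.
  replace (s + h / 2 + - (h / 2)) with s by ring.
  replace (t + h / 2 + - (h / 2)) with t by ring.
  replace (s + h / 2 + h / 2) with (s + h) by field.
  replace (t + h / 2 + h / 2) with (t + h) by field.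
  rewrite (seg_int_mid f (pt s t) (pt (s + h) t) (pt (s + h / 2) t));
    [ | unfold pt, tri_point; rewrite !RtoC_plus, RtoC_div by lra; field | apply tri_point_seg_cont; lra].
  rewrite (seg_int_mid f (pt (s + h) t) (pt s (t + h)) (pt (s + h / 2) (t + h / 2)));
    [ | unfold pt, tri_point; rewrite !RtoC_plus, RtoC_div by lra; field | apply tri_point_seg_cont; lra].
  rewrite (seg_int_mid f (pt s (t + h)) (pt s t) (pt s (t + h / 2)));
    [ | unfold pt, tri_point; rewrite !RtoC_plus, RtoC_div by lra; field | apply tri_point_seg_cont; lra].
  rewrite (seg_int_swap f (pt (s + h / 2) t) (pt s (t + h / 2))) by (apply tri_point_seg_cont; lra).
  rewrite (seg_int_swap f (pt s (t + h / 2)) (pt (s + h / 2) (t + h / 2))) by (apply tri_point_seg_cont; lra).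
  rewrite (seg_int_swap f (pt (s + h / 2) (t + h / 2)) (pt (s + h / 2) t)) by (apply tri_point_seg_cont; lra).
  ring.
Qed.

Definition tri_step (x : R * R * R) : R * R * R :=
  let '(s, t, h) := x in
  let m := Cmod (tri_param f a v w x) / 4 in
  let x1 := (s, t, h / 2) in
  let x2 := (s + h / 2, t, h / 2) in
  let x3 := (s, t + h / 2, h / 2) in
  let x4 := (s + h / 2, t + h / 2, - (h / 2)) in
  if Rle_dec m (Cmod (tri_param f a v w x1)) then x1 else
  if Rle_dec m (Cmod (tri_param f a v w x2)) then x2 else
  if Rle_dec m (Cmod (tri_param f a v w x3)) then x3 else x4.

Lemma tri_step_spec (s t h : R) : tri_valid (s, t, h) ->
  exists s' t' h', tri_step (s, t, h) = (s', t', h') /\ tri_valid (s', t', h') /\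
    Rabs h' = Rabs h / 2 /\ Rabs (s' - s) <= Rabs h / 2 /\ Rabs (t' - t) <= Rabs h / 2 /\
    Cmod (tri_param f a v w (s, t, h)) / 4 <= Cmod (tri_param f a v w (s', t', h')).
Proof.
  intros Hv. assert (E := tri_param_split s t h Hv).
  assert (Hh : Rabs (h / 2) = Rabs h / 2) by (unfold Rdiv; rewrite Rabs_mult, (Rabs_pos_eq (/2)); lra).
  assert (Hh' := Rabs_pos h).
  unfold tri_valid in Hv. unfold tri_step, tri_valid.
  destruct Rle_dec as [L|L1]; [|destruct Rle_dec as [L|L2]; [|destruct Rle_dec as [L|L3]]].
  - do 3 eexists. split; [reflexivity|]. split; [lra|]. split; [lra|].
    rewrite !Rminus_diag, !Rabs_R0. split; [lra|]. split; [lra|]. exact L.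
  - do 3 eexists. split; [reflexivity|]. split; [lra|]. split; [lra|].
    replace (s + h / 2 - s) with (h / 2) by ring.
    rewrite !Rminus_diag, !Rabs_R0. split; [lra|]. split; [lra|]. exact L.
  - do 3 eexists. split; [reflexivity|]. split; [lra|]. split; [lra|].
    replace (t + h / 2 - t) with (h / 2) by ring.
    rewrite !Rminus_diag, !Rabs_R0. split; [lra|]. split; [lra|]. exact L.
  - do 3 eexists. split; [reflexivity|]. split; [lra|]. split; [rewrite Rabs_Ropp; lra|].
    replace (t + h / 2 - t) with (h / 2) by ring. replace (s + h / 2 - s) with (h / 2) by ring.
    split; [lra|]. split; [lra|].
    (* If the first three pieces each stay below a quarter of the total, the triangle inequality
       leaves more than a quarter for the fourth. *)
    apply Rnot_le_lt in L1, L2, L3. rewrite E in L1, L2, L3 |- *.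
    match goal with |- Cmod (?A + ?B + ?G + ?D) / 4 <= _ =>
      assert (Cmod (A + B + G + D) <= Cmod A + Cmod B + Cmod G + Cmod D) end.
    { eapply Rle_trans; [apply Cmod_triangle|]. apply Rplus_le_compat_r.
      eapply Rle_trans; [apply Cmod_triangle|]. apply Rplus_le_compat_r. apply Cmod_triangle. }
    lra.
Qed.

Theorem goursat :
  (forall s t, 0 <= s -> 0 <= t -> s + t <= 1 -> cderivable f (tri_point a v w s t)) ->
  tri_int f a (a + v) (a + w) = 0%C.
Proof.
  intros Hf.
  set (x := fix x n := match n with O => (0, 0, 1) | S n => tri_step (x n) end).
  set (ss := fun n => fst (fst (x n))). set (tt := fun n => snd (fst (x n))).
  set (hh := fun n => snd (x n)).
  assert (Ex : forall n, x n = (ss n, tt n, hh n)) by (intros n; unfold ss, tt, hh; now destruct (x n) as [[? ?] ?]).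
  set (T := Cmod (tri_param f a v w (0, 0, 1))).
  assert (I : forall n, tri_valid (x n) /\ Rabs (hh n) = (/2) ^ n /\
     T * (/4) ^ n <= Cmod (tri_param f a v w (x n)) /\
     Rabs (ss (S n) - ss n) <= (/2) ^ (S n) /\ Rabs (tt (S n) - tt n) <= (/2) ^ (S n)).
  { assert (Q : forall n, tri_valid (x n) -> Rabs (hh n) = (/2) ^ n ->
      tri_valid (x (S n)) /\ Rabs (hh (S n)) = (/2) ^ (S n) /\
      Cmod (tri_param f a v w (x n)) / 4 <= Cmod (tri_param f a v w (x (S n))) /\
      Rabs (ss (S n) - ss n) <= (/2) ^ (S n) /\ Rabs (tt (S n) - tt n) <= (/2) ^ (S n)).
    { intros n V H. rewrite Ex in V.
      destruct (tri_step_spec _ _ _ V) as (s' & t' & h' & E & V' & A & B & G & D).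
      assert (E' : x (S n) = (s', t', h')) by (simpl; rewrite Ex; exact E).
      unfold ss at 1, tt at 1, hh at 1. rewrite E'. simpl fst. simpl snd.
      rewrite H in *. rewrite Ex. simpl pow. split; [exact V'|]. split; [lra|]. split; [exact D|]. split; lra. }
    intros n. induction n as [|n IH].
    - assert (V0 : tri_valid (x O)) by (simpl; lra).
      assert (H0 : Rabs (hh O) = (/2) ^ 0) by (unfold hh; simpl; apply Rabs_R1).
      destruct (Q O V0 H0) as (_ & _ & _ & A & B). split; [auto|]. split; [auto|]. split; [simpl pow; rewrite Rmult_1_r; apply Rle_refl | auto].
    - destruct IH as (V & H & L & _ & _). destruct (Q n V H) as (V1 & H1 & L1 & _ & _).
      destruct (Q (S n) V1 H1) as (_ & _ & _ & A & B). split; [auto|]. split; [auto|]. split; [simpl pow; lra | auto]. }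
  destruct (geometric_cauchy_limit ss ltac:(intros n; apply I)) as [s Hs].
  destruct (geometric_cauchy_limit tt ltac:(intros n; apply I)) as [t Ht].
  assert (Hpos : forall n, 0 < (/2) ^ n) by (intros; apply pow_lt; lra).
  assert (Hsmall : forall e, 0 < e -> exists n, (/2) ^ n < e).
  { intros e He. destruct (pow_lt_1_zero (/2) ltac:(rewrite Rabs_pos_eq; lra) e He) as [N HN].
    exists N. specialize (HN N ltac:(lia)). rewrite Rabs_pos_eq in HN; auto. left; auto. }
  (* The limit [(s, t)] must lie in the closed simplex, since only there is [f] known to be
     differentiable. *)
  assert (S0 : 0 <= s).
  { apply Rnot_lt_le. intros L. destruct (Hsmall (- s)) as [n Hn]; [lra|].
    specialize (Hs n). destruct (I n) as [V _]. rewrite Ex in V. unfold tri_valid in V.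
    apply Rabs_le_between in Hs. lra. }
  assert (T0 : 0 <= t).
  { apply Rnot_lt_le. intros L. destruct (Hsmall (- t)) as [n Hn]; [lra|].
    specialize (Ht n). destruct (I n) as [V _]. rewrite Ex in V. unfold tri_valid in V.
    apply Rabs_le_between in Ht. lra. }
  assert (ST : s + t <= 1).
  { apply Rnot_lt_le. intros L. destruct (Hsmall ((s + t - 1) / 2)) as [n Hn]; [lra|].
    specialize (Hs n). specialize (Ht n). destruct (I n) as [V _]. rewrite Ex in V. unfold tri_valid in V.
    apply Rabs_le_between in Hs. apply Rabs_le_between in Ht. lra. }
  destruct (Hf s t S0 T0 ST) as [l Hl]. fold (pt s t) in Hl.
  set (K := Cmod v + Cmod w + 1).
  assert (HK : 1 <= K) by (unfold K; assert (Hv := Cmod_ge_0 v); assert (Hw := Cmod_ge_0 w); lra).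
  assert (Dist : forall s1 t1 s2 t2 d, Rabs (s1 - s2) <= d -> Rabs (t1 - t2) <= d ->
     Cmod (pt s1 t1 - pt s2 t2) <= K * d).
  { intros s1 t1 s2 t2 d A B. unfold pt, tri_point.
    replace (a + s1 * v + t1 * w - (a + s2 * v + t2 * w))%C
      with (RtoC (s1 - s2) * v + RtoC (t1 - t2) * w)%C by (rewrite !RtoC_minus; ring).
    eapply Rle_trans; [apply Cmod_triangle|]. rewrite !Cmod_mult, !Cmod_R.
    unfold K. assert (Hv := Cmod_ge_0 v). assert (Hw := Cmod_ge_0 w).
    assert (P := Rabs_pos (s1 - s2)). nra. }
  assert (TB : forall e, 0 < e -> T <= 24 * K * K * e).
  { intros e He. destruct (Hl e He) as [d [Hd Hlim]].
    destruct (Hsmall (d / (2 * K))) as [n Hn]; [apply Rdiv_lt_0_compat; lra|].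
    assert (Hnd : K * (2 * (/2) ^ n) < d).
    { apply (Rmult_lt_compat_l (2 * K)) in Hn; [|lra].
      replace (2 * K * (d / (2 * K))) with d in Hn by (field; lra). lra. }
    destruct (I n) as (V & H & L & _ & _). rewrite Ex in V, L.
    specialize (Hs n). specialize (Ht n). specialize (Hpos n).
    set (q := (/2) ^ n) in *.
    assert (Q4 : (/4) ^ n = q * q) by (unfold q; rewrite <- Rpow_mult_distr; f_equal; lra).
    set (al := (f (pt s t) - l * pt s t)%C).
    (* Vertices are within [2 q] of the limit: [q] for the base vertex, [q] more for the side. The
       error of the affine approximation is thus at most [e * K * 2 q] on a side of length at most
       [K * q], and [seg_int_bound] doubles the product. *)
    assert (SEG : forall s1 t1 s2 t2, 
       0 <= s1 -> 0 <= t1 -> s1 + t1 <= 1 -> 0 <= s2 -> 0 <= t2 -> s2 + t2 <= 1 ->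
       Rabs (s1 - s) <= 2 * q -> Rabs (t1 - t) <= 2 * q ->
       Rabs (s2 - s) <= 2 * q -> Rabs (t2 - t) <= 2 * q ->
       Rabs (s1 - s2) <= q -> Rabs (t1 - t2) <= q ->
       Cmod (seg_int f (pt s1 t1) (pt s2 t2) - seg_int (fun z => al + l * z)%C (pt s1 t1) (pt s2 t2))
        <= 4 * K * K * e * (q * q)).
    { intros s1 t1 s2 t2 A1 A2 A3 A4 A5 A6 B1 B2 B3 B4 B5 B6.
      assert (SC := tri_point_seg_cont s1 t1 s2 t2 A1 A2 A3 A4 A5 A6).
      assert (SA : seg_cont (fun z => al + l * z)%C (pt s1 t1) (pt s2 t2)).
      { intros y _. apply ccont_plus; [apply ccont_const|]. apply ccont_mult; [apply ccont_const|apply ccont_id]. }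
      rewrite <- seg_int_minus by auto.
      eapply Rle_trans; [apply (seg_int_bound _ _ _ (e * (K * (2 * q))))|].
      - intros y Hy. apply ccont_plus; auto. apply ccont_opp. auto.
      - intros y Hy.
        set (z := (pt s1 t1 + RtoC y * (pt s2 t2 - pt s1 t1))%C).
        assert (Dz : Cmod (z - pt s t) <= K * (2 * q)).
        { unfold z, pt. rewrite tri_point_seg. fold pt.
          apply Dist; apply Rabs_le_between; apply Rabs_le_between in B1, B2, B3, B4; nra. }
        replace (f z - (al + l * z))%C with (f z - f (pt s t) - l * (z - pt s t))%C by (unfold al; ring).
        eapply Rle_trans; [apply Hlim; lra|]. apply Rmult_le_compat_l; [lra|]. exact Dz.
      - assert (Dp : Cmod (pt s2 t2 - pt s1 t1) <= K * q).
        { rewrite Cmod_sub_sym. apply Dist; auto. }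
        assert (0 < e * (K * (2 * q))) by (repeat apply Rmult_lt_0_compat; lra).
        apply Rle_trans with (2 * (e * (K * (2 * q))) * (K * q)); [apply Rmult_le_compat_l; lra|].
        right. ring. }
    unfold tri_param, tri_int in L. unfold tri_valid in V. fold pt in L.
    set (s1 := ss n) in *. set (t1 := tt n) in *. set (h := hh n) in *.
    assert (Hh : -q <= h <= q) by (apply Rabs_le_between; lra).
    apply Rabs_le_between in Hs, Ht.
    assert (X1 : Cmod (seg_int f (pt s1 t1) (pt (s1 + h) t1) - seg_int (fun z => al + l * z)%C (pt s1 t1) (pt (s1 + h) t1)) <= 4 * K * K * e * (q * q))
      by (apply SEG; try lra; apply Rabs_le_between; lra).
    assert (X2 : Cmod (seg_int f (pt (s1 + h) t1) (pt s1 (t1 + h)) - seg_int (fun z => al + l * z)%C (pt (s1 + h) t1) (pt s1 (t1 + h))) <= 4 * K * K * e * (q * q))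
      by (apply SEG; try lra; apply Rabs_le_between; lra).
    assert (X3 : Cmod (seg_int f (pt s1 (t1 + h)) (pt s1 t1) - seg_int (fun z => al + l * z)%C (pt s1 (t1 + h)) (pt s1 t1)) <= 4 * K * K * e * (q * q))
      by (apply SEG; try lra; apply Rabs_le_between; lra).
    rewrite seg_int_affine in X1, X2, X3.
    (* The three affine integrals add up to zero, so subtracting them leaves the triangle integral
       unchanged. *)
    match type of X1 with Cmod (?A - ?A') <= _ => match type of X2 with Cmod (?B - ?B') <= _ =>
      match type of X3 with Cmod (?G - ?G') <= _ =>
      assert (Z : (A + B + G = (A - A') + (B - B') + (G - G'))%C) by (field) ;
      rewrite Z in L;
      assert (Z' := Cmod_triangle ((A - A') + (B - B')) (G - G'));
      assert (Z'' := Cmod_triangle (A - A') (B - B')) end end end.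
    rewrite Q4 in L.
    assert (Hqq : 0 < q * q) by nra.
    apply (Rmult_le_reg_r (q * q)); auto.
    assert (0 < K * K * e * (q * q)) by (repeat apply Rmult_lt_0_compat; lra).
    lra. }
  assert (HT : T <= 0).
  { apply Rnot_lt_le. intros P. assert (B := TB (T / (48 * K * K)) ltac:(apply Rdiv_lt_0_compat; nra)).
    replace (24 * K * K * (T / (48 * K * K))) with (T / 2) in B by (field; lra). lra. }
  assert (E : tri_param f a v w (0, 0, 1) = 0%C).
  { apply Cmod_eq_0. assert (P := Cmod_ge_0 (tri_param f a v w (0, 0, 1))). unfold T in HT. lra. }
  unfold tri_param, tri_point in E.
  replace (a + 0 * v + 0 * w)%C with a in E by ring.
  replace (a + (0 + 1)%R * v + 0 * w)%C with (a + v)%C in E by (rewrite RtoC_plus; ring).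
  replace (a + 0 * v + (0 + 1)%R * w)%C with (a + w)%C in E by (rewrite RtoC_plus; ring).
  exact E.
Qed.

End Goursat.

(** * Primitives, the Cauchy estimate and the identity theorem *)


(** A subtriangle is a full triangle with base [tri_point a v w s t] and edges [h v], [h w];
    negative [h] is included because the inverted middle piece needs it. *)
Lemma tri_param_goursat (f : C -> C) (a v w : C) (s t h : R) :
  (forall x y, 0 <= x -> 0 <= y -> x + y <= 1 -> cderivable f (tri_point a v w (s + h * x) (t + h * y))) ->
  tri_param f a v w (s, t, h) = 0%C.
Proof.
  intros H.
  assert (E : forall x y, tri_point (tri_point a v w s t) (h * v) (h * w) x y = tri_point a v w (s + h * x) (t + h * y)).
  { intros. unfold tri_point. rewrite !RtoC_plus, !RtoC_mult. ring. }
  assert (G := goursat f (tri_point a v w s t) (h * v) (h * w)).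
  unfold tri_param. rewrite <- G.
  - f_equal; unfold tri_point; rewrite !RtoC_plus; ring.
  - intros x y Hx Hy Hxy. rewrite E. apply cderivable_ccont; auto.
  - intros x y Hx Hy Hxy. rewrite E. auto.
Qed.

(* Goursat's theorem when differentiability may fail at the vertex [a]: cut off
   ever smaller corners. *)
Lemma goursat_vertex (f : C -> C) (a v w : C) :
  (forall s t, 0 <= s -> 0 <= t -> s + t <= 1 -> ccont f (tri_point a v w s t)) ->
  (forall s t, 0 <= s -> 0 <= t -> 0 < s + t -> s + t <= 1 -> cderivable f (tri_point a v w s t)) ->
  tri_int f a (a + v) (a + w) = 0%C.
Proof.
  intros Hc Hf.
  assert (E0 : forall t, t = 0 -> tri_point a v w t 0 = a) by (intros t ->; unfold tri_point; ring).
  (* Of the four pieces only the corner at [a] escapes Goursat's theorem; the other three keep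
     [s + t > 0]. *)
  assert (E : forall n, tri_param f a v w (0, 0, 1) = tri_param f a v w (0, 0, (/2) ^ n)).
  { induction n as [|n IH]; [reflexivity|]. rewrite IH.
    assert (P : 0 < (/2) ^ n) by (apply pow_lt; lra).
    assert (P1 : (/2) ^ n <= 1) by (rewrite <- (pow1 n); apply pow_incr; lra).
    simpl pow. set (h := (/2) ^ n) in *.
    rewrite (tri_param_split f a v w Hc 0 0 h) by (unfold tri_valid; lra).
    rewrite (tri_param_goursat f a v w (0 + h / 2) 0 (h / 2)) by (intros; apply Hf; nra).
    rewrite (tri_param_goursat f a v w 0 (0 + h / 2) (h / 2)) by (intros; apply Hf; nra).
    rewrite (tri_param_goursat f a v w (0 + h / 2) (0 + h / 2) (- (h / 2))) by (intros; apply Hf; nra).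
    replace (h / 2) with (/ 2 * h) by field. ring. }
  replace (tri_int f a (a + v) (a + w)) with (tri_param f a v w (0, 0, 1)).
  2: { unfold tri_param. f_equal; unfold tri_point; rewrite ?RtoC_plus; ring. }
  set (T := tri_param f a v w (0, 0, 1)) in *.
  assert (C0 := Hc 0 0 ltac:(lra) ltac:(lra) ltac:(lra)). rewrite E0 in C0 by auto.
  destruct (C0 1 Rlt_0_1) as [d [Hd K0]].
  set (M := Cmod (f a) + 1). assert (HM : 1 <= M) by (unfold M; assert (X := Cmod_ge_0 (f a)); lra).
  set (K := Cmod v + Cmod w + 1).
  assert (Hv := Cmod_ge_0 v). assert (Hw := Cmod_ge_0 w).
  assert (HK : 1 <= K) by (unfold K; lra).
  assert (HMK : 0 < M * K) by (apply Rmult_lt_0_compat; lra).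
  assert (TB : forall e, 0 < e -> Cmod T <= 12 * (M * K) * e).
  { intros e He.
    destruct (pow_lt_1_zero (/2) ltac:(rewrite Rabs_pos_eq; lra) (Rmin e (d / K))) as [n Hn].
    { apply Rmin_pos; auto. apply Rdiv_lt_0_compat; lra. }
    specialize (Hn n (le_n _)). specialize (E n).
    assert (P : 0 < (/2) ^ n) by (apply pow_lt; lra).
    assert (P1 : (/2) ^ n <= 1) by (rewrite <- (pow1 n); apply pow_incr; lra).
    rewrite Rabs_pos_eq in Hn by lra.
    assert (Hn1 := Rlt_le_trans _ _ _ Hn (Rmin_l _ _)).
    assert (Hn2 := Rlt_le_trans _ _ _ Hn (Rmin_r _ _)).
    set (h := (/2) ^ n) in *.
    apply (Rmult_lt_compat_r K) in Hn2; [|lra].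
    replace (d / K * K) with d in Hn2 by (field; lra).
    assert (SEG : forall s1 t1 s2 t2, 0 <= s1 -> 0 <= t1 -> s1 + t1 <= h -> 0 <= s2 -> 0 <= t2 -> s2 + t2 <= h ->
      Cmod (seg_int f (tri_point a v w s1 t1) (tri_point a v w s2 t2)) <= 4 * (M * K) * h).
    { intros s1 t1 s2 t2 A1 A2 A3 B1 B2 B3.
      eapply Rle_trans; [apply (seg_int_bound _ _ _ M)|].
      - apply tri_point_seg_cont; auto; lra.
      - intros y Hy. rewrite tri_point_seg.
        set (s := s1 + y * (s2 - s1)). set (t := t1 + y * (t2 - t1)).
        assert (X : 0 <= s /\ 0 <= t /\ s + t <= h) by (unfold s, t; nra).
        assert (D : Cmod (tri_point a v w s t - a) < d).
        { unfold tri_point. replace (a + s * v + t * w - a)%C with (s * v + t * w)%C by ring.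
          eapply Rle_lt_trans; [apply Cmod_triangle|]. rewrite !Cmod_mult, !Cmod_R, !Rabs_pos_eq by lra.
          unfold K in Hn2. nra. }
        apply K0 in D. assert (Z := Cmod_ge_sub (f (tri_point a v w s t)) (f a)). unfold M. lra.
      - assert (X : Cmod (tri_point a v w s2 t2 - tri_point a v w s1 t1) <= 2 * K * h).
        { unfold tri_point. replace (a + s2 * v + t2 * w - (a + s1 * v + t1 * w))%C
            with (RtoC (s2 - s1) * v + RtoC (t2 - t1) * w)%C by (rewrite !RtoC_minus; ring).
          eapply Rle_trans; [apply Cmod_triangle|]. rewrite !Cmod_mult, !Cmod_R.
          assert (Rabs (s2 - s1) <= h) by (apply Rabs_le; lra).
          assert (Rabs (t2 - t1) <= h) by (apply Rabs_le; lra). unfold K. nra. }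
        replace (4 * (M * K) * h) with (2 * M * (2 * K * h)) by ring.
        apply Rmult_le_compat_l; lra. }
    rewrite E. unfold tri_param, tri_int.
    eapply Rle_trans; [apply Cmod_triangle|].
    eapply Rle_trans; [apply Rplus_le_compat_r, Cmod_triangle|].
    assert (X1 := SEG 0 0 (0 + h) 0 ltac:(lra) ltac:(lra) ltac:(lra) ltac:(lra) ltac:(lra) ltac:(lra)).
    assert (X2 := SEG (0 + h) 0 0 (0 + h) ltac:(lra) ltac:(lra) ltac:(lra) ltac:(lra) ltac:(lra) ltac:(lra)).
    assert (X3 := SEG 0 (0 + h) 0 0 ltac:(lra) ltac:(lra) ltac:(lra) ltac:(lra) ltac:(lra) ltac:(lra)).
    assert (M * K * h <= M * K * e) by (apply Rmult_le_compat_l; lra). lra. }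
  apply Cmod_eq_0. assert (Z := Cmod_ge_0 T).
  apply Rle_antisym; auto. apply Rnot_lt_le. intros P.
  assert (B := TB (Cmod T / (24 * (M * K))) ltac:(apply Rdiv_lt_0_compat; lra)).
  replace (12 * (M * K) * (Cmod T / (24 * (M * K)))) with (Cmod T / 2) in B by (field; split; lra). lra.
Qed.

Lemma seg_int_refl (f : C -> C) (p : C) : seg_int f p p = 0%C.
Proof. unfold seg_int. ring. Qed.

(** At the centre [c] mere continuity is asked of [g]: [cauchy_estimate] takes for [g] a difference
    quotient at [c = a], where differentiability is not known beforehand. *)
Lemma star_primitive (Om : C -> Prop) (c : C) (g : C -> C) :
  (forall z, Om z -> exists r, 0 < r /\ forall w, Cmod (w - z) < r -> Om w) ->
  (forall z t, Om z -> 0 <= t <= 1 -> Om (c + RtoC t * (z - c))%C) ->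
  (forall z, Om z -> ccont g z) ->
  (forall z, Om z -> z <> c -> cderivable g z) ->
  forall z, Om z -> cderiv (seg_int g c) z (g z).
Proof.
  intros Hop Hst Hcc Hcd z Hz.
  assert (SC : forall x, Om x -> seg_cont g c x) by (intros x Hx t Ht; apply Hcc, Hst; auto).
  assert (L : exists r, 0 < r /\ forall w, Cmod (w - z) < r ->
     Om w /\ (seg_int g c w - seg_int g c z = seg_int g z w)%C).
  { destruct (Hop z Hz) as [r [Hr Hb]].
    destruct (Ceq_dec z c) as [->|N].
    { exists r. split; auto. intros w Hw. split; auto. rewrite seg_int_refl. ring. }
    assert (Np := Cmod_sub_pos z c N).
    (* Staying closer to [z] than [c] keeps the side from [z] to [w] off [c], so the triangle meets
       [c] only at its vertex. *)
    exists (Rmin r (Cmod (z - c))). split; [apply Rmin_pos; auto|]. intros w Hw.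
    assert (W1 := Rlt_le_trans _ _ _ Hw (Rmin_l _ _)).
    assert (W2 := Rlt_le_trans _ _ _ Hw (Rmin_r _ _)).
    split; auto.
    assert (Seg : forall x, 0 <= x <= 1 -> Om (z + RtoC x * (w - z))%C /\ (z + RtoC x * (w - z))%C <> c).
    { intros x Hx.
      assert (D : Cmod (z + x * (w - z) - z) <= Cmod (w - z)).
      { replace (z + x * (w - z) - z)%C with (x * (w - z))%C by ring.
        rewrite Cmod_mult, Cmod_R, Rabs_pos_eq by lra. assert (X := Cmod_ge_0 (w - z)). nra. }
      split; [apply Hb; lra|]. intros E. rewrite E in D. rewrite Cmod_sub_sym in D. lra. }
    (* Every other point of the triangle lies on a segment from [c] to a point of the opposite side,
       which puts it in the star-shaped set. *)
    assert (Par : forall s t, 0 <= s -> 0 <= t -> 0 < s + t -> 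
       tri_point c (z - c) (w - c) s t = (c + RtoC (s + t) * ((z + RtoC (t / (s + t)) * (w - z)) - c))%C).
    { intros s t Hs Ht Hst'. unfold tri_point. rewrite RtoC_div, !RtoC_plus by lra. field.
      rewrite <- RtoC_plus. intros X. apply RtoC_inj in X. lra. }
    assert (Rat : forall s t, 0 <= s -> 0 <= t -> 0 < s + t -> 0 <= t / (s + t) <= 1).
    { intros s t Hs Ht Hst'. split.
      - apply Rmult_le_pos; auto. left. now apply Rinv_0_lt_compat.
      - apply (Rmult_le_reg_r (s + t)); auto. unfold Rdiv. rewrite Rmult_assoc, Rinv_l by lra. lra. }
    assert (Omt : forall s t, 0 <= s -> 0 <= t -> 0 < s + t -> s + t <= 1 -> Om (tri_point c (z - c) (w - c) s t)).
    { intros s t Hs Ht Hst' Hle. rewrite Par by auto. apply Hst; [|lra]. apply Seg, Rat; auto. }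
    assert (T := goursat_vertex g c (z - c) (w - c)).
    replace (c + (z - c))%C with z in T by ring. replace (c + (w - c))%C with w in T by ring.
    unfold tri_int in T. rewrite (seg_int_swap g c w) in T by auto.
    rewrite <- (Cplus_0_r (seg_int g c w - seg_int g c z)). rewrite <- T; [ring| |].
    - intros s t Hs Ht Hle. apply Hcc. destruct (Rle_lt_or_eq_dec 0 (s + t)) as [P|P]; [lra|auto|].
      assert (s = 0) by lra. assert (t = 0) by lra. subst.
      replace (tri_point c (z - c) (w - c) 0 0) with (c + 0 * (z - c))%C by (unfold tri_point; ring). apply Hst; auto; lra.
    - intros s t Hs Ht P Hle. apply Hcd; auto. rewrite Par by auto. intros X.
      assert (Y : (RtoC (s + t) * (z + (t / (s + t))%R * (w - z) - c))%C = 0%C).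
      { replace (RtoC (s + t) * (z + (t / (s + t))%R * (w - z) - c))%C
         with (c + RtoC (s + t) * (z + (t / (s + t))%R * (w - z) - c) - c)%C by ring. rewrite X. ring. }
      revert Y. apply Cmult_neq_0.
      + intros Y. apply RtoC_inj in Y. lra.
      + intros Y. apply Csub_0_eq in Y. revert Y. apply Seg, Rat; auto. }
  destruct L as [r [Hr Hw]]. intros e He.
  destruct (Hcc z Hz (e/2)) as [d [Hd Kd]]; [lra|].
  exists (Rmin r d). split; [apply Rmin_pos; auto|]. intros w Hwz.
  assert (W1 := Rlt_le_trans _ _ _ Hwz (Rmin_l _ _)).
  assert (W2 := Rlt_le_trans _ _ _ Hwz (Rmin_r _ _)).
  destruct (Hw w W1) as [_ ->].
  assert (In : forall t, 0 <= t <= 1 -> Cmod (z + RtoC t * (w - z) - z) < Rmin r d).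
  { intros t Ht. replace (z + t * (w - z) - z)%C with (t * (w - z))%C by ring.
    rewrite Cmod_mult, Cmod_R, Rabs_pos_eq by lra. assert (X := Cmod_ge_0 (w - z)). nra. }
  assert (Sg : seg_cont g z w).
  { intros t Ht. apply Hcc. apply Hw. eapply Rlt_le_trans; [apply In; auto|apply Rmin_l]. }
  assert (Sa : seg_cont (fun x => g z + 0 * x)%C z w).
  { intros t Ht. apply ccont_plus; [apply ccont_const|].
    apply ccont_mult; [apply ccont_const|apply ccont_id]. }
  (* The constant is written as an affine function so that [seg_int_affine] evaluates its
     integral. *)
  replace (g z * (w - z))%C with (seg_int (fun x => g z + 0 * x)%C z w) by (rewrite seg_int_affine; field).
  rewrite <- seg_int_minus by auto.
  eapply Rle_trans; [apply (seg_int_bound _ _ _ (e/2))|].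
  - intros t Ht. apply ccont_plus; [apply Sg; auto|]. apply ccont_opp, Sa; auto.
  - intros t Ht. replace (g z + 0 * (z + t * (w - z)))%C with (g z) by ring.
    left. apply Kd. eapply Rlt_le_trans; [apply In; auto|apply Rmin_r].
  - right. field.
Qed.

Lemma disc_open (z0 : C) (Rd : R) : forall z, Cmod (z - z0) < Rd ->
  exists r, 0 < r /\ forall w, Cmod (w - z) < r -> Cmod (w - z0) < Rd.
Proof.
  intros z Hz. exists (Rd - Cmod (z - z0)). split; [lra|]. intros w Hw.
  eapply Rle_lt_trans; [apply (Cmod_tri w z z0)|]. lra.
Qed.

Lemma disc_convex (z0 : C) (Rd : R) (c z : C) (t : R) :
  Cmod (c - z0) < Rd -> Cmod (z - z0) < Rd -> 0 <= t <= 1 -> Cmod (c + RtoC t * (z - c) - z0) < Rd.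
Proof.
  intros Hc Hz Ht.
  replace (c + t * (z - c) - z0)%C with (RtoC (1 - t) * (c - z0) + RtoC t * (z - z0))%C
    by (rewrite RtoC_minus; ring).
  eapply Rle_lt_trans; [apply Cmod_triangle|]. rewrite !Cmod_mult, !Cmod_R, !Rabs_pos_eq by lra.
  assert (0 <= (1 - t) * (Rd - Cmod (c - z0))) by (apply Rmult_le_pos; lra).
  destruct (Req_dec t 0) as [->|N]; [lra|].
  assert (0 < t * (Rd - Cmod (z - z0))) by (apply Rmult_lt_0_compat; lra). lra.
Qed.

(** * The unit circle and Cauchy's formula *)

Definition cis (t : R) : C := (cos t, sin t).

Lemma cis_rderiv (t : R) : rderiv cis t (Ci * cis t).
Proof.
  split; simpl.
  - replace (0 * cos t - 1 * sin t) with (- sin t) by ring. apply is_derive_cos.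
  - replace (0 * sin t + 1 * cos t) with (cos t) by ring. apply is_derive_sin.
Qed.

Lemma Cmod_cis (t : R) : Cmod (cis t) = 1.
Proof.
  unfold Cmod, cis; simpl. assert (H := sin2_cos2 t). unfold Rsqr in H.
  rewrite !Rmult_1_r. rewrite Rplus_comm, H. apply sqrt_1.
Qed.

Lemma cis_opp (t : R) : (cis t * cis (- t) = 1)%C.
Proof.
  unfold cis. rewrite cos_neg, sin_neg. assert (H := sin2_cos2 t). unfold Rsqr in H.
  apply C_ext; simpl; lra.
Qed.

Lemma cis_neg_rderiv (t : R) : rderiv (fun s => cis (- s)) t (- Ci * cis (- t)).
Proof.
  apply (rderiv_ext (fun s => (cos s, - sin s))).
  { intros s. unfold cis. now rewrite cos_neg, sin_neg. }
  unfold cis; rewrite cos_neg, sin_neg.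
  split; simpl; auto_derive; auto; ring.
Qed.

(* [Q] below is a primitive of [i r e f(z) / (z - a)] along the circle [z = z0 + r e], so
   [Q (2 pi) - Q 0 = 2 pi i f(a)] is Cauchy's formula.  It combines a primitive [G] of the difference
   quotient [(f z - f a) / (z - a)] with a primitive [L] of [i r e / (z - a) = i / (1 - b / e)]. *)
Lemma cauchy_estimate (f : C -> C) (z0 a : C) (Rd r M : R) :
  0 < r < Rd -> Cmod (a - z0) < r ->
  (forall z, Cmod (z - z0) < Rd -> cderivable f z) ->
  (forall t, 0 <= t <= 2 * PI -> Cmod (f (z0 + r * cis t)%C) <= M) ->
  Cmod (f a) * (r - Cmod (a - z0)) <= M * r.
Proof.
  intros Hr Ha Hf HM.
  assert (Ha0 := Cmod_ge_0 (a - z0)).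
  destruct (Hf a ltac:(lra)) as [l Hl]. apply cderiv_slope in Hl.
  destruct Hl as [g [Hg [Hgc _]]].
  assert (Gd : forall z, Cmod (z - z0) < Rd -> z <> a -> cderivable g z).
  { intros z Hz N. apply (cderivable_loc (fun w => (f w - f a) / (w - a))%C _ _ (Cmod (z - a))).
    - now apply Cmod_sub_pos.
    - intros w Hw. rewrite (Hg w). field. intros X. apply Csub_0_eq in X. subst w.
      rewrite Cmod_sub_sym in Hw. lra.
    - apply cderivable_div.
      + intros X. apply N, Csub_0_eq, X.
      + apply cderivable_minus; [auto | apply cderivable_const].
      + apply cderivable_minus; [apply cderivable_id | apply cderivable_const]. }
  assert (HG : forall z, Cmod (z - z0) < Rd -> cderiv (seg_int g a) z (g z)).
  { apply (star_primitive (fun z => Cmod (z - z0) < Rd)).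
    - apply disc_open.
    - intros z t Hz Ht. apply disc_convex; auto; lra.
    - intros z Hz. destruct (Ceq_dec z a) as [->|N]; auto. apply cderivable_ccont; auto.
    - auto. }
  set (b := ((a - z0) / r)%C).
  assert (Hr0 : RtoC r <> 0%C) by (intros X; apply RtoC_inj in X; lra).
  assert (Hb : Cmod b < 1).
  { unfold b. rewrite Cmod_div, Cmod_R, Rabs_pos_eq by (auto; lra).
    apply (Rmult_lt_reg_r r); [lra|]. unfold Rdiv. rewrite Rmult_assoc, Rinv_l by lra. lra. }
  assert (Hb0 := Cmod_ge_0 b).
  set (h := fun x => (b / (1 - b * x))%C).
  (* A radius above 1 with [|b| R' < 1], so that [h] is holomorphic on a disc containing the closed
     unit disc. *)
  set (R' := 2 / (1 + Cmod b)).
  assert (HR' : 1 < R').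
  { unfold R'. apply (Rmult_lt_reg_r (1 + Cmod b)); [lra|]. unfold Rdiv. rewrite Rmult_assoc, Rinv_l by lra. lra. }
  assert (HbR : Cmod b * R' < 1).
  { unfold R'. apply (Rmult_lt_reg_r (1 + Cmod b)); [lra|]. 
    replace (Cmod b * (2 / (1 + Cmod b)) * (1 + Cmod b)) with (2 * Cmod b) by (field; lra). lra. }
  assert (Nz : forall x, Cmod (x - 0) < R' -> (1 - b * x)%C <> 0%C).
  { intros x Hx X. replace (x - 0)%C with x in Hx by ring.
    assert (Y : Cmod (b * x) = 1).
    { replace (b * x)%C with (1 - (1 - b * x))%C by ring. rewrite X.
      replace (1 - 0)%C with (RtoC 1) by ring. apply Cmod_1. }
    rewrite Cmod_mult in Y. assert (Z := Cmod_ge_0 x). nra. }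
  assert (Hd : forall x, Cmod (x - 0) < R' -> cderivable h x).
  { intros x Hx. apply cderivable_div; auto; [apply cderivable_const|].
    apply cderivable_minus; [apply cderivable_const|]. apply cderivable_mult; [apply cderivable_const|apply cderivable_id]. }
  assert (HH : forall x, Cmod (x - 0) < R' -> cderiv (seg_int h 0) x (h x)).
  { apply (star_primitive (fun x => Cmod (x - 0) < R')).
    - apply disc_open.
    - intros z t Hz Ht. apply disc_convex; auto. rewrite Cmod_self. lra.
    - intros x Hx. apply cderivable_ccont; auto.
    - auto. }
  (* This avoids a logarithm: with [e = cis t], [i / (1 - b / e) = i + i (b / e) / (1 - b / e)], and
     the second term is the derivative of [- H (1 / e)] for a primitive [H] of [h]. *)
  set (Lf := fun t : R => (Ci * (0 + RtoC t * 1) + - 1 * seg_int h 0 (cis (- t)))%C).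
  set (Q := fun t => (seg_int g a (z0 + r * cis t) + f a * Lf t)%C).
  assert (Circ : forall t, Cmod (z0 + r * cis t - z0) = r).
  { intros t. replace (z0 + r * cis t - z0)%C with (r * cis t)%C by ring.
    rewrite Cmod_mult, Cmod_cis, Cmod_R, Rabs_pos_eq; lra. }
  assert (Za : forall t, (z0 + r * cis t)%C <> a).
  { intros t X. assert (Y := Circ t). rewrite X in Y. lra. }
  assert (HQ : forall t, rderiv Q t (Ci * r * cis t * f (z0 + r * cis t) / (z0 + r * cis t - a))%C).
  { intros t.
    assert (E1 : Cmod (cis (- t) - 0) < R').
    { replace (cis (- t) - 0)%C with (cis (- t)) by ring. rewrite Cmod_cis. lra. }
    eapply rderiv_eq.
    - apply rderiv_plus.
      + apply (rderiv_comp (seg_int g a) (fun t => (z0 + r * cis t)%C)).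
        * apply HG. rewrite Circ. lra.
        * apply (rderiv_plus (fun _ => z0)).
          -- apply (rderiv_ext (fun s => z0 + RtoC s * 0)%C); [intros; ring|]. apply rderiv_seg.
          -- apply rderiv_cmult, cis_rderiv.
      + apply rderiv_cmult. apply rderiv_plus.
        * apply rderiv_cmult, rderiv_seg.
        * apply rderiv_cmult. apply (rderiv_comp (seg_int h 0) (fun t => cis (- t))).
          -- apply HH, E1.
          -- apply cis_neg_rderiv.
    - rewrite (Hg (z0 + r * cis t)%C). unfold h.
      assert (D : (z0 + r * cis t - a)%C <> 0%C) by (intros X; apply (Za t), Csub_0_eq, X).
      assert (E : cis t <> 0%C) by (apply Cmod_gt_0; rewrite Cmod_cis; lra).
      assert (Ei : cis (- t) = (/ cis t)%C).
      { rewrite <- (Cmult_1_l (/ cis t)%C), <- (cis_opp t). field. auto. }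
      assert (N2 := Nz _ E1). rewrite Ei in N2 |- *.
      assert (Ea : a = (z0 + r * b)%C) by (unfold b; field; auto).
      rewrite Ea in D |- *. 
      assert (D' : (cis t - b)%C <> 0%C).
      { intros X. apply D. replace (z0 + r * cis t - (z0 + r * b))%C with (r * (cis t - b))%C by ring.
        rewrite X. ring. }
      field. repeat split; auto. }
  assert (B : Cmod (Q (2 * PI) - Q 0) <= (M * r / (r - Cmod (a - z0))) * (2 * PI - 0)).
  { assert (HPI := PI_RGT_0).
    apply (mean_value_ineq Q (fun t => Ci * r * cis t * f (z0 + r * cis t) / (z0 + r * cis t - a))%C); [lra| |].
    - intros t _. apply HQ.
    - intros t Ht.
      assert (D : (z0 + r * cis t - a)%C <> 0%C) by (intros X; apply (Za t), Csub_0_eq, X).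
      rewrite Cmod_div, !Cmod_mult, Cmod_Ci, Cmod_cis, Cmod_R, Rabs_pos_eq by (auto; lra).
      assert (D1 : r - Cmod (a - z0) <= Cmod (z0 + r * cis t - a)).
      { replace (z0 + r * cis t - a)%C with ((z0 + r * cis t - z0) - (a - z0))%C by ring.
        eapply Rle_trans; [|apply Cmod_ge_sub]. rewrite Circ. lra. }
      specialize (HM t Ht). assert (X := Cmod_ge_0 (f (z0 + r * cis t)%C)).
      unfold Rdiv. apply Rmult_le_compat; [nra| | nra |].
      + left. apply Rinv_0_lt_compat. lra.
      + apply Rinv_le_contravar; lra. }
  (* The two primitives return to their initial values after one turn; only the term [i t] grows. *)
  replace (Q (2 * PI)%R - Q 0%R)%C with (f a * (Ci * RtoC (2 * PI)))%C in B.
  2: { unfold Q, Lf. replace (cis (2 * PI)) with (cis 0).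
       2: { unfold cis. now rewrite cos_2PI, sin_2PI, cos_0, sin_0. }
       replace (cis (- (2 * PI))) with (cis (- 0)).
       2: { unfold cis. now rewrite !cos_neg, !sin_neg, cos_2PI, sin_2PI, cos_0, sin_0. }
       ring. }
  assert (HPI := PI_RGT_0).
  rewrite !Cmod_mult, Cmod_Ci, Cmod_R, Rabs_pos_eq in B by lra.
  assert (B' : Cmod (f a) <= M * r / (r - Cmod (a - z0))).
  { apply (Rmult_le_reg_r (2 * PI)); lra. }
  apply (Rmult_le_compat_r (r - Cmod (a - z0))) in B'; [|lra].
  replace (M * r / (r - Cmod (a - z0)) * (r - Cmod (a - z0))) with (M * r) in B' by (field; lra).
  exact B'.
Qed.

Lemma circle_bound (f : C -> C) (z0 : C) (r : R) :
  (forall t, ccont f (z0 + r * cis t)%C) ->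
  exists M, forall t, 0 <= t <= 2 * PI -> Cmod (f (z0 + r * cis t)%C) <= M.
Proof.
  intros H. assert (HPI := PI_RGT_0).
  assert (Hc : forall t, continuity_pt (fun t => Cmod (f (z0 + r * cis t)%C)) t).
  { intros t. apply continuity_pt_filterlim. apply continuous_eps. intros e He.
    destruct (H t e He) as [d [Hd K]].
    assert (Dg : rderiv (fun s => z0 + r * cis s)%C t (0 + r * (Ci * cis t))%C).
    { apply rderiv_plus.
      - apply (rderiv_ext (fun s => z0 + RtoC s * 0)%C); [intros; ring|]. apply rderiv_seg.
      - apply rderiv_cmult, cis_rderiv. }
    assert (Cg : exists d', 0 < d' /\ forall s, Rabs (s - t) < d' ->
       Cmod ((z0 + r * cis s) - (z0 + r * cis t)) < d).
    { rewrite rderiv_eps in Dg. destruct (Dg 1 Rlt_0_1) as [d1 [H1 K1]].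
      set (v := (0 + r * (Ci * cis t))%C) in *. assert (Hv := Cmod_ge_0 v).
      exists (Rmin d1 (d / (Cmod v + 1))). split; [apply Rmin_pos; auto; apply Rdiv_lt_0_compat; lra|].
      intros s Hs. assert (S1 := Rlt_le_trans _ _ _ Hs (Rmin_l _ _)).
      assert (S2 := Rlt_le_trans _ _ _ Hs (Rmin_r _ _)). specialize (K1 s S1).
      apply (Rmult_lt_compat_r (Cmod v + 1)) in S2; [|lra].
      replace (d / (Cmod v + 1) * (Cmod v + 1)) with d in S2 by (field; lra).
      replace ((z0 + r * cis s) - (z0 + r * cis t))%C
        with ((z0 + r * cis s - (z0 + r * cis t) - v * RtoC (s - t)) + v * RtoC (s - t))%C by ring.
      eapply Rle_lt_trans; [apply Cmod_triangle|]. rewrite (Cmod_mult v), Cmod_R. lra. }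
    destruct Cg as [d' [Hd' K']]. exists d'. split; auto. intros s Hs. specialize (K _ (K' s Hs)).
    assert (A := Cmod_ge_sub (f (z0 + r * cis s)%C) (f (z0 + r * cis t)%C)).
    assert (B := Cmod_ge_sub (f (z0 + r * cis t)%C) (f (z0 + r * cis s)%C)).
    rewrite Cmod_sub_sym in B. apply Rabs_def1; lra. }
  destruct (continuity_ab_maj _ 0 (2 * PI) ltac:(lra) (fun c _ => Hc c)) as [m [Hm _]].
  eexists. exact Hm.
Qed.

(* Apply the Cauchy estimate to [f z / (z - z0) ^ n] and let [n] tend to infinity. *)
Lemma identity_disc (f : C -> C) (z0 : C) (Rd rho : R) :
  0 < rho -> (forall z, Cmod (z - z0) < Rd -> cderivable f z) ->
  (forall z, Cmod (z - z0) < rho -> f z = 0%C) ->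
  forall z, Cmod (z - z0) < Rd -> f z = 0%C.
Proof.
  intros Hrho Hf H0 a Ha.
  destruct (Rlt_dec (Cmod (a - z0)) rho) as [L|L]; auto. apply Rnot_lt_le in L.
  set (r := (Cmod (a - z0) + Rd) / 2). set (q := Cmod (a - z0)) in *.
  assert (Hr : q < r < Rd) by (unfold r; lra).
  assert (Circ : forall t, Cmod (z0 + r * cis t - z0) = r).
  { intros t. replace (z0 + r * cis t - z0)%C with (r * cis t)%C by ring.
    rewrite Cmod_mult, Cmod_cis, Cmod_R, Rabs_pos_eq; lra. }
  destruct (circle_bound f z0 r) as [M HM].
  { intros t. apply cderivable_ccont, Hf. rewrite Circ. lra. }
  (* The factor [r / (r - q)] of the Cauchy estimate does not depend on [n], while [(q / r) ^ n]
     tends to 0. *)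
  assert (E : forall n, Cmod (f a) * (r - q) <= M * r * (q / r) ^ n).
  { intros n.
    assert (X := cauchy_estimate (fun z => f z / (z - z0) ^ n)%C z0 a Rd r (M / r ^ n)).
    assert (Pr : 0 < r ^ n) by (apply pow_lt; lra). assert (Pq : 0 < q ^ n) by (apply pow_lt; lra).
    assert (Nz : forall z, z <> z0 -> ((z - z0) ^ n)%C <> 0%C).
    { intros z N. apply Cpow_nz. intros Y. apply N, Csub_0_eq, Y. }
    assert (Na : a <> z0) by (intros ->; unfold q in L; rewrite Cmod_self in L; lra).
    assert (Y : Cmod (f a / (a - z0) ^ n) * (r - q) <= M / r ^ n * r).
    { apply X; [lra | unfold q in Hr; lra | | ].
      (* Near [z0] the quotient is identically 0, and at [z0] itself too: the numerator is 0
         whatever value the inverse of 0 has. *)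
      - intros z Hz. destruct (Ceq_dec z z0) as [->|N].
        + apply (cderivable_loc (fun _ => 0%C) _ _ rho Hrho); [|apply cderivable_const].
          intros w Hw. rewrite H0 by auto. unfold Cdiv. ring.
        + apply cderivable_div; auto. apply cderivable_pow. apply cderivable_minus; [apply cderivable_id|apply cderivable_const].
      - intros t Ht. assert (z0 + r * cis t <> z0)%C.
        { intros Y. assert (Z := Circ t). rewrite Y, Cmod_self in Z. lra. }
        rewrite Cmod_div, Cmod_pow, Circ by auto. unfold Rdiv.
        apply Rmult_le_compat_r; auto. left. now apply Rinv_0_lt_compat. }
    rewrite Cmod_div, Cmod_pow in Y by auto. fold q in Y.
    unfold Rdiv at 1. rewrite Rpow_mult_distr, pow_inv.
    apply (Rmult_le_compat_r (q ^ n)) in Y; [|lra].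
    replace (Cmod (f a) / q ^ n * (r - q) * q ^ n) with (Cmod (f a) * (r - q)) in Y by (field; lra).
    replace (M * r * (q ^ n * / r ^ n)) with (M / r ^ n * r * q ^ n) by (field; lra). exact Y. }
  apply Cmod_eq_0. apply Rle_antisym; [|apply Cmod_ge_0]. apply Rnot_lt_le. intros P.
  assert (Hqr : 0 <= q / r < 1).
  { split.
    - apply Rmult_le_pos; [lra|]. left. apply Rinv_0_lt_compat. lra.
    - apply (Rmult_lt_reg_r r); [lra|]. unfold Rdiv. rewrite Rmult_assoc, Rinv_l by lra. lra. }
  assert (HM0 : 0 <= M).
  { eapply Rle_trans; [apply Cmod_ge_0|]. apply (HM 0). assert (X := PI_RGT_0). lra. }
  assert (Pe : 0 < Cmod (f a) * (r - q) / (M * r + 1)).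
  { apply Rdiv_lt_0_compat; [apply Rmult_lt_0_compat; lra|]. nra. }
  destruct (pow_lt_1_zero (q / r) ltac:(rewrite Rabs_pos_eq; lra) _ Pe) as [n Hn].
  specialize (Hn n (le_n _)). rewrite Rabs_pos_eq in Hn by (apply pow_le; lra).
  specialize (E n). assert (Pn : 0 <= (q / r) ^ n) by (apply pow_le; lra).
  apply (Rmult_lt_compat_r (M * r + 1)) in Hn; [|nra].
  replace (Cmod (f a) * (r - q) / (M * r + 1) * (M * r + 1)) with (Cmod (f a) * (r - q)) in Hn by (field; nra).
  nra.
Qed.

(** * Reflection across an arc and the principal square root *)


Lemma cis_small (d : R) : 0 < d -> exists t, 0 < t < PI /\ Cmod (cis t - 1) < d.
Proof.
  intros Hd. assert (D := cis_rderiv 0). rewrite rderiv_eps in D.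
  destruct (D 1 Rlt_0_1) as [d1 [H1 K1]]. assert (HPI := PI_RGT_0).
  set (t := Rmin (PI / 2) (Rmin (d1 / 2) (d / 4))).
  assert (Ht : 0 < t) by (unfold t; repeat apply Rmin_pos; lra).
  assert (T1 : t <= PI / 2) by apply Rmin_l.
  assert (T2 : t <= d1 / 2) by (eapply Rle_trans; [apply Rmin_r|apply Rmin_l]).
  assert (T3 : t <= d / 4) by (eapply Rle_trans; [apply Rmin_r|apply Rmin_r]).
  exists t. split; [lra|].
  assert (E0 : cis 0 = 1%C) by (unfold cis; rewrite cos_0, sin_0; reflexivity).
  specialize (K1 t). rewrite Rminus_0_r, (Rabs_pos_eq t) in K1 by lra. specialize (K1 ltac:(lra)).
  rewrite E0 in K1.
  replace (cis t - 1)%C with ((cis t - 1 - Ci * 1 * t) + Ci * 1 * t)%C by ring.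
  eapply Rle_lt_trans; [apply Cmod_triangle|].
  rewrite (Cmod_mult (Ci * 1)), Cmod_mult, Cmod_Ci, Cmod_1, Cmod_R, Rabs_pos_eq by lra. lra.
Qed.

Lemma cis_ne_1 (t : R) : 0 < t < PI -> cis t <> 1%C.
Proof.
  intros Ht E. assert (S : 0 < sin t) by (apply sin_gt_0; lra).
  unfold cis in E. apply (f_equal Im) in E. simpl in E. lra.
Qed.

Lemma Re_le_Cmod_signed (z : C) : Re z <= Cmod z.
Proof. eapply Rle_trans; [apply Rle_abs | apply re_le_Cmod]. Qed.

(* Schwarz reflection in disguise: extending [h] by 0 across the arc keeps it complex
   differentiable, because the derivative of [h] vanishes along the arc. *)
Lemma arc_zero (h : C -> C) (eta : R) :
  (forall q, Cmod (q - 1) < eta -> cderivable h q) ->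
  (forall q, Cmod q = 1 -> Cmod (q - 1) < eta -> h q = 0%C) ->
  forall q, Cmod (q - 1) < eta -> Cmod q <= 1 -> h q = 0%C.
Proof.
  intros Hh Hz.
  set (g := fun q => if Rle_dec (Cmod q) 1 then h q else 0%C).
  assert (Hg : forall q, Cmod (q - 1) < eta -> cderivable g q).
  { intros q Hq. destruct (Rtotal_order (Cmod q) 1) as [L|[E|G]].
    - apply (cderivable_loc h _ _ (1 - Cmod q)); [lra| |auto].
      intros w Hw. unfold g. destruct Rle_dec as [_|N]; auto. exfalso. apply N.
      assert (X := Cmod_ge_sub w q). lra.
    - assert (Z := Hz q E Hq). destruct (Hh q Hq) as [l Hl].
      (* Along the circle points [q * cis t] the function stays 0, so a nonzero [l] would violate
         the first-order approximation. *)
      assert (El : l = 0%C).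
      { apply NNPP. intros Nl. assert (Pl := proj1 (Cmod_gt_0 _) Nl).
        destruct (Hl (Cmod l / 2) ltac:(lra)) as [d [Hd K]].
        destruct (cis_small (Rmin d (eta - Cmod (q - 1)))) as [t [Ht Et]]; [apply Rmin_pos; lra|].
        assert (E1 := Rlt_le_trans _ _ _ Et (Rmin_l _ _)).
        assert (E2 := Rlt_le_trans _ _ _ Et (Rmin_r _ _)).
        assert (Dq : Cmod (q * cis t - q) = Cmod (cis t - 1)).
        { replace (q * cis t - q)%C with (q * (cis t - 1))%C by ring. rewrite Cmod_mult, E. ring. }
        specialize (K (q * cis t)%C ltac:(lra)). rewrite Z in K. rewrite Hz in K.
        - replace (0 - 0 - l * (q * cis t - q))%C with (- (l * (q * cis t - q)))%C in K by ring.
          rewrite Cmod_opp, Cmod_mult, Dq in K.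
          assert (0 < Cmod (cis t - 1)) by (apply Cmod_sub_pos, cis_ne_1; auto). nra.
        - rewrite Cmod_mult, E, Cmod_cis. ring.
        - eapply Rle_lt_trans; [apply (Cmod_tri _ q)|]. lra. }
      subst l. exists 0%C. intros e He. destruct (Hl e He) as [d [Hd K]]. exists d. split; auto.
      intros w Hw. specialize (K w Hw). assert (Gq : g q = 0%C) by (unfold g; destruct Rle_dec; auto).
      rewrite Gq. rewrite Z in K. unfold g. destruct Rle_dec; auto.
      replace (0 - 0 - 0 * (w - q))%C with (RtoC 0) by ring. rewrite Cmod_0.
      apply Rmult_le_pos; [lra | apply Cmod_ge_0].
    - apply (cderivable_loc (fun _ => 0%C) _ _ (Cmod q - 1)); [lra| |apply cderivable_const].
      intros w Hw. unfold g. destruct Rle_dec as [N|_]; auto. exfalso.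
      assert (X := Cmod_ge_sub q w). rewrite Cmod_sub_sym in X. lra. }
  intros q Hq Hq1.
  assert (Gq : g q = h q) by (unfold g; destruct Rle_dec; [auto|contradiction]).
  (* The identity theorem is centred at [1 + s], whose disc of radius [s] lies in [Re z > 1], where
     [g] is 0. The third makes [|q - 1| + s] smaller than [eta - s], so [q] is reached without
     leaving the disc of radius [eta] about 1. *)
  rewrite <- Gq. set (s := (eta - Cmod (q - 1)) / 3).
  assert (Hs : Cmod (RtoC (1 + s) - 1) = s).
  { rewrite RtoC_plus. replace (1 + s - 1)%C with (RtoC s) by ring. rewrite Cmod_R, Rabs_pos_eq; unfold s; lra. }
  apply (identity_disc g (RtoC (1 + s)) (eta - s) s).
  - unfold s; lra.
  - intros z Hz'. apply Hg. eapply Rle_lt_trans; [apply (Cmod_tri _ (RtoC (1 + s)))|]. lra.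
  - intros z Hz'. unfold g. destruct Rle_dec as [N|_]; auto. exfalso.
    assert (X := re_le_Cmod (z - RtoC (1 + s))). apply Rabs_le_between in X.
    assert (Y := Re_le_Cmod_signed z). destruct z as [x y]. simpl in X, Y. lra.
  - eapply Rle_lt_trans; [apply (Cmod_tri _ 1)|]. rewrite (Cmod_sub_sym 1), Hs. unfold s. lra.
Qed.

Definition csqrt (z : C) : C :=
  let m := sqrt ((Cmod z + Re z) / 2) in (m, Im z / (2 * m)).

(** The second part says that the argument of the root is below [PI / 4]; hence a product of two
    such roots has positive real part, which later decides a sign. *)
Lemma csqrt_spec (z : C) : 0 < Re z ->
  (csqrt z * csqrt z)%C = z /\ Rabs (Im (csqrt z)) < Re (csqrt z).
Proof.
  intros Hz. assert (Hm := Cmod_sqr z). assert (Hr := Re_le_Cmod_signed z).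
  set (m := sqrt ((Cmod z + Re z) / 2)).
  assert (Pm : 0 < m) by (apply sqrt_lt_R0; lra).
  assert (Em : m * m = (Cmod z + Re z) / 2) by (apply sqrt_sqrt; lra).
  assert (E1 : m * m - Im z / (2 * m) * (Im z / (2 * m)) = Re z).
  { apply (Rmult_eq_reg_r (4 * (m * m))); [|nra].
    replace ((m * m - Im z / (2 * m) * (Im z / (2 * m))) * (4 * (m * m)))
      with (4 * (m * m) * (m * m) - Im z * Im z) by (field; lra).
    rewrite Em. nra. }
  split.
  - apply C_ext; unfold csqrt; simpl; fold m.
    + exact E1.
    + field. lra.
  - unfold csqrt; simpl; fold m. set (n := Im z / (2 * m)) in *.
    apply Rnot_le_lt. intros L.
    assert (m * m <= Rabs n * Rabs n) by (apply Rmult_le_compat; lra).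
    assert (Rabs n * Rabs n = n * n) by (rewrite <- Rabs_mult; apply Rabs_pos_eq; nra). lra.
Qed.

(** The slope is [1 / (csqrt w + csqrt z)], whose denominator has real part at least that of
    [csqrt z]. *)
Lemma csqrt_cderivable (z : C) : 0 < Re z -> cderivable csqrt z.
Proof.
  intros Hz.
  assert (Pos : forall w, 0 < Re w -> 0 < Re (csqrt w)).
  { intros w Hw. destruct (csqrt_spec w Hw) as [_ K]. assert (X := Rabs_pos (Im (csqrt w))). lra. }
  assert (Near : forall w, Cmod (w - z) < Re z -> 0 < Re w).
  { intros w Hw. assert (X := re_le_Cmod (w - z)). apply Rabs_le_between in X.
    destruct w, z; simpl in *; lra. }
  assert (Sum : forall w, 0 < Re w -> Re (csqrt z) <= Cmod (csqrt w + csqrt z)).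
  { intros w Hw. eapply Rle_trans; [|apply Re_le_Cmod_signed]. assert (X := Pos w Hw). 
    destruct (csqrt w), (csqrt z); simpl in *; lra. }
  assert (Hs := Pos z Hz).
  assert (Sum0 : forall w, 0 < Re w -> (csqrt w + csqrt z)%C <> 0%C).
  { intros w Hw. apply Cmod_gt_0. specialize (Sum w Hw). lra. }
  assert (Diff : forall w, 0 < Re w -> csqrt w = (csqrt z + / (csqrt w + csqrt z) * (w - z))%C).
  { intros w Hw. rewrite <- (proj1 (csqrt_spec w Hw)) at 3. rewrite <- (proj1 (csqrt_spec z Hz)) at 3.
    field. auto. }
  assert (Cc : ccont csqrt z).
  { intros e He. exists (Rmin (Re z) (e * Re (csqrt z))). split; [apply Rmin_pos; nra|].
    intros w Hw. assert (W1 := Near w (Rlt_le_trans _ _ _ Hw (Rmin_l _ _))).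
    assert (W2 := Rlt_le_trans _ _ _ Hw (Rmin_r _ _)).
    rewrite (Diff w W1).
    replace (csqrt z + / (csqrt w + csqrt z) * (w - z) - csqrt z)%C
      with (/ (csqrt w + csqrt z) * (w - z))%C by ring.
    rewrite Cmod_mult, Cmod_inv by auto. specialize (Sum w W1).
    apply (Rmult_lt_reg_l (Cmod (csqrt w + csqrt z))); [lra|].
    rewrite <- Rmult_assoc, Rinv_r by lra. nra. }
  apply (cderivable_loc (fun w => csqrt z + / (csqrt w + csqrt z) * (w - z))%C _ _ (Re z) Hz).
  { intros w Hw. symmetry. apply Diff, Near, Hw. }
  exists (/ (csqrt z + csqrt z))%C. apply cderiv_slope.
  exists (fun w => / (csqrt w + csqrt z))%C. repeat split.
  - intros w. ring.
  - apply ccont_inv; auto. apply ccont_plus; auto. apply ccont_const.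
Qed.

Lemma cderiv_pow6 (z : C) : cderiv (fun w => w ^ 6)%C z (6 * z ^ 5)%C.
Proof.
  apply cderiv_slope.
  exists (fun w => w ^ 5 + w ^ 4 * z + w ^ 3 * z ^ 2 + w ^ 2 * z ^ 3 + w * z ^ 4 + z ^ 5)%C.
  split; [|split].
  - intros w. ring.
  - apply cderivable_ccont. repeat apply cderivable_plus; repeat apply cderivable_mult;
      try (apply (cderivable_pow (fun w => w))); try apply cderivable_id; apply cderivable_const.
  - ring.
Qed.

Lemma cderiv_unique (f : C -> C) (z l m : C) : cderiv f z l -> cderiv f z m -> l = m.
Proof.
  intros Hl Hm. apply NNPP. intros N. assert (P := Cmod_sub_pos _ _ N).
  destruct (Hl (Cmod (l - m) / 4) ltac:(lra)) as [d1 [H1 K1]].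
  destruct (Hm (Cmod (l - m) / 4) ltac:(lra)) as [d2 [H2 K2]].
  set (d := Rmin d1 d2 / 2). assert (Hd : 0 < d) by (unfold d; assert (0 < Rmin d1 d2) by (apply Rmin_pos; auto); lra).
  assert (D1 : d < d1) by (unfold d; assert (X := Rmin_l d1 d2); lra).
  assert (D2 : d < d2) by (unfold d; assert (X := Rmin_r d1 d2); lra).
  assert (E : Cmod (z + d - z) = d).
  { replace (z + d - z)%C with (RtoC d) by ring. rewrite Cmod_R, Rabs_pos_eq; lra. }
  specialize (K1 (z + d)%C ltac:(lra)). specialize (K2 (z + d)%C ltac:(lra)). rewrite E in K1, K2.
  assert (X : Cmod ((l - m) * (z + d - z)) <= Cmod (l - m) / 2 * d).
  { replace ((l - m) * (z + d - z))%C with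
     ((f (z + d) - f z - m * (z + d - z)) - (f (z + d) - f z - l * (z + d - z)))%C by ring.
    eapply Rle_trans; [apply Cmod_sub_le|]. lra. }
  rewrite Cmod_mult, E in X. nra.
Qed.

Lemma rderiv_unique (g : R -> C) (t : R) (v w : C) : rderiv g t v -> rderiv g t w -> v = w.
Proof.
  intros [A B] [A' B']. apply C_ext.
  - rewrite <- (is_derive_unique _ _ _ A). apply is_derive_unique, A'.
  - rewrite <- (is_derive_unique _ _ _ B). apply is_derive_unique, B'.
Qed.

(** * The inverse function as an integral over the unit disc *)


(** This is [exp (2 i arcsin k)]: since [p^6 = exp (2 i psi)], the points where [p^6] is [omega k]
    or its conjugate are those with [sin(phi)^2 = 1]. *)
Definition omega (k : R) : C := (1 - 2 * k ^ 2, 2 * k * sqrt (1 - k ^ 2)).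

(** A product of two roots instead of the root of a product: on the disc each factor stays in the
    right half plane, so the principal branch is holomorphic. *)
Definition radical (k : R) (p : C) : C :=
  (csqrt (1 - omega k * p ^ 6) * csqrt (1 - Cconj (omega k) * p ^ 6))%C.

(** From [du = cos(2 psi / 3) / (k cos phi) dpsi], using [dpsi = -3 i dp / p],
    [cos(2 psi / 3) = (p^4 + 1) / (2 p^2)] and [2 k cos(phi) p^3 = radical k p]. *)
Definition density (k : R) (p : C) : C := (- (3) * Ci * (p ^ 4 + 1) / radical k p)%C.

Definition inv_int (k : R) : C -> C := seg_int (density k) 1.

(** [2 - p^6 - p^-6] is [4 sin(psi)^2]; the constants [A], [B] treat the three functions at once. *)
Definition target (A B p : C) : C := (A + B * (2 - p ^ 6 - / p ^ 6))%C.

(** The small disc makes the base point 1, on the boundary of the unit disc, an interior point; the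
    union is still star-shaped about 1. *)
Definition domain (rho : R) (p : C) : Prop := Cmod p < 1 \/ Cmod (p - 1) < rho.

Lemma omega_mod (k : R) : 0 < k < 1 -> Cmod (omega k) = 1.
Proof.
  intros Hk. assert (S : 0 <= 1 - k ^ 2) by nra.
  assert (E := Cmod_sqr (omega k)). unfold omega in E at 3 4 5 6; simpl in E.
  assert (Q : sqrt (1 - k * (k * 1)) * sqrt (1 - k * (k * 1)) = 1 - k * (k * 1)) by (apply sqrt_sqrt; simpl in S; lra).
  assert (P := Cmod_ge_0 (omega k)).
  assert (Cmod (omega k) * Cmod (omega k) = 1).
  { rewrite E. transitivity ((1 - 2 * (k * (k * 1))) * (1 - 2 * (k * (k * 1))) +
      4 * (k * k) * (sqrt (1 - k * (k * 1)) * sqrt (1 - k * (k * 1)))); [ring|]. rewrite Q. ring. }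
  nra.
Qed.

Lemma radical_factor_pos (c p : C) : Cmod c = 1 -> Cmod p < 1 -> 0 < Re (1 - c * p ^ 6).
Proof.
  intros Hc Hp. assert (X := Re_le_Cmod_signed (c * p ^ 6)).
  rewrite Cmod_mult, Hc, Cmod_pow in X. assert (P := Cmod_ge_0 p).
  assert (Cmod p ^ 6 < 1).
  { assert (Cmod p * Cmod p < 1) by nra.
    replace (Cmod p ^ 6) with ((Cmod p * Cmod p) * ((Cmod p * Cmod p) * (Cmod p * Cmod p))) by ring.
    assert (0 <= Cmod p * Cmod p) by nra. set (x := Cmod p * Cmod p) in *.
    assert (x * x <= 1) by nra. assert (x * (x * x) <= x * 1) by (apply Rmult_le_compat_l; lra). lra. }
  unfold Cminus. change (Re (1 + - (c * p ^ 6))) with (1 + - Re (c * p ^ 6)). lra.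
Qed.

Lemma radical_factor_cderivable (c p : C) : cderivable (fun p => 1 - c * p ^ 6)%C p.
Proof.
  apply cderivable_minus; [apply cderivable_const|]. apply cderivable_mult; [apply cderivable_const|].
  apply (cderivable_pow (fun w => w)), cderivable_id.
Qed.

Lemma radical_factor_near (c p : C) (m : R) : m < Re (1 - c * p ^ 6) ->
  exists rho, 0 < rho /\ forall q, Cmod (q - p) < rho -> m < Re (1 - c * q ^ 6).
Proof.
  intros H. destruct (cderivable_ccont _ _ (radical_factor_cderivable c p) (Re (1 - c * p ^ 6) - m) ltac:(lra)) as [d [Hd K]].
  exists d. split; auto. intros q Hq. specialize (K q Hq).
  assert (X := re_le_Cmod (1 - c * q ^ 6 - (1 - c * p ^ 6))). apply Rabs_le_between in X.
  change (Re (1 - c * q ^ 6 - (1 - c * p ^ 6))) with (Re (1 - c * q ^ 6) + - Re (1 - c * p ^ 6)) in X. lra.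
Qed.

(** At [p = 1] both factors have real part [2 k^2 > 0], and continuity does the rest. *)
Lemma domain_exists (k : R) : 0 < k < 1 -> exists rho, 0 < rho /\
  forall p, domain rho p -> 0 < Re (1 - omega k * p ^ 6) /\ 0 < Re (1 - Cconj (omega k) * p ^ 6).
Proof.
  intros Hk. assert (M := omega_mod k Hk).
  destruct (radical_factor_near (omega k) 1 0) as [r1 [H1 K1]].
  { rewrite Cpow_1_l. unfold omega; simpl. nra. }
  destruct (radical_factor_near (Cconj (omega k)) 1 0) as [r2 [H2 K2]].
  { rewrite Cpow_1_l. unfold omega; simpl. nra. }
  exists (Rmin r1 r2). split; [apply Rmin_pos; auto|]. intros p [Hp|Hp].
  - split; apply radical_factor_pos; auto. rewrite Cmod_conj; auto.
  - split; [apply K1|apply K2]; eapply Rlt_le_trans; [exact Hp|apply Rmin_l|exact Hp|apply Rmin_r].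
Qed.

Lemma csqrt_nz (z : C) : 0 < Re z -> csqrt z <> 0%C.
Proof.
  intros H E. destruct (csqrt_spec z H) as [_ K]. rewrite E in K. simpl in K. rewrite Rabs_R0 in K. lra.
Qed.

Lemma density_cderivable (k : R) (p : C) :
  0 < Re (1 - omega k * p ^ 6) -> 0 < Re (1 - Cconj (omega k) * p ^ 6) -> cderivable (density k) p.
Proof.
  intros H1 H2. unfold density, radical. apply cderivable_div.
  - apply Cmult_neq_0; apply csqrt_nz; auto.
  - apply cderivable_mult; [apply cderivable_const|]. apply cderivable_plus; [|apply cderivable_const].
    apply (cderivable_pow (fun w => w)), cderivable_id.
  - apply cderivable_mult.
    + apply (cderivable_comp csqrt); [apply radical_factor_cderivable | apply csqrt_cderivable; auto].
    + apply (cderivable_comp csqrt); [apply radical_factor_cderivable | apply csqrt_cderivable; auto].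
Qed.

Lemma inv_int_deriv (k rho : R) :
  0 < rho ->
  (forall p, domain rho p -> 0 < Re (1 - omega k * p ^ 6) /\ 0 < Re (1 - Cconj (omega k) * p ^ 6)) ->
  forall p, domain rho p -> cderiv (inv_int k) p (density k p).
Proof.
  intros Hrho H. unfold inv_int. apply (star_primitive (domain rho)).
  - intros z [Hz|Hz].
    + destruct (disc_open 0 1 z) as [r [Hr K]].
      { now replace (z - 0)%C with z by ring. }
      exists r. split; auto. intros w Hw. left. specialize (K w Hw).
      now replace (w - 0)%C with w in K by ring.
    + destruct (disc_open 1 rho z Hz) as [r [Hr K]]. exists r. split; auto.
      intros w Hw. right. auto.
  - intros z t [Hz|Hz] Ht.
    + destruct (Req_dec t 0) as [->|N].
      * right. replace (1 + 0 * (z - 1) - 1)%C with (RtoC 0) by ring. rewrite Cmod_0. auto.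
      * left. replace (1 + t * (z - 1))%C with (RtoC (1 - t) + t * z)%C by (rewrite RtoC_minus; ring).
        eapply Rle_lt_trans; [apply Cmod_triangle|]. rewrite Cmod_mult, !Cmod_R, !Rabs_pos_eq by lra. nra.
    + right. apply disc_convex; auto. rewrite Cmod_self. auto.
  - intros z Hz. apply cderivable_ccont, density_cderivable; apply H; auto.
  - intros z Hz _. apply density_cderivable; apply H; auto.
Qed.

(** [p^4 = -1] forces [|p| = 1]. Consequently [inv_int k] is nowhere locally constant in the
    disc. *)
Lemma density_nz (k : R) (p : C) : 0 < k < 1 -> Cmod p < 1 -> density k p <> 0%C.
Proof.
  intros Hk Hp. assert (M := omega_mod k Hk).
  assert (N4 : (p ^ 4 + 1)%C <> 0%C).
  { intros E. assert (X : Cmod (p ^ 4) = 1).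
    { replace (p ^ 4)%C with ((p ^ 4 + 1) - 1)%C by ring. rewrite E.
      replace (0 - 1)%C with (- (1))%C by ring. apply Cmod_m1. }
    rewrite Cmod_pow in X. assert (P := Cmod_ge_0 p).
    assert (Cmod p * Cmod p < 1) by nra. assert (0 <= Cmod p * Cmod p) by nra.
    replace (Cmod p ^ 4) with ((Cmod p * Cmod p) * (Cmod p * Cmod p)) in X by ring. nra. }
  assert (NR : radical k p <> 0%C).
  { unfold radical. apply Cmult_neq_0; apply csqrt_nz, radical_factor_pos; rewrite ?Cmod_conj; auto. }
  unfold density, Cdiv. apply Cmult_neq_0; [apply Cmult_neq_0; auto|].
  - apply Cmult_neq_0.
    + intros E. apply (f_equal Re) in E. simpl in E. lra.
    + intros E. apply (f_equal Im) in E. simpl in E. lra.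
  - intros E. apply (f_equal (fun x => (radical k p * x)%C)) in E. rewrite Cinv_r in E by auto.
    apply (f_equal Re) in E. simpl in E. lra.
Qed.

Lemma target_cderiv (A B p : C) : p <> 0%C ->
  cderiv (target A B) p (B * (- (6 * p ^ 5) + 6 * p ^ 5 / (p ^ 6 * p ^ 6)))%C.
Proof.
  intros Hp. unfold target. eapply cderiv_eq.
  - apply cderiv_plus; [apply cderiv_const|].
    apply cderiv_mult; [apply cderiv_const|].
    apply cderiv_minus; [apply cderiv_minus; [apply cderiv_const|apply cderiv_pow6]|].
    apply (cderiv_inv (fun w => w ^ 6)%C); [apply Cpow_nz; auto|apply cderiv_pow6].
  - simpl. field. auto.
Qed.

(** * The chord from 1 to the eighth root of unity *)

Definition zeta8 : C := (sqrt 2 / 2, sqrt 2 / 2).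

Lemma sqrt2_half_sqr : sqrt 2 / 2 * (sqrt 2 / 2) = 1 / 2.
Proof.
  replace (sqrt 2 / 2 * (sqrt 2 / 2)) with (sqrt 2 * sqrt 2 / 4) by field. rewrite sqrt_sqrt; lra.
Qed.

Lemma zeta8_sqr : (zeta8 * zeta8)%C = Ci.
Proof. assert (X := sqrt2_half_sqr). apply C_ext; simpl; lra. Qed.

Lemma zeta8_pow6 : (zeta8 ^ 6)%C = (- Ci)%C.
Proof.
  replace (zeta8 ^ 6)%C with ((zeta8 * zeta8) * (zeta8 * zeta8) * (zeta8 * zeta8))%C by ring. rewrite zeta8_sqr.
  apply C_ext; simpl; ring.
Qed.

Lemma zeta8_mod : Cmod zeta8 = 1.
Proof.
  assert (X := sqrt2_half_sqr). assert (E := Cmod_sqr zeta8). simpl in E. assert (P := Cmod_ge_0 zeta8). nra.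
Qed.

Definition chord (t : R) : C := (1 + RtoC t * (zeta8 - 1))%C.

(** Both ends have modulus 1, so the squared modulus is 1 minus a multiple of [t (1 - t)]: the chord
    leaves the circle at a linear rate, which bounds the radical from below near [zeta8]. *)
Lemma chord_mod (t : R) :
  Cmod (chord t) * Cmod (chord t) = 1 - t * (1 - t) * (Cmod (zeta8 - 1) * Cmod (zeta8 - 1)).
Proof.
  assert (X := sqrt2_half_sqr). rewrite !Cmod_sqr. unfold chord, zeta8; simpl.
  set (s := sqrt 2 / 2) in *. apply Rminus_diag_uniq. transitivity (t * (2 * (s * s) - 1)); [ring|]. rewrite X. field.
Qed.

Lemma zeta8_ne_1 : 0 < Cmod (zeta8 - 1).
Proof.
  apply Cmod_sub_pos. intros E. apply (f_equal Im) in E. simpl in E.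
  assert (0 < sqrt 2) by (apply sqrt_lt_R0; lra). lra.
Qed.

Lemma chord_in (t : R) : 0 < t < 1 -> Cmod (chord t) < 1.
Proof.
  intros Ht. assert (X := chord_mod t). assert (Y := zeta8_ne_1).
  assert (0 < t * (1 - t) * (Cmod (zeta8 - 1) * Cmod (zeta8 - 1))) by (repeat apply Rmult_lt_0_compat; lra).
  assert (Z := Cmod_ge_0 (chord t)). nra.
Qed.

Lemma chord_nz (t : R) : 0 <= t <= 1 -> chord t <> 0%C.
Proof.
  intros Ht E. assert (X := sqrt2_half_sqr). assert (0 < sqrt 2) by (apply sqrt_lt_R0; lra).
  assert (E1 := f_equal Im E). assert (E2 := f_equal Re E). unfold chord, zeta8 in E1, E2; simpl in E1, E2. nra.
Qed.

Lemma chord_rderiv (t : R) : rderiv chord t (zeta8 - 1)%C.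
Proof. apply rderiv_seg. Qed.

Lemma chord_dist (s t : R) : Cmod (chord s - chord t) = Rabs (s - t) * Cmod (zeta8 - 1).
Proof.
  unfold chord. replace (1 + s * (zeta8 - 1) - (1 + t * (zeta8 - 1)))%C with (RtoC (s - t) * (zeta8 - 1))%C
    by (rewrite RtoC_minus; ring). now rewrite Cmod_mult, Cmod_R.
Qed.

Lemma chord_1 : chord 1 = zeta8.
Proof. unfold chord. ring. Qed.

(* The density tends to 0 at [zeta8]: its numerator vanishes there to first order, while the
   denominator is at least of the order of [sqrt (1 - t)] even when [zeta8] is a branch point. *)
Lemma density_chord_small (k eps : R) : 0 < k < 1 -> 0 < eps ->
  exists t1, 0 < t1 < 1 /\ forall t, t1 <= t < 1 -> Cmod (density k (chord t)) <= eps.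
Proof.
  intros Hk He. assert (M := omega_mod k Hk). assert (E0 := zeta8_ne_1). set (E := Cmod (zeta8 - 1)) in *.
  (* Since [zeta8^6 = -i], the conjugate factor has real part [1 + 2 k sqrt (1 - k^2)] at [zeta8];
     only the factor with [omega k] can vanish there. *)
  destruct (radical_factor_near (Cconj (omega k)) zeta8 (1/2)) as [rho [Hr K]].
  { rewrite zeta8_pow6. unfold omega; simpl. simpl.
    assert (0 <= sqrt (1 - k * (k * 1))) by apply sqrt_pos. nra. }
  (* [1/2] gives [t >= 1/2], the second bound gives [|p - zeta8| < rho]. For the third, the squared
     numerator is at most [144 (1 - t)^2 E^2] and the squared radical at least [(1 - t) E^2 / 4];
     576 is [4 * 144]. *)
  set (d := Rmin (1/2) (Rmin (rho / (2 * E)) (eps * eps / 576))).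
  assert (Hd : 0 < d) by (unfold d; repeat apply Rmin_pos; try lra; apply Rdiv_lt_0_compat; nra).
  assert (D1 : d <= 1/2) by apply Rmin_l.
  assert (D2 : d <= rho / (2 * E)) by (eapply Rle_trans; [apply Rmin_r|apply Rmin_l]).
  assert (D3 : d <= eps * eps / 576) by (eapply Rle_trans; [apply Rmin_r|apply Rmin_r]).
  exists (1 - d). split; [lra|]. intros t Ht.
  set (p := chord t).
  assert (Hp : Cmod p < 1) by (apply chord_in; lra).
  assert (Dp : Cmod (p - zeta8) = (1 - t) * E).
  { unfold p. rewrite <- chord_1 at 1. rewrite chord_dist, Rabs_left1 by lra. fold E. ring. }
  assert (Hnear : Cmod (p - zeta8) < rho).
  { rewrite Dp. apply (Rmult_le_compat_r (2 * E)) in D2; [|lra].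
    replace (rho / (2 * E) * (2 * E)) with rho in D2 by (field; lra). nra. }
  specialize (K p Hnear).
  assert (P1 : 0 < Re (1 - omega k * p ^ 6)) by (apply radical_factor_pos; auto).
  destruct (csqrt_spec _ P1) as [S1 _]. assert (S2' : 0 < Re (1 - Cconj (omega k) * p ^ 6)) by lra.
  destruct (csqrt_spec _ S2') as [S2 _].
  assert (N1 := csqrt_nz _ P1). assert (N2 := csqrt_nz _ S2').
  unfold density, radical. set (s1 := csqrt (1 - omega k * p ^ 6)) in *.
  set (s2 := csqrt (1 - Cconj (omega k) * p ^ 6)) in *.
  assert (M1 := proj1 (Cmod_gt_0 _) N1). assert (M2 := proj1 (Cmod_gt_0 _) N2).
  assert (B2 : 1/2 <= Cmod s2 * Cmod s2).
  { rewrite <- Cmod_mult, S2. eapply Rle_trans; [|apply Re_le_Cmod_signed]. lra. }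
  (* [|1 - omega p^6| >= 1 - |p|^6 >= 1 - |p|^2 = t (1 - t) E^2], with [t >= 1/2]. *)
  assert (B1 : (1 - t) * (E * E) / 2 <= Cmod s1 * Cmod s1).
  { rewrite <- Cmod_mult, S1. eapply Rle_trans; [|apply Cmod_ge_sub].
    rewrite Cmod_1, Cmod_mult, M, Cmod_pow.
    assert (C2 := chord_mod t). fold p E in C2. assert (Z := Cmod_ge_0 p).
    set (x := Cmod p * Cmod p) in *. assert (X : 0 <= x <= 1) by (unfold x; nra).
    replace (Cmod p ^ 6) with (x * x * x) by (unfold x; ring).
    assert (x * x * x <= x) by nra.
    assert (0 <= (1 - t) * (E * E) * (t - 1/2)) by (apply Rmult_le_pos; nra). nra. }
  assert (B4 : Cmod (p ^ 4 + 1) <= 4 * ((1 - t) * E)).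
  { replace (p ^ 4 + 1)%C with ((p - zeta8) * (p ^ 3 + p ^ 2 * zeta8 + p * zeta8 ^ 2 + zeta8 ^ 3))%C.
    - rewrite Cmod_mult, Dp. rewrite Rmult_comm. apply Rmult_le_compat_r; [nra|].
      assert (Z := Cmod_ge_0 p).
      eapply Rle_trans; [apply Cmod_triangle|].
      eapply Rle_trans; [apply Rplus_le_compat_r, Cmod_triangle|].
      eapply Rle_trans; [apply Rplus_le_compat_r, Rplus_le_compat_r, Cmod_triangle|].
      rewrite !Cmod_mult, !Cmod_pow, zeta8_mod, !pow1.
      assert (Cmod p ^ 2 <= 1) by (simpl; nra). assert (0 <= Cmod p ^ 2) by (simpl; nra).
      assert (Cmod p ^ 3 <= 1) by (replace (Cmod p ^ 3) with (Cmod p * Cmod p ^ 2) by ring; nra). lra.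
    - transitivity (p ^ 4 - (zeta8 * zeta8) * (zeta8 * zeta8))%C; [ring|]. rewrite zeta8_sqr.
      assert (CC : (Ci * Ci = - (1))%C) by (apply C_ext; simpl; ring). rewrite CC. ring. }
  rewrite Cmod_div, !Cmod_mult, Cmod_opp, Cmod_Ci, Cmod_R, Rabs_pos_eq by (auto; try lra; apply Cmult_neq_0; auto).
  set (x1 := Cmod s1) in *. set (x2 := Cmod s2) in *. set (y := Cmod (p ^ 4 + 1)) in *.
  assert (Hy : 0 <= y) by apply Cmod_ge_0.
  apply (Rmult_le_reg_r (x1 * x2)); [nra|]. unfold Rdiv. rewrite Rmult_assoc, Rinv_l by nra.
  rewrite Rmult_1_r.
  assert (Big : (1 - t) * (E * E) / 4 <= (x1 * x2) * (x1 * x2)).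
  { replace ((x1 * x2) * (x1 * x2)) with ((x1 * x1) * (x2 * x2)) by ring.
    assert (0 <= (1 - t) * (E * E)) by nra. nra. }
  apply Rnot_lt_le. intros L.
  assert (L2 : eps * (x1 * x2) * (eps * (x1 * x2)) < 3 * 1 * y * (3 * 1 * y)).
  { assert (0 <= eps * (x1 * x2)) by (repeat apply Rmult_le_pos; lra). nra. }
  assert (U : 3 * 1 * y * (3 * 1 * y) <= 144 * ((1 - t) * (1 - t) * (E * E))) by nra.
  assert (V : eps * eps * ((1 - t) * (E * E) / 4) <= eps * (x1 * x2) * (eps * (x1 * x2))).
  { replace (eps * (x1 * x2) * (eps * (x1 * x2))) with (eps * eps * ((x1 * x2) * (x1 * x2))) by ring.
    apply Rmult_le_compat_l; nra. }
  assert (W : 144 * ((1 - t) * (1 - t) * (E * E)) <= eps * eps * ((1 - t) * (E * E) / 4)).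
  { assert (0 <= (1 - t) * (E * E)) by nra. assert (576 * (1 - t) <= eps * eps) by lra. nra. }
  lra.
Qed.

(** * Analytic continuation along the chord *)


(** A substitute for a critical point at [zeta8], where [u] need not be holomorphic: as the
    derivative tends to 0 along the chord, [u] has a limit there and approaches it faster than
    linearly. *)
Lemma chord_limit (u : C -> C) (d : C -> C) :
  (forall p, Cmod p < 1 -> cderiv u p (d p)) ->
  (forall eps, 0 < eps -> exists t1, 0 < t1 < 1 /\ forall t, t1 <= t < 1 -> Cmod (d (chord t)) <= eps) ->
  exists u0, forall eps, 0 < eps -> exists t1, 0 < t1 < 1 /\
    forall t, t1 <= t < 1 -> Cmod (u (chord t) - u0) <= eps * Cmod (chord t - zeta8).
Proof.
  intros Hu Hd. set (E := Cmod (zeta8 - 1)). assert (HE : 0 < E) by apply zeta8_ne_1.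
  assert (HE2 : E <= 2).
  { unfold E. eapply Rle_trans; [apply Cmod_sub_le|]. rewrite zeta8_mod, Cmod_1. lra. }
  assert (Lip : forall eps t1, 0 < t1 < 1 -> (forall t, t1 <= t < 1 -> Cmod (d (chord t)) <= eps) ->
    forall s t, t1 <= s -> s <= t -> t < 1 -> Cmod (u (chord t) - u (chord s)) <= eps * E * (t - s)).
  { intros eps t1 Ht1 H s t Hs Hst Ht.
    apply (mean_value_ineq (fun t => u (chord t)) (fun t => d (chord t) * (zeta8 - 1))%C); auto.
    - intros x Hx. apply rderiv_comp; [apply Hu, chord_in; lra | apply chord_rderiv].
    - intros x Hx. rewrite Cmod_mult. fold E. apply Rmult_le_compat_r; [lra|]. apply H. lra. }
  destruct (Hd (1/2) ltac:(lra)) as [t1 [Ht1 K1]].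
  (* With [|d| <= 1/2] and [E <= 2], halving the distance to 1 makes [u] move by at most
     [(/2) ^ (S n)], as [geometric_cauchy_limit] requires. *)
  set (s := fun n : nat => 1 - (/2) ^ n * (1 - t1)).
  assert (Hpw : forall n, 0 < (/2) ^ n <= 1).
  { intros n. split; [apply pow_lt; lra|]. rewrite <- (pow1 n). apply pow_incr; lra. }
  assert (Hs : forall n, t1 <= s n < 1) by (intros n; unfold s; assert (X := Hpw n); nra).
  assert (Step : forall n, Cmod (u (chord (s (S n))) - u (chord (s n))) <= (/2) ^ (S n)).
  { intros n. assert (X := Hpw n).
    assert (D : s (S n) - s n = (/2) ^ (S n) * (1 - t1)) by (unfold s; simpl; field).
    assert (X' := Hpw (S n)).
    eapply Rle_trans; [apply (Lip (1/2) t1 Ht1 K1 (s n) (s (S n))); try apply Hs|].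
    - assert (0 <= (/2) ^ (S n) * (1 - t1)) by (apply Rmult_le_pos; lra). lra.
    - rewrite D. assert (1 / 2 * E <= 1) by lra. assert (0 < 1 / 2 * E) by lra.
      assert (0 <= (/2) ^ (S n) * (1 - t1) <= (/2) ^ (S n)) by nra. nra. }
  destruct (geometric_cauchy_limit (fun n => Re (u (chord (s n))))) as [x Hx].
  { intros n. eapply Rle_trans; [|apply (Step n)]. eapply Rle_trans; [|apply re_le_Cmod]. right. f_equal. }
  destruct (geometric_cauchy_limit (fun n => Im (u (chord (s n))))) as [y Hy].
  { intros n. eapply Rle_trans; [|apply (Step n)]. eapply Rle_trans; [|apply im_le_Cmod]. right. f_equal. }
  exists (x, y).
  assert (Lim : forall n, Cmod (u (chord (s n)) - (x, y)) <= 2 * (/2) ^ n).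
  { intros n. rewrite Cmod_sub_sym. eapply Rle_trans; [apply Cmod_le_ReIm|].
    specialize (Hx n). specialize (Hy n). 
    change (Re ((x, y) - u (chord (s n)))) with (x - Re (u (chord (s n)))).
    change (Im ((x, y) - u (chord (s n)))) with (y - Im (u (chord (s n)))). lra. }
  intros eps He. destruct (Hd eps He) as [t2 [Ht2 K2]].
  exists t2. split; auto. intros t Ht.
  rewrite <- chord_1, chord_dist, Rabs_left1 by lra. fold E.
  apply Rnot_lt_le. intros L.
  set (gap := Cmod (u (chord t) - (x, y)) - eps * (- (t - 1) * E)) in *.
  assert (Hgap : 0 < gap) by (unfold gap; lra).
  destruct (pow_lt_1_zero (/2) ltac:(rewrite Rabs_pos_eq; lra) (Rmin (gap / 2) (1 - t))) as [n Hn].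
  { apply Rmin_pos; lra. }
  specialize (Hn n (le_n _)). assert (X := Hpw n). rewrite Rabs_pos_eq in Hn by lra.
  assert (N1 := Rlt_le_trans _ _ _ Hn (Rmin_l _ _)). assert (N2 := Rlt_le_trans _ _ _ Hn (Rmin_r _ _)).
  assert (Hst : t <= s n) by (unfold s; nra).
  assert (A := Lip eps t2 Ht2 K2 t (s n) ltac:(lra) Hst ltac:(apply Hs)).
  assert (B := Lim n). assert (T := Cmod_tri (u (chord t)) (u (chord (s n))) (x, y)).
  rewrite Cmod_sub_sym in A.
  assert (eps * E * (s n - t) <= eps * (- (t - 1) * E)).
  { assert (Y := Hs n). assert (0 < eps * E) by nra. nra. }
  unfold gap in N1. lra.
Qed.

Lemma mero_cderivable (f : C -> C) (P : C -> Prop) (z : C) : meromorphic_with_poles f P ->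
  ~ P z -> exists r, 0 < r /\ forall w, Cmod (w - z) < r -> cderivable f w.
Proof.
  intros [H1 [H2 _]] Hz. destruct (H1 z) as [r [Hr K]]. exists r. split; auto.
  intros w Hw. apply cdiff_cderivable, H2. destruct (Ceq_dec w z) as [->|N]; auto.
  apply K. split; auto. now apply Cmod_sub_pos.
Qed.

(** Agreement on a whole disc, so that the identity theorem can be restarted at [p]. *)
Definition agree_near (f u D : C -> C) (p : C) : Prop :=
  exists r, 0 < r /\ forall q, Cmod (q - p) < r -> f (u q) = D q.

(** If [u p] is not a pole, the identity theorem applies near [p]. If it is, no nearby [q] can have
    agreement at all: [D] is bounded there and [f] is large around [u p], so [u] would equal [u p]
    near [q], against [d q <> 0]. *)
Lemma agree_near_spread (f u d D : C -> C) (P : C -> Prop) (p : C) (r0 : R) :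
  meromorphic_with_poles f P -> 0 < r0 ->
  (forall q, Cmod (q - p) < r0 -> cderiv u q (d q) /\ d q <> 0%C /\ cderivable D q) ->
  exists r, 0 < r /\ forall q, Cmod (q - p) < r -> agree_near f u D q ->
    forall q', Cmod (q' - p) < r -> agree_near f u D q'.
Proof.
  intros Hm Hr0 Hu.
  assert (Hp : Cmod (p - p) < r0) by (rewrite Cmod_self; auto).
  destruct (Hu p Hp) as [Up [_ Dp]].
  destruct (classic (P (u p))) as [Pu|Pu].
  - destruct (cderivable_ccont _ _ Dp 1 Rlt_0_1) as [r1 [H1 K1]].
    destruct Hm as [_ [_ H3]]. destruct (H3 _ Pu (Cmod (D p) + 1)) as [r2 [H2 K2]].
    destruct (cderiv_ccont _ _ _ Up r2 H2) as [r3 [Hr3 K3]].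
    exists (Rmin r0 (Rmin r1 r3)). split; [repeat apply Rmin_pos; auto|].
    intros q Hq [r [Hr K]]. exfalso.
    set (r' := Rmin r (Rmin r0 (Rmin r1 r3) - Cmod (q - p))).
    assert (Hr' : 0 < r') by (unfold r'; apply Rmin_pos; lra).
    assert (Cst : forall w, Cmod (w - q) < r' -> u w = u p).
    { intros w Hw. apply NNPP. intros N.
      assert (W1 := Rlt_le_trans _ _ _ Hw (Rmin_l _ _)).
      assert (W2 := Rlt_le_trans _ _ _ Hw (Rmin_r _ _)).
      assert (Wp : Cmod (w - p) < Rmin r0 (Rmin r1 r3)).
      { eapply Rle_lt_trans; [apply (Cmod_tri w q p)|]. lra. }
      assert (Wp' := Rlt_le_trans _ _ _ Wp (Rmin_r _ _)).
      assert (A := K1 w (Rlt_le_trans _ _ _ Wp' (Rmin_l _ _))).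
      assert (B := K3 w (Rlt_le_trans _ _ _ Wp' (Rmin_r _ _))).
      assert (G := K2 (u w) (conj (Cmod_sub_pos _ _ N) B)).
      rewrite K in G by auto. assert (Z := Cmod_ge_sub (D w) (D p)). lra. }
    destruct (Hu q (Rlt_le_trans _ _ _ Hq (Rmin_l _ _))) as [Uq [Nq _]].
    apply Nq. apply (cderiv_unique u q); auto.
    apply (cderiv_loc (fun _ => u p) _ _ _ r' Hr'); [|apply cderiv_const].
    intros w Hw. symmetry. auto.
  - destruct (mero_cderivable f P _ Hm Pu) as [r1 [H1 K1]].
    destruct (cderiv_ccont _ _ _ Up r1 H1) as [r2 [H2 K2]].
    set (r := Rmin r0 r2). assert (Hr : 0 < r) by (apply Rmin_pos; auto).
    (* The disc of radius [2 r / 3] about [q] covers the disc of radius [r / 3] about [p] and stays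
       inside that of radius [r]. *)
    exists (r / 3). split; [lra|]. intros q Hq [rho [Hrho K]] q' Hq'.
    exists (r / 3 - Cmod (q' - p)). split; [lra|]. intros w Hw.
    apply Csub_0_eq.
    apply (identity_disc (fun w => f (u w) - D w)%C q (2 * r / 3) rho Hrho).
    + intros z Hz. assert (Zp : Cmod (z - p) < r).
      { eapply Rle_lt_trans; [apply (Cmod_tri z q p)|]. lra. }
      destruct (Hu z (Rlt_le_trans _ _ _ Zp (Rmin_l _ _))) as [Uz [_ Dz]].
      apply cderivable_minus; auto. apply cderivable_comp; [exists (d z); auto|].
      apply K1, K2. exact (Rlt_le_trans _ _ _ Zp (Rmin_r _ _)).
    + intros z Hz. rewrite K by auto. ring.
    + assert (Cmod (w - p) < r / 3).
      { eapply Rle_lt_trans; [apply (Cmod_tri w q' p)|]. lra. }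
      eapply Rle_lt_trans; [apply (Cmod_tri w p q)|]. rewrite (Cmod_sub_sym p q). lra.
Qed.

(** Connectedness of the interval: at the supremum of the good initial segments the local hypothesis
    transfers [Q] from just before it to just beyond it. *)
Lemma interval_induction (Q : R -> Prop) (t0 : R) :
  0 < t0 < 1 -> Q t0 ->
  (forall t, 0 < t < 1 -> exists d, 0 < d /\ forall s s', 0 < s < 1 -> 0 < s' < 1 ->
      Rabs (s - t) < d -> Rabs (s' - t) < d -> Q s -> Q s') ->
  forall t, t0 <= t < 1 -> Q t.
Proof.
  intros Ht0 Q0 Hloc t1 Ht1. apply NNPP. intros NQ.
  set (S := fun t => t0 <= t <= t1 /\ forall s, t0 <= s <= t -> Q s).
  assert (S0 : S t0).
  { split; [lra|]. intros s Hs. now replace s with t0 by lra. }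
  destruct (completeness S) as [l [Hub Hl]].
  { exists t1. intros x [Hx _]. lra. }
  { exists t0; auto. }
  assert (L0 : t0 <= l) by (apply Hub; exact S0).
  assert (L1 : l <= t1) by (apply Hl; intros x [Hx _]; lra).
  destruct (Hloc l ltac:(lra)) as [d [Hd K]].
  assert (Ex : exists x, S x /\ l - d < x).
  { apply NNPP. intros N. assert (l <= l - d); [|lra].
    apply Hl. intros x Sx. apply Rnot_lt_le. intros L. apply N. exists x; auto. }
  destruct Ex as [x [Sx Lx]]. assert (Xl : x <= l) by (apply Hub; exact Sx).
  destruct Sx as [Hx Kx].
  set (m := Rmin t1 (l + d / 2)).
  assert (Hm1 : m <= t1) by apply Rmin_l. assert (Hm2 : m <= l + d / 2) by apply Rmin_r.
  assert (Hm3 : l <= m) by (apply Rmin_glb; lra).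
  assert (Qm : forall s, t0 <= s <= m -> Q s).
  { intros s Hs. destruct (Rle_dec s x) as [L|L]; [apply Kx; lra|].
    apply (K x s); try lra; try (apply Rabs_lt_between; lra). apply Kx; lra. }
  assert (Ml : m <= l) by (apply Hub; split; [lra|auto]).
  assert (m = t1).
  { unfold m. apply Rmin_left. apply Rnot_lt_le. intros L.
    unfold m in Ml. rewrite Rmin_right in Ml by lra. lra. }
  apply NQ, Qm. lra.
Qed.

Theorem no_continuation (k : R) (f : C -> C) (P : C -> Prop) (A B : C) (delta : R) :
  0 < k < 1 -> meromorphic_with_poles f P -> B <> 0%C -> 0 < delta ->
  (forall q, Cmod q = 1 -> Cmod (q - 1) < delta -> f (inv_int k q) = target A B q) ->
  ~ P 0%C -> False.
Proof.
  intros Hk Hm HB Hdelta Harc HP0.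
  set (u := inv_int k) in *. set (D := target A B) in *.
  destruct (domain_exists k Hk) as [rho [Hrho Hdom]].
  assert (Hu : forall p, domain rho p -> cderiv u p (density k p)) by (apply inv_int_deriv; auto).
  assert (HD : forall p : C, p <> 0%C -> cderivable D p) by (intros p Np; eexists; apply target_cderiv; exact Np).
  assert (U1 : u 1%C = 0%C) by (unfold u, inv_int; apply seg_int_refl).
  assert (D1 : domain rho 1) by (right; rewrite Cmod_self; auto).
  destruct (mero_cderivable f P 0 Hm HP0) as [r1 [Hr1 K1]].
  destruct (cderiv_ccont _ _ _ (Hu 1%C D1) r1 Hr1) as [r2 [Hr2 K2]]. rewrite U1 in K2.
  (* [1/2] keeps 0, the pole of [D], away; [delta] gives the arc identity, [rho] holomorphy of [u],
     and [r2] keeps [u] where [f] is differentiable. *)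
  set (eta := Rmin (Rmin (1/2) delta) (Rmin rho r2)).
  assert (Heta : 0 < eta) by (unfold eta; repeat apply Rmin_pos; auto; lra).
  assert (E1 : eta <= 1/2) by (eapply Rle_trans; [apply Rmin_l|apply Rmin_l]).
  assert (E2 : eta <= delta) by (eapply Rle_trans; [apply Rmin_l|apply Rmin_r]).
  assert (E3 : eta <= rho) by (eapply Rle_trans; [apply Rmin_r|apply Rmin_l]).
  assert (E4 : eta <= r2) by (eapply Rle_trans; [apply Rmin_r|apply Rmin_r]).
  assert (Near : forall q, Cmod (q - 1) < eta -> Cmod q <= 1 -> (f (u q) - D q)%C = 0%C).
  { apply (arc_zero (fun q => f (u q) - D q)%C).
    - intros q Hq. apply cderivable_minus.
      + apply cderivable_comp.
        * exists (density k q). apply Hu. right. lra.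
        * apply K1, K2. lra.
      + apply HD. intros ->. replace (0 - 1)%C with (- (1))%C in Hq by ring. rewrite Cmod_m1 in Hq. lra.
    - intros q Hq Hq1. rewrite Harc by (auto; lra). ring. }
  assert (E0 := zeta8_ne_1).
  assert (EE : Cmod (zeta8 - 1) <= 2).
  { eapply Rle_trans; [apply Cmod_sub_le|]. rewrite zeta8_mod, Cmod_1. lra. }
  set (Q := fun t => agree_near f u D (chord t)).
  (* At [t = eta / 4] the chord is strictly inside the unit disc and within [eta / 2] of 1, so
     [Near] gives agreement on a disc. *)
  assert (Qall : forall t, eta / 4 <= t < 1 -> Q t).
  { apply interval_induction; [lra| |].
    - assert (In := chord_in (eta / 4) ltac:(lra)).
      assert (C1 : Cmod (chord (eta / 4) - 1) <= eta / 2).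
      { unfold chord. replace (1 + (eta / 4)%R * (zeta8 - 1) - 1)%C with ((eta / 4)%R * (zeta8 - 1))%C by ring.
        rewrite Cmod_mult, Cmod_R, Rabs_pos_eq by lra. nra. }
      exists (Rmin (1 - Cmod (chord (eta / 4))) (eta / 2)). split; [apply Rmin_pos; lra|].
      intros q Hq. assert (Q1 := Rlt_le_trans _ _ _ Hq (Rmin_l _ _)).
      assert (Q2 := Rlt_le_trans _ _ _ Hq (Rmin_r _ _)).
      apply Csub_0_eq, Near.
      + eapply Rle_lt_trans; [apply (Cmod_tri q (chord (eta / 4)) 1)|]. lra.
      + assert (Z := Cmod_ge_sub q (chord (eta / 4))). lra.
    - intros t Ht. assert (In := chord_in t Ht). assert (Nz := chord_nz t ltac:(lra)).
      assert (Nzp := proj1 (Cmod_gt_0 _) Nz).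
      destruct (agree_near_spread f u (density k) D P (chord t) (Rmin (1 - Cmod (chord t)) (Cmod (chord t))) Hm)
        as [r [Hr K]].
      + apply Rmin_pos; lra.
      + intros q Hq. assert (Q1 := Rlt_le_trans _ _ _ Hq (Rmin_l _ _)).
        assert (Q2 := Rlt_le_trans _ _ _ Hq (Rmin_r _ _)).
        assert (Z := Cmod_ge_sub q (chord t)).
        split; [|split].
        * apply Hu. left. lra.
        * apply density_nz; auto. lra.
        * apply HD. intros ->. replace (0 - chord t)%C with (- chord t)%C in Q2 by ring.
          rewrite Cmod_opp in Q2. lra.
      + exists (r / 2). split; [lra|]. intros s s' Hs Hs' Ds Ds'.
        assert (Near' : forall x, Rabs (x - t) < r / 2 -> Cmod (chord x - chord t) < r).
        { intros x Hx. rewrite chord_dist. assert (Z := Rabs_pos (x - t)). nra. }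
        intros Qs. apply (K (chord s)); auto. }
  assert (QE : forall t, eta / 4 <= t < 1 -> f (u (chord t)) = D (chord t)).
  { intros t Ht. destruct (Qall t Ht) as [r [Hr K]]. apply K. rewrite Cmod_self. auto. }
  destruct (chord_limit u (density k)) as [u0 Hu0].
  { intros p Hp. apply Hu. left. auto. }
  { intros eps He. apply density_chord_small; auto. }
  assert (Nee : zeta8 <> 0%C) by (apply Cmod_gt_0; rewrite zeta8_mod; lra).
  assert (De := target_cderiv A B zeta8 Nee). fold D in De.
  set (m := (B * (- (6 * zeta8 ^ 5) + 6 * zeta8 ^ 5 / (zeta8 ^ 6 * zeta8 ^ 6)))%C) in *.
  (* Because [zeta8^12 = -1], the two terms of the derivative reinforce each other to
     [-12 B zeta8^5]. *)
  assert (Hm0 : 0 < Cmod m).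
  { apply Cmod_gt_0. unfold m. rewrite zeta8_pow6.
    replace (- Ci * - Ci)%C with (- (1))%C by (apply C_ext; simpl; ring).
    replace (- (6 * zeta8 ^ 5) + 6 * zeta8 ^ 5 / - (1))%C with (- (12) * zeta8 ^ 5)%C
      by (field; intros X; apply (f_equal Re) in X; simpl in X; lra).
    apply Cmult_neq_0; [auto|]. apply Cmult_neq_0.
    - intros X. apply (f_equal Re) in X. simpl in X. lra.
    - apply Cpow_nz; auto. }
  assert (Dist : forall t, t < 1 -> Cmod (chord t - zeta8) = (1 - t) * Cmod (zeta8 - 1)).
  { intros t Ht. rewrite <- chord_1 at 1. rewrite chord_dist, Rabs_left1 by lra. ring. }
  (* At a pole [u0], boundedness of [D] near [zeta8] would force [u = u0] on the end of the chord,
     whereas the derivative of [u] along the chord is nonzero. *)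
  assert (HPu : ~ P u0).
  { intros Pu. destruct (cderiv_ccont _ _ _ De 1 Rlt_0_1) as [s1 [Hs1 L1]].
    assert (Hm' := Hm). destruct Hm' as [_ [_ H3]]. destruct (H3 _ Pu (Cmod (D zeta8) + 1)) as [s2 [Hs2 L2]].
    destruct (Hu0 1 Rlt_0_1) as [t1 [Ht1 L3]].
    set (t2 := Rmax (Rmax t1 (eta / 4)) (1 - Rmin s1 s2 / 4)).
    assert (M : 0 < Rmin s1 s2) by (apply Rmin_pos; auto).
    assert (T1 : t1 <= t2) by (eapply Rle_trans; [apply Rmax_l|apply Rmax_l]).
    assert (T2 : eta / 4 <= t2) by (eapply Rle_trans; [apply Rmax_r|apply Rmax_l]).
    assert (T3 : 1 - Rmin s1 s2 / 4 <= t2) by apply Rmax_r.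
    assert (T4 : t2 < 1) by (unfold t2; repeat apply Rmax_lub_lt; lra).
    assert (Cst : forall t, t2 <= t < 1 -> u (chord t) = u0).
    { intros t Ht. apply NNPP. intros N.
      assert (Dt : Cmod (chord t - zeta8) < Rmin s1 s2) by (rewrite Dist by lra; nra).
      assert (X1 := L1 _ (Rlt_le_trans _ _ _ Dt (Rmin_l _ _))).
      assert (X2 := L3 t ltac:(lra)). rewrite Rmult_1_l in X2.
      assert (X3 := L2 (u (chord t)) (conj (Cmod_sub_pos _ _ N)
        (Rle_lt_trans _ _ _ X2 (Rlt_le_trans _ _ _ Dt (Rmin_r _ _))))).
      rewrite QE in X3 by lra. assert (Z := Cmod_ge_sub (D (chord t)) (D zeta8)). lra. }
    set (t3 := (t2 + 1) / 2).
    assert (In3 : Cmod (chord t3) < 1) by (apply chord_in; unfold t3; lra).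
    assert (R1 : rderiv (fun t => u (chord t)) t3 (density k (chord t3) * (zeta8 - 1))%C).
    { apply rderiv_comp; [apply Hu; left; auto | apply chord_rderiv]. }
    assert (R2 : rderiv (fun t => u (chord t)) t3 0%C).
    { apply rderiv_eps. intros e He. exists ((1 - t2) / 2). split; [lra|]. intros s Hs.
      apply Rabs_lt_between in Hs. unfold t3 in *.
      rewrite !Cst by lra. replace (u0 - u0 - 0 * (s - (t2 + 1) / 2)%R)%C with (RtoC 0) by ring.
      rewrite Cmod_0. apply Rmult_le_pos; [lra|apply Rabs_pos]. }
    assert (Z := rderiv_unique _ _ _ _ R1 R2). revert Z. apply Cmult_neq_0.
    - apply density_nz; auto.
    - apply Cmod_gt_0; auto. }
  destruct (mero_cderivable f P u0 Hm HPu) as [r3 [Hr3 K3]].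
  destruct (K3 u0 ltac:(rewrite Cmod_self; auto)) as [l Hl].
  set (lam := Cmod l + 1). assert (Hlam : 1 <= lam) by (unfold lam; assert (Z := Cmod_ge_0 l); lra).
  destruct (Hl 1 Rlt_0_1) as [r4 [Hr4 K4]].
  assert (FL : forall w, Cmod (w - u0) < r4 -> Cmod (f w - f u0) <= lam * Cmod (w - u0)).
  { intros w Hw. specialize (K4 w Hw).
    replace (f w - f u0)%C with ((f w - f u0 - l * (w - u0)) + l * (w - u0))%C by ring.
    eapply Rle_trans; [apply Cmod_triangle|]. rewrite (Cmod_mult l). unfold lam. lra. }
  (* [lam] is a Lipschitz constant of [f] at [u0]; with this [eps], [f (u (chord t))] moves at most
     at a quarter of the speed [|m|] at which [D] leaves [D zeta8]. *)
  set (eps := Cmod m / 4 / lam).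
  assert (Heps : 0 < eps) by (unfold eps; repeat apply Rdiv_lt_0_compat; lra).
  assert (Eel : lam * eps = Cmod m / 4) by (unfold eps; field; lra).
  destruct (Hu0 eps Heps) as [t1 [Ht1 L1]].
  destruct (De (Cmod m / 4) ltac:(lra)) as [s1 [Hs1 L2]].
  set (t2 := Rmax (Rmax t1 (eta / 4)) (1 - Rmin s1 (r4 / eps) / 4)).
  assert (Hre : 0 < r4 / eps) by (apply Rdiv_lt_0_compat; auto).
  assert (M : 0 < Rmin s1 (r4 / eps)) by (apply Rmin_pos; auto).
  assert (T1 : t1 <= t2) by (eapply Rle_trans; [apply Rmax_l|apply Rmax_l]).
  assert (T2 : eta / 4 <= t2) by (eapply Rle_trans; [apply Rmax_r|apply Rmax_l]).
  assert (T3 : 1 - Rmin s1 (r4 / eps) / 4 <= t2) by apply Rmax_r.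
  assert (T4 : t2 < 1) by (unfold t2; repeat apply Rmax_lub_lt; lra).
  assert (Main : forall t, t2 <= t < 1 ->
     Cmod (D (chord t) - f u0) <= Cmod m / 4 * Cmod (chord t - zeta8) /\
     Cmod (D (chord t) - D zeta8 - m * (chord t - zeta8)) <= Cmod m / 4 * Cmod (chord t - zeta8)).
  { intros t Ht.
    assert (Dt : Cmod (chord t - zeta8) < Rmin s1 (r4 / eps)) by (rewrite Dist by lra; nra).
    assert (X1 := L1 t ltac:(lra)).
    assert (X2 := Rlt_le_trans _ _ _ Dt (Rmin_l _ _)). assert (X3 := Rlt_le_trans _ _ _ Dt (Rmin_r _ _)).
    split; [|apply L2; auto].
    rewrite <- QE by lra. eapply Rle_trans; [apply FL|].
    - eapply Rle_lt_trans; [exact X1|]. apply (Rmult_lt_compat_l eps) in X3; auto.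
      replace (eps * (r4 / eps)) with r4 in X3 by (field; lra). exact X3.
    - rewrite <- Eel, Rmult_assoc. apply Rmult_le_compat_l; lra. }
  assert (Ef : f u0 = D zeta8).
  { apply Cmod_zero_eq. apply Rnot_lt_le. intros G.
    set (g := Cmod (f u0 - D zeta8)) in *.
    set (t := Rmax t2 (1 - g / (4 * (Cmod m + 1)))).
    assert (Hg : 0 < g / (4 * (Cmod m + 1))) by (apply Rdiv_lt_0_compat; lra).
    assert (U1' : t2 <= t) by apply Rmax_l. assert (U2 : 1 - g / (4 * (Cmod m + 1)) <= t) by apply Rmax_r.
    assert (U3 : t < 1) by (unfold t; apply Rmax_lub_lt; lra).
    destruct (Main t ltac:(lra)) as [A1 A2].
    assert (Z1 : g <= Cmod (D (chord t) - f u0) + Cmod (D (chord t) - D zeta8)).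
    { unfold g. rewrite (Cmod_sub_sym (D (chord t)) (f u0)). apply Cmod_tri. }
    assert (Z2 : Cmod (D (chord t) - D zeta8) <= Cmod (D (chord t) - D zeta8 - m * (chord t - zeta8)) + Cmod m * Cmod (chord t - zeta8)).
    { rewrite <- Cmod_mult.
      replace (D (chord t) - D zeta8)%C with ((D (chord t) - D zeta8 - m * (chord t - zeta8)) + m * (chord t - zeta8))%C at 1 by ring.
      apply Cmod_triangle. }
    assert (Z3 : Cmod (chord t - zeta8) <= 2 * (g / (4 * (Cmod m + 1)))) by (rewrite Dist by lra; nra).
    assert (Z4 : (Cmod m + 1) * Cmod (chord t - zeta8) <= g / 2).
    { replace (g / 2) with ((Cmod m + 1) * (2 * (g / (4 * (Cmod m + 1))))) by (field; lra).
      apply Rmult_le_compat_l; lra. }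
    assert (Z5 := Cmod_ge_0 (chord t - zeta8)). nra. }
  (* The two quarters combine to [|m| <= |m| / 2]. *)
  destruct (Main t2 ltac:(lra)) as [A1 A2]. rewrite Ef in A1.
  assert (Z : Cmod (m * (chord t2 - zeta8)) <= Cmod m / 2 * Cmod (chord t2 - zeta8)).
  { replace (m * (chord t2 - zeta8))%C with ((D (chord t2) - D zeta8) - (D (chord t2) - D zeta8 - m * (chord t2 - zeta8)))%C by ring.
    eapply Rle_trans; [apply Cmod_sub_le|]. lra. }
  rewrite Cmod_mult, Dist in Z by lra.
  assert (0 < Cmod m * ((1 - t2) * Cmod (zeta8 - 1))) by (repeat apply Rmult_lt_0_compat; lra). lra.
Qed.

(** * The hypergeometric series *)


Lemma poch_half_pos (n : nat) : 0 < poch (1/2) n.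
Proof.
  induction n as [|n IH]; simpl; [lra|]. assert (X := pos_INR n). apply Rmult_lt_0_compat; lra.
Qed.

Lemma hypc_S (n : nat) :
  hypc (S n) * ((INR n + 1) * (INR n + 1/2)) = hypc n * ((INR n + 1/6) * (INR n + 5/6)).
Proof.
  unfold hypc. assert (X := pos_INR n). assert (F := INR_fact_lt_0 n). assert (P := poch_half_pos n).
  rewrite fact_simpl, mult_INR, S_INR. simpl poch. field. lra.
Qed.

(** The ratio of consecutive coefficients is at most 1, as [n^2 + n + 5/36 <= n^2 + 3 n / 2 + 1/2].
    This gives radius of convergence at least 1. *)
Lemma hypc_bounds (n : nat) : 0 <= hypc n <= 1.
Proof.
  induction n as [|n IH].
  - unfold hypc; simpl. lra.
  - assert (H := hypc_S n). assert (X := pos_INR n).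
    set (x := INR n) in *. set (c := hypc n) in *. set (c' := hypc (S n)) in *.
    assert (P : 0 < (x + 1) * (x + 1/2)) by nra.
    assert (Q : 0 <= (x + 1/6) * (x + 5/6) <= (x + 1) * (x + 1/2)) by nra.
    split.
    + apply (Rmult_le_reg_r ((x + 1) * (x + 1/2))); [auto|]. rewrite H. nra.
    + apply (Rmult_le_reg_r ((x + 1) * (x + 1/2))); [auto|]. rewrite H. nra.
Qed.

Lemma hypc_0 : hypc 0 = 1.
Proof. unfold hypc; simpl. field. Qed.

Lemma hypc_radius (x : R) : Rabs x < 1 -> Rbar_lt (Rabs x) (CV_radius hypc).
Proof.
  intros Hx. apply (Rbar_lt_le_trans _ 1); [exact Hx|].
  apply (CV_radius_bounded hypc). exists 1. intros n. rewrite pow1, Rmult_1_r.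
  assert (H := hypc_bounds n). rewrite Rabs_pos_eq; lra.
Qed.

Definition hyp_d0 : R -> R := PSeries hypc.
Definition hyp_d1 : R -> R := PSeries (PS_derive hypc).
Definition hyp_d2 : R -> R := PSeries (PS_derive (PS_derive hypc)).

Lemma hyp_d0_derive (x : R) : Rabs x < 1 -> is_derive hyp_d0 x (hyp_d1 x).
Proof. intros H. apply is_derive_PSeries, hypc_radius, H. Qed.

Lemma hyp_d1_derive (x : R) : Rabs x < 1 -> is_derive hyp_d1 x (hyp_d2 x).
Proof.
  intros H. apply is_derive_PSeries. rewrite CV_radius_derive. apply hypc_radius, H.
Qed.

Lemma hyp_d0_0 : hyp_d0 0 = 1.
Proof. unfold hyp_d0. rewrite PSeries_0. apply hypc_0. Qed.

(** The hypergeometric equation with [c = 1/2], [a + b + 1 = 2], [a b = 5/36]; coefficient by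
    coefficient it is the recurrence [hypc_S]. *)
Lemma hyp_ode (x : R) : Rabs x < 1 ->
  x * (1 - x) * hyp_d2 x + (1/2 - 2 * x) * hyp_d1 x - 5/36 * hyp_d0 x = 0.
Proof.
  intros Hx.
  set (c := hypc). set (c1 := PS_derive c). set (c2 := PS_derive c1).
  assert (E0 : ex_pseries c x) by (apply CV_radius_inside, hypc_radius, Hx).
  assert (E1 : ex_pseries c1 x).
  { apply CV_radius_inside. unfold c1. rewrite CV_radius_derive. apply hypc_radius, Hx. }
  assert (E2 : ex_pseries c2 x).
  { apply CV_radius_inside. unfold c2, c1. rewrite !CV_radius_derive. apply hypc_radius, Hx. }
  assert (Sc : forall (k : R) (a : nat -> R), ex_pseries a x -> ex_pseries (PS_scal k a) x).
  { intros k a Ha. apply (ex_pseries_scal (K := R_AbsRing) (V := R_NormedModule)); auto.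
    apply Rmult_comm. }
  set (p1 := PS_incr_1 c2). set (p2 := PS_incr_1 (PS_incr_1 c2)). set (p3 := PS_incr_1 c1).
  assert (X1 : ex_pseries p1 x) by (apply ex_pseries_incr_1; auto).
  assert (X2 : ex_pseries p2 x) by (apply ex_pseries_incr_1; auto).
  assert (X3 : ex_pseries p3 x) by (apply ex_pseries_incr_1; auto).
  assert (Z : PSeries (PS_plus (PS_plus p1 (PS_scal (-1) p2))
      (PS_plus (PS_plus (PS_scal (1/2) c1) (PS_scal (-2) p3)) (PS_scal (-5/36) c))) x = 0).
  { rewrite <- (PSeries_const_0 x). apply PSeries_ext. intros n.
    unfold PS_plus, PS_scal, p1, p2, p3, c2, c1, c, PS_incr_1, PS_derive, plus, scal, zero; simpl; unfold mult; simpl.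
    assert (H := hypc_S n). destruct n as [|[|n]].
    - simpl in *. match goal with |- ?a = ?b => change (@eq R a b) end. lra.
    - simpl in *. match goal with |- ?a = ?b => change (@eq R a b) end. lra.
    - change (match n with O => 1 | S _ => INR n + 1 end) with (INR (S n)).
      match goal with |- ?a = ?b => change (@eq R a b) end. rewrite !S_INR in *. lra. }
  assert (PP : forall a b : nat -> R, ex_pseries a x -> ex_pseries b x -> ex_pseries (PS_plus a b) x).
  { intros a b Ha Hb. apply (ex_pseries_plus (K := R_AbsRing) (V := R_NormedModule)); auto. }
  rewrite !PSeries_plus, !PSeries_scal in Z
    by (repeat match goal with
        | |- ex_pseries (PS_plus _ _) _ => apply PP
        | |- ex_pseries (PS_scal _ _) _ => apply Sc
        | _ => assumption
        end).
  unfold p1, p2, p3 in Z. rewrite !PSeries_incr_1 in Z.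
  change (PSeries c x) with (hyp_d0 x) in Z. change (PSeries c1 x) with (hyp_d1 x) in Z.
  change (PSeries c2 x) with (hyp_d2 x) in Z. lra.
Qed.

Lemma sin2_lt_1 (t : R) : Rabs t < PI / 2 -> Rabs (sin t * sin t) < 1.
Proof.
  intros H. apply Rabs_lt_between in H. assert (C := cos_gt_0 t ltac:(lra) ltac:(lra)).
  assert (S := sin2_cos2 t). unfold Rsqr in S. rewrite Rabs_pos_eq by nra. nra.
Qed.

(* [y = cos t * F(sin t ^ 2)] solves [y'' = - (4/9) y]; the energy of [y - cos (2 t / 3)] is constant. *)
Lemma hyp_trig (t : R) : Rabs t < PI / 2 -> cos t * hyp_d0 (sin t * sin t) = cos (2 * t / 3).
Proof.
  intros Ht.
  set (g := fun t => cos t * hyp_d0 (sin t * sin t) - cos (2 * t / 3)).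
  set (g1 := fun t => - sin t * hyp_d0 (sin t * sin t) + 2 * sin t * (cos t * cos t) * hyp_d1 (sin t * sin t)
        + 2/3 * sin (2 * t / 3)).
  assert (Ds : forall x, is_derive (fun t => sin t * sin t) x (2 * sin x * cos x)).
  { intros x. auto_derive; auto. ring. }
  assert (Dd0 : forall x, Rabs x < PI / 2 ->
     is_derive (fun t => hyp_d0 (sin t * sin t)) x (2 * sin x * cos x * hyp_d1 (sin x * sin x))).
  { intros x Hx. apply (is_derive_comp hyp_d0 (fun t => sin t * sin t)); [|apply Ds].
    apply hyp_d0_derive, sin2_lt_1, Hx. }
  assert (DF1 : forall x, Rabs x < PI / 2 ->
     is_derive (fun t => hyp_d1 (sin t * sin t)) x (2 * sin x * cos x * hyp_d2 (sin x * sin x))).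
  { intros x Hx. apply (is_derive_comp hyp_d1 (fun t => sin t * sin t)); [|apply Ds].
    apply hyp_d1_derive, sin2_lt_1, Hx. }
  assert (Dg : forall x, Rabs x < PI / 2 -> is_derive g x (g1 x)).
  { intros x Hx. unfold g. evar_last.
    - apply (is_derive_minus (fun t => cos t * hyp_d0 (sin t * sin t)) (fun t => cos (2 * t / 3))).
      + apply (is_derive_mult cos (fun t => hyp_d0 (sin t * sin t))); [apply is_derive_cos | apply Dd0, Hx | apply Rmult_comm].
      + auto_derive; auto.
    - unfold g1, minus, plus, opp, mult; simpl. unfold Rdiv. field. }
  assert (Dg1 : forall x, Rabs x < PI / 2 -> is_derive g1 x (- (4/9) * g x)).
  { intros x Hx. unfold g1. evar_last.
    - apply (is_derive_plus (fun t => - sin t * hyp_d0 (sin t * sin t) + 2 * sin t * (cos t * cos t) * hyp_d1 (sin t * sin t))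
       (fun t => 2/3 * sin (2 * t / 3))).
      + apply (is_derive_plus (fun t => - sin t * hyp_d0 (sin t * sin t)) (fun t => 2 * sin t * (cos t * cos t) * hyp_d1 (sin t * sin t))).
        * apply (is_derive_mult (fun t => - sin t) (fun t => hyp_d0 (sin t * sin t))); [|apply Dd0, Hx|apply Rmult_comm].
          auto_derive; auto.
        * apply (is_derive_mult (fun t => 2 * sin t * (cos t * cos t)) (fun t => hyp_d1 (sin t * sin t))); [|apply DF1, Hx|apply Rmult_comm].
          auto_derive; auto.
      + auto_derive; auto.
    - assert (O := hyp_ode _ (sin2_lt_1 x Hx)). unfold g, plus, mult; simpl. change (2 * x * / 3) with (2 * x / 3).
      assert (S := sin2_cos2 x). unfold Rsqr in S.
      set (s := sin x) in *. set (c := cos x) in *. set (a := hyp_d0 (s * s)) in *. set (b := hyp_d1 (s * s)) in *.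
      set (d := hyp_d2 (s * s)) in *.
      assert (C2 : c * c = 1 - s * s) by lra.
      (* The derivative of [g1] is sorted into the wanted term, [4 c] times the hypergeometric
         equation at [s^2], and a multiple of [c^2 + s^2 - 1]. *)
      transitivity (- (4/9) * (c * a - cos (2 * x / 3)) + 4 * c * (s * s * (c * c) * d - (5/36 * a - (1/2 - 2 * (s * s)) * b))
         + 2 * c * b * (c * c + s * s - 1)); [field|].
      rewrite C2. replace (s * s * (1 - s * s) * d) with (5/36 * a - (1/2 - 2 * (s * s)) * b) by lra. ring. }
  set (e := fun t => g1 t * g1 t + 4/9 * (g t * g t)).
  assert (De : forall x, Rabs x < PI / 2 -> is_derive e x 0).
  { intros x Hx. unfold e. evar_last.
    - apply (is_derive_plus (fun t => g1 t * g1 t) (fun t => 4/9 * (g t * g t))).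
      + apply (is_derive_mult g1 g1); [apply Dg1, Hx | apply Dg1, Hx | apply Rmult_comm].
      + apply (is_derive_scal (fun t => g t * g t)).
        apply (is_derive_mult g g); [apply Dg, Hx | apply Dg, Hx | apply Rmult_comm].
    - unfold plus, mult; simpl. unfold scal; simpl; unfold mult; simpl. ring. }
  assert (In : forall x, Rmin 0 t <= x <= Rmax 0 t -> Rabs x < PI / 2).
  { intros x Hx. apply Rabs_lt_between in Ht. apply Rabs_lt_between. unfold Rmin, Rmax in Hx.
    destruct (Rle_dec 0 t); lra. }
  destruct (MVT_gen e 0 t (fun _ => 0)) as [x [_ Hx]].
  { intros x Hx. apply De, In. lra. }
  { intros x Hx. apply derivable_continuous_pt. exists 0. apply is_derive_Reals, De, In, Hx. }
  assert (G0 : g 0 = 0).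
  { unfold g. replace (2 * 0 / 3) with 0 by field. rewrite sin_0, cos_0, Rmult_0_l, hyp_d0_0. ring. }
  assert (G1 : g1 0 = 0).
  { unfold g1. replace (2 * 0 / 3) with 0 by field. rewrite sin_0. ring. }
  assert (e t = 0).
  { assert (e 0 = 0) by (unfold e; rewrite G0, G1; ring). lra. }
  assert (g t = 0) by (unfold e in *; nra). unfold g in *. lra.
Qed.

(** * The integral on the real axis *)


Definition realU (k w : R) : R := RInt (fun t => hyp_d0 (k ^ 2 * sin t ^ 2)) 0 w.

Definition psi_of (k w : R) : R := asin (k * sin w).

Lemma k_sin_lt (k t : R) : 0 < k < 1 -> -1 < k * sin t < 1.
Proof. intros Hk. assert (B := SIN_bound t). nra. Qed.

Lemma realU_integrand_cont (k t : R) : 0 < k < 1 -> continuous (fun t => hyp_d0 (k ^ 2 * sin t ^ 2)) t.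
Proof.
  intros Hk. apply (ex_derive_continuous (V := R_NormedModule)).
  assert (B := k_sin_lt k t Hk).
  eexists. apply (is_derive_comp hyp_d0 (fun t => k ^ 2 * sin t ^ 2)).
  - apply hyp_d0_derive. replace (k ^ 2 * sin t ^ 2) with ((k * sin t) * (k * sin t)) by ring.
    rewrite Rabs_pos_eq by nra. nra.
  - auto_derive; auto.
Qed.

Lemma realU_derive (k w : R) : 0 < k < 1 -> is_derive (realU k) w (hyp_d0 (k ^ 2 * sin w ^ 2)).
Proof.
  intros Hk. unfold realU. apply (is_derive_RInt (fun t => hyp_d0 (k ^ 2 * sin t ^ 2)) _ 0).
  - apply filter_forall. intros x. apply (RInt_correct (V := R_CompleteNormedModule)).
    apply (ex_RInt_continuous (V := R_CompleteNormedModule)). intros z _. apply realU_integrand_cont, Hk.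
  - apply realU_integrand_cont, Hk.
Qed.

Lemma realU_0 (k : R) : realU k 0 = 0.
Proof. apply (RInt_point (V := R_CompleteNormedModule)). Qed.

Lemma sin_psi_of (k w : R) : 0 < k < 1 -> sin (psi_of k w) = k * sin w.
Proof. intros Hk. apply sin_asin. assert (B := k_sin_lt k w Hk). lra. Qed.

Lemma psi_of_bound (k w : R) : 0 < k < 1 -> - (PI / 2) < psi_of k w < PI / 2.
Proof. intros Hk. apply asin_bound_lt, k_sin_lt, Hk. Qed.

Lemma cos_psi_of_pos (k w : R) : 0 < k < 1 -> 0 < cos (psi_of k w).
Proof. intros Hk. assert (B := psi_of_bound k w Hk). apply cos_gt_0; lra. Qed.

Lemma psi_of_derive (k w : R) : 0 < k < 1 -> is_derive (psi_of k) w (k * cos w / cos (psi_of k w)).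
Proof.
  intros Hk. assert (B := k_sin_lt k w Hk).
  assert (Ec : cos (psi_of k w) = sqrt (1 - (k * sin w)²)) by (apply cos_asin; lra).
  evar_last.
  - apply (is_derive_comp asin (fun t => k * sin t)).
    + apply is_derive_Reals.
      rewrite <- (derive_pt_eq asin _ _ (derivable_pt_asin _ B)). apply derive_pt_asin.
    + auto_derive; auto.
  - unfold scal; simpl; unfold mult; simpl. rewrite <- Ec. field.
    apply Rgt_not_eq, cos_psi_of_pos, Hk.
Qed.

Lemma hyp_d0_psi_of (k w : R) : 0 < k < 1 ->
  hyp_d0 (k ^ 2 * sin w ^ 2) = cos (2 * psi_of k w / 3) / cos (psi_of k w).
Proof.
  intros Hk. assert (P := cos_psi_of_pos k w Hk). assert (B := psi_of_bound k w Hk).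
  assert (H := hyp_trig (psi_of k w) ltac:(apply Rabs_lt_between; lra)).
  rewrite sin_psi_of in H by auto. rewrite <- H.
  replace (k * sin w * (k * sin w)) with (k ^ 2 * sin w ^ 2) by ring. field. lra.
Qed.

Lemma cis_add (a b : R) : (cis a * cis b = cis (a + b))%C.
Proof. unfold cis. rewrite cos_plus, sin_plus. apply C_ext; simpl; ring. Qed.

Lemma cis_pow (t : R) (n : nat) : (cis t ^ n = cis (INR n * t))%C.
Proof.
  induction n as [|n IH].
  - simpl. rewrite Rmult_0_l. unfold cis. now rewrite cos_0, sin_0.
  - rewrite Cpow_S, IH, cis_add, S_INR. f_equal. ring.
Qed.

Lemma cis_sum (t : R) : (cis t + cis (- t) = RtoC (2 * cos t))%C.
Proof. unfold cis. rewrite cos_neg, sin_neg. apply C_ext; simpl; ring. Qed.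

Lemma radical_arc (k w : R) : 0 < k < 1 -> 0 < cos w ->
  0 < Re (1 - omega k * cis (psi_of k w / 3) ^ 6) ->
  0 < Re (1 - Cconj (omega k) * cis (psi_of k w / 3) ^ 6) ->
  radical k (cis (psi_of k w / 3)) = (RtoC (2 * k * cos w) * cis (psi_of k w))%C.
Proof.
  intros Hk Hw H1 H2. set (p := cis (psi_of k w / 3)) in *.
  assert (P3 : (p ^ 3 = cis (psi_of k w))%C).
  { unfold p. rewrite cis_pow. f_equal. simpl. field. }
  assert (Cp := cos_psi_of_pos k w Hk). assert (Sp := sin_psi_of k w Hk).
  destruct (csqrt_spec _ H1) as [S1 T1]. destruct (csqrt_spec _ H2) as [S2 T2].
  unfold radical. set (s1 := csqrt (1 - omega k * p ^ 6)) in *. set (s2 := csqrt (1 - Cconj (omega k) * p ^ 6)) in *.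
  rewrite <- P3. set (x := (RtoC (2 * k * cos w) * p ^ 3)%C).
  assert (Sq : (s1 * s2 * (s1 * s2) = x * x)%C).
  { transitivity ((s1 * s1) * (s2 * s2))%C; [ring|]. rewrite S1, S2.
    assert (Om : (omega k * Cconj (omega k) = 1)%C).
    { rewrite <- Cmod2_conj, omega_mod by auto. now rewrite pow1. }
    assert (Os : (omega k + Cconj (omega k) = RtoC (2 - 4 * k ^ 2))%C).
    { unfold omega. apply C_ext; simpl; ring. }
    transitivity (1 - (omega k + Cconj (omega k)) * p ^ 6 + (omega k * Cconj (omega k)) * (p ^ 6 * p ^ 6))%C; [ring|].
    rewrite Om, Os.
    assert (E12 : (1 + p ^ 6 * p ^ 6 = RtoC (2 * cos (2 * psi_of k w)) * p ^ 6)%C).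
    { rewrite <- cis_sum. 
      replace (p ^ 6)%C with (cis (2 * psi_of k w)).
      - rewrite Cmult_plus_distr_r, (Cmult_comm (cis (- (2 * psi_of k w)))), cis_opp. ring.
      - unfold p. rewrite cis_pow. f_equal. simpl. field. }
    transitivity ((1 + p ^ 6 * p ^ 6) - RtoC (2 - 4 * k ^ 2) * p ^ 6)%C; [ring|]. rewrite E12.
    transitivity (RtoC (2 * cos (2 * psi_of k w) - (2 - 4 * k ^ 2)) * p ^ 6)%C; [rewrite (RtoC_minus (2 * cos _)); ring|].
    assert (W := sin2_cos2 w). unfold Rsqr in W.
    replace (2 * cos (2 * psi_of k w) - (2 - 4 * k ^ 2)) with ((2 * k * cos w) * (2 * k * cos w)).
    - unfold x. rewrite RtoC_mult. ring.
    - rewrite cos_2a_sin, Sp. transitivity (4 * k ^ 2 * (cos w * cos w)); [ring|].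
      replace (cos w * cos w) with (1 - sin w * sin w) by lra. ring. }
  assert (Rx : 0 < Re x).
  { unfold x. rewrite P3. unfold cis; simpl.
    assert (0 < 2 * k * cos w * cos (psi_of k w)) by (repeat apply Rmult_lt_0_compat; lra). lra. }
  assert (Rs : 0 < Re (s1 * s2)).
  { destruct s1 as [a b], s2 as [c d]. simpl in T1, T2 |- *.
    assert (X := Rabs_pos b). assert (Y := Rabs_pos d).
    assert (b * d <= Rabs b * Rabs d) by (rewrite <- Rabs_mult; apply Rle_abs).
    assert (Rabs b * Rabs d < a * c) by (apply Rmult_le_0_lt_compat; lra). lra. }
  assert (Z : ((s1 * s2 - x) * (s1 * s2 + x) = 0)%C).
  { transitivity (s1 * s2 * (s1 * s2) - x * x)%C; [ring|]. rewrite Sq. ring. }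
  apply Csub_0_eq. apply NNPP. intros N. revert Z. apply Cmult_neq_0; auto.
  intros E. apply (f_equal Re) in E. 
  change (Re (s1 * s2 + x)) with (Re (s1 * s2) + Re x) in E. simpl Re at 3 in E. lra.
Qed.

(** As functions of [w] both sides vanish at 0, where [p = 1], and have the same derivative. A small
    [d] keeps [p w] in the disc about 1, the part of [domain] that meets the circle, and
    [cos w > 0]. *)
Lemma inv_int_arc (k : R) : 0 < k < 1 -> exists d, 0 < d /\ d < PI / 2 /\
  forall w, Rabs w < d -> inv_int k (cis (psi_of k w / 3)) = RtoC (realU k w).
Proof.
  intros Hk. destruct (domain_exists k Hk) as [rho [Hrho Hdom]].
  assert (Hu := inv_int_deriv k rho Hrho Hdom).
  set (p := fun w => cis (psi_of k w / 3)).
  assert (Dp : forall w, rderiv p w (RtoC (k * cos w / cos (psi_of k w) / 3) * (Ci * p w))%C).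
  { intros w. 
    assert (D1 : is_derive (fun w => psi_of k w / 3) w (k * cos w / cos (psi_of k w) / 3)).
    { evar_last. 
      - apply (is_derive_ext (fun w => / 3 * psi_of k w)); [intros; simpl; unfold Rdiv; ring|].
        apply (is_derive_scal (psi_of k) w (/ 3)), psi_of_derive, Hk.
      - simpl. unfold Rdiv. ring. }
    split; unfold p, cis; simpl.
    - evar_last.
      + apply (is_derive_comp cos (fun w => psi_of k w / 3)); [apply is_derive_cos | apply D1].
      + unfold scal; simpl; unfold mult; simpl. ring.
    - evar_last.
      + apply (is_derive_comp sin (fun w => psi_of k w / 3)); [apply is_derive_sin | apply D1].
      + unfold scal; simpl; unfold mult; simpl. ring. }
  assert (P0 : p 0 = 1%C).
  { unfold p, psi_of. rewrite sin_0, Rmult_0_r, asin_0. replace (0 / 3) with 0 by field.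
    unfold cis. now rewrite cos_0, sin_0. }
  assert (HPI := PI_RGT_0).
  assert (Hnear : exists d, 0 < d /\ d < PI / 2 /\ forall w, Rabs w < d -> domain rho (p w)).
  { assert (D0 := Dp 0). rewrite rderiv_eps in D0. destruct (D0 1 Rlt_0_1) as [d1 [Hd1 K]].
    rewrite P0 in K. set (v := (RtoC (k * cos 0 / cos (psi_of k 0) / 3) * (Ci * 1))%C) in *.
    assert (Hv := Cmod_ge_0 v).
    exists (Rmin (PI / 4) (Rmin d1 (rho / (Cmod v + 1)))).
    assert (0 < rho / (Cmod v + 1)) by (apply Rdiv_lt_0_compat; lra).
    split; [repeat apply Rmin_pos; lra|]. split; [eapply Rle_lt_trans; [apply Rmin_l|]; lra|].
    intros w Hw. right. assert (W := Rlt_le_trans _ _ _ Hw (Rmin_r _ _)).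
    assert (W1 := Rlt_le_trans _ _ _ W (Rmin_l _ _)). assert (W2 := Rlt_le_trans _ _ _ W (Rmin_r _ _)).
    specialize (K w). rewrite Rminus_0_r in K. specialize (K W1).
    apply (Rmult_lt_compat_r (Cmod v + 1)) in W2; [|lra].
    replace (rho / (Cmod v + 1) * (Cmod v + 1)) with rho in W2 by (field; lra).
    replace (p w - 1)%C with ((p w - 1 - v * w) + v * w)%C by ring.
    eapply Rle_lt_trans; [apply Cmod_triangle|]. rewrite (Cmod_mult v), Cmod_R. lra. }
  destruct Hnear as [d [Hd [Hd2 Kd]]]. exists d. split; [auto|]. split; [auto|].
  set (G := fun w => (inv_int k (p w) + - 1 * RtoC (realU k w))%C).
  assert (DG : forall w, Rabs w < d -> rderiv G w 0).
  { intros w Hw. assert (Hp := Kd w Hw). apply Rabs_lt_between in Hw.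
    assert (Cw : 0 < cos w) by (apply cos_gt_0; lra).
    assert (DV : rderiv (fun w => RtoC (realU k w)) w (RtoC (hyp_d0 (k ^ 2 * sin w ^ 2)))).
    { split; simpl; [apply realU_derive, Hk | apply (is_derive_const (V := R_NormedModule) 0)]. }
    eapply rderiv_eq.
    - apply rderiv_plus; [apply rderiv_comp; [apply Hu, Hp | apply Dp]|]. apply rderiv_cmult, DV.
    - unfold density. destruct (Hdom _ Hp) as [R1 R2].
      assert (RA := radical_arc k w Hk Cw R1 R2). fold (p w) in RA. rewrite RA. rewrite hyp_d0_psi_of by auto.
      assert (Cp := cos_psi_of_pos k w Hk).
      assert (E3 : cis (psi_of k w) = (p w ^ 3)%C).
      { unfold p. rewrite cis_pow. f_equal. simpl. field. }
      assert (E4 : (p w ^ 4 + 1 = RtoC (2 * cos (2 * psi_of k w / 3)) * p w ^ 2)%C).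
      { rewrite <- cis_sum. unfold p. rewrite !cis_pow, Cmult_plus_distr_r, !cis_add.
        f_equal; [f_equal; simpl; field|].
        replace (- (2 * psi_of k w / 3) + INR 2 * (psi_of k w / 3)) with 0 by (simpl; field).
        unfold cis. now rewrite cos_0, sin_0. }
      rewrite E3, E4.
      assert (Np : p w <> 0%C) by (apply Cmod_gt_0; unfold p; rewrite Cmod_cis; lra).
      assert (N1 : RtoC (cos w) <> 0%C) by (intros X; apply RtoC_inj in X; lra).
      assert (N2 : RtoC (cos (psi_of k w)) <> 0%C) by (intros X; apply RtoC_inj in X; lra).
      assert (N3 : RtoC k <> 0%C) by (intros X; apply RtoC_inj in X; lra).
      assert (Two : RtoC 2 <> 0%C) by (intros X; apply RtoC_inj in X; lra).
      rewrite !RtoC_div, !RtoC_mult by lra.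
      assert (CC : (Ci * Ci = - (1))%C) by (apply C_ext; simpl; ring).
      transitivity (- (1 + Ci * Ci) * RtoC (cos (2 * psi_of k w / 3)) / RtoC (cos (psi_of k w)))%C.
      + field. repeat split; auto.
      + rewrite CC. field. auto. }
  assert (G0 : G 0 = 0%C).
  { unfold G. rewrite P0, realU_0. unfold inv_int. rewrite seg_int_refl. ring. }
  intros w Hw. assert (Gw : G w = 0%C).
  { apply Rabs_lt_between in Hw. rewrite <- G0. destruct (Rle_dec 0 w) as [L|L].
    - apply rderiv_zero_const; auto. intros t Ht. apply DG, Rabs_lt_between. lra.
    - symmetry. apply rderiv_zero_const; [lra|]. intros t Ht. apply DG, Rabs_lt_between. lra. }
  unfold G in Gw. fold (p w). apply Csub_0_eq. rewrite <- Gw. ring.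
Qed.

(** Near 1 every point of the circle is [cis (psi_of k w / 3)] for a small real [w], which turns the
    hypothesis into that of [no_continuation]. Its coefficient is [B / (4 k^2)] because
    [2 - p^6 - p^-6 = 4 k^2 sin(w)^2]. *)
Theorem no_mero_extension (k : R) (f : C -> C) (P : C -> Prop) (A B : C) (d : R) :
  0 < k < 1 -> meromorphic_with_poles f P -> B <> 0%C -> 0 < d ->
  (forall w : R, Rabs w < d -> f (RtoC (realU k w)) = (A + B * RtoC (sin w ^ 2))%C) -> False.
Proof.
  intros Hk Hm HB Hd Hf.
  destruct (inv_int_arc k Hk) as [d1 [Hd1 [Hd1' Harc]]].
  (* The points [realU k w] tend to 0 and are at least [w / 2 > 0], the derivative at 0 being 1; on
     them [|f|] is at most [|A| + |B|]. *)
  assert (HP0 : ~ P 0%C).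
  { intros P0. destruct Hm as [_ [_ H3]]. destruct (H3 _ P0 (Cmod A + Cmod B)) as [r [Hr K]].
    assert (D := realU_derive k 0 Hk). rewrite is_derive_eps in D.
    destruct (D (1/2) ltac:(lra)) as [d2 [Hd2 K2]].
    rewrite realU_0, sin_0 in K2. replace (k ^ 2 * 0 ^ 2) with 0 in K2 by ring. rewrite hyp_d0_0 in K2.
    set (w := Rmin (d / 2) (Rmin (d2 / 2) (r / 2))).
    assert (Hw : 0 < w) by (unfold w; repeat apply Rmin_pos; lra).
    assert (W1 : w <= d / 2) by apply Rmin_l.
    assert (W2 : w <= d2 / 2) by (eapply Rle_trans; [apply Rmin_r|apply Rmin_l]).
    assert (W3 : w <= r / 2) by (eapply Rle_trans; [apply Rmin_r|apply Rmin_r]).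
    specialize (K2 w). rewrite !Rminus_0_r, (Rabs_pos_eq w), Rmult_1_l in K2 by lra.
    specialize (K2 ltac:(lra)). apply Rabs_le_between in K2.
    assert (X : Cmod A + Cmod B < Cmod (f (RtoC (realU k w)))).
    { apply K. replace (RtoC (realU k w) - 0)%C with (RtoC (realU k w)) by ring.
      rewrite Cmod_R, Rabs_pos_eq by lra. lra. }
    rewrite Hf in X by (rewrite Rabs_pos_eq; lra).
    assert (Y := Cmod_triangle A (B * RtoC (sin w ^ 2))).
    rewrite Cmod_mult, Cmod_R, Rabs_pos_eq in Y by (simpl; nra).
    assert (S := sin2_cos2 w). unfold Rsqr in S.
    assert (sin w ^ 2 <= 1) by (simpl; nra). assert (Z := Cmod_ge_0 B). nra. }
  set (dd := Rmin d d1). assert (Hdd : 0 < dd) by (apply Rmin_pos; auto).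
  assert (Dd1 : dd <= d) by apply Rmin_l. assert (Dd2 : dd <= d1) by apply Rmin_r.
  assert (Sd : 0 < sin dd) by (apply sin_gt_0; lra).
  (* [|y| < 1/2] gives [|a| <= PI / 6], hence [asin (sin (3 a)) = 3 a]; the second bound keeps
     [|sin (3 a)| <= 3 |y|] below [k * sin dd], so that [|w| < dd]. *)
  set (delta := Rmin (1/2) (k * sin dd / 7)).
  assert (Hks : 0 < k * sin dd) by (apply Rmult_lt_0_compat; lra).
  assert (Hdelta : 0 < delta) by (apply Rmin_pos; lra).
  assert (L1 : delta <= 1/2) by apply Rmin_l. assert (L2 : delta <= k * sin dd / 7) by apply Rmin_r.
  assert (Nk : RtoC k <> 0%C) by (intros X; apply RtoC_inj in X; lra).
  assert (N4 : RtoC 4 <> 0%C) by (intros X; apply RtoC_inj in X; lra).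
  apply (no_continuation k f P A (B / (4 * (k * k)))%C delta); auto.
  { unfold Cdiv. apply Cmult_neq_0; auto. apply Cmod_gt_0.
    rewrite Cmod_inv by (repeat apply Cmult_neq_0; auto).
    apply Rinv_0_lt_compat, Cmod_gt_0. repeat apply Cmult_neq_0; auto. }
  intros q Hq Hq1. destruct q as [x y].
  assert (Hx := re_le_Cmod ((x, y) - 1)). assert (Hy := im_le_Cmod ((x, y) - 1)).
  simpl in Hx, Hy.
  assert (Hx1 : 1/2 < x) by (apply Rabs_le_between in Hx; lra).
  assert (Hy1 : Rabs y < delta) by (replace (y + - 0) with y in Hy by ring; lra).
  assert (Hxy : x * x + y * y = 1).
  { assert (E := Cmod_sqr (x, y)). rewrite Hq in E. simpl in E. lra. }
  assert (Hy2 := Hy1). apply Rabs_lt_between in Hy2.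
  set (a := asin y).
  assert (Sa : sin a = y) by (apply sin_asin; lra).
  assert (Ca : cos a = x).
  { unfold a. rewrite cos_asin by lra. unfold Rsqr. replace (1 - y * y) with (x * x) by lra.
    apply sqrt_square. lra. }
  assert (HPI := PI_RGT_0).
  assert (Ba : - (PI / 6) <= a <= PI / 6).
  { assert (B2 := asin_bound y). fold a in B2.
    split; apply Rnot_lt_le; intros X.
    - assert (Y := sin_increasing_1 a (- (PI / 6)) ltac:(lra) ltac:(lra) ltac:(lra) ltac:(lra) X).
      rewrite sin_neg, sin_PI6, Sa in Y. lra.
    - assert (Y := sin_increasing_1 (PI / 6) a ltac:(lra) ltac:(lra) ltac:(lra) ltac:(lra) X).
      rewrite sin_PI6, Sa in Y. lra. }
  assert (S3 : sin (3 * a) = 3 * y - 4 * (y * y * y)).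
  { replace (3 * a) with (2 * a + a) by ring. rewrite sin_plus, sin_2a, cos_2a, Sa, Ca.
    transitivity (3 * (x * x) * y - y * y * y); [ring|]. replace (x * x) with (1 - y * y) by lra. ring. }
  assert (B3 : Rabs (sin (3 * a)) <= k * sin dd - delta / 100).
  { rewrite S3. replace (3 * y - 4 * (y * y * y)) with (y * (3 - 4 * (y * y))) by ring. rewrite Rabs_mult.
    rewrite (Rabs_pos_eq (3 - _)) by nra. assert (Z := Rabs_pos y). nra. }
  set (z := sin (3 * a) / k).
  assert (Bz : Rabs z < sin dd).
  { unfold z, Rdiv. rewrite Rabs_mult, Rabs_inv, (Rabs_pos_eq k) by lra.
    apply (Rmult_lt_reg_r k); [lra|]. rewrite Rmult_assoc, Rinv_l by lra. lra. }
  assert (Sd1 : sin dd <= 1) by apply SIN_bound.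
  apply Rabs_lt_between in Bz.
  set (w := asin z).
  assert (Sw : sin w = z) by (apply sin_asin; lra).
  assert (Bw : Rabs w < dd).
  { assert (B4 := asin_bound z). fold w in B4. apply Rabs_lt_between.
    split; apply Rnot_le_lt; intros X.
    - assert (Y := sin_incr_1 w (- dd) ltac:(lra) ltac:(lra) ltac:(lra) ltac:(lra) X).
      rewrite sin_neg, Sw in Y. lra.
    - assert (Y := sin_incr_1 dd w ltac:(lra) ltac:(lra) ltac:(lra) ltac:(lra) X).
      rewrite Sw in Y. lra. }
  assert (Epsi : psi_of k w = 3 * a).
  { unfold psi_of. rewrite Sw. unfold z. replace (k * (sin (3 * a) / k)) with (sin (3 * a)) by (field; lra).
    apply asin_sin. lra. }
  assert (Eq : (x, y) = cis (psi_of k w / 3)).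
  { rewrite Epsi. replace (3 * a / 3) with a by field. unfold cis. now rewrite Ca, Sa. }
  rewrite Eq, Harc by lra. rewrite Hf by lra. unfold target. f_equal.
  assert (E6 : (cis (psi_of k w / 3) ^ 6 = cis (2 * (3 * a)))%C).
  { rewrite cis_pow, Epsi. f_equal. simpl. field. }
  rewrite E6.
  assert (Ei : (/ cis (2 * (3 * a)) = cis (- (2 * (3 * a))))%C).
  { assert (N : cis (2 * (3 * a)) <> 0%C) by (apply Cmod_gt_0; rewrite Cmod_cis; lra).
    rewrite <- (Cmult_1_r (/ _)%C), <- (cis_opp (2 * (3 * a))). field. auto. }
  rewrite Ei.
  replace (2 - cis (2 * (3 * a)) - cis (- (2 * (3 * a))))%C with (2 - (cis (2 * (3 * a)) + cis (- (2 * (3 * a)))))%C by ring.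
  rewrite cis_sum, cos_2a_sin, Sw. unfold z.
  replace ((sin (3 * a) / k) ^ 2) with (sin (3 * a) * sin (3 * a) / (k * k)) by (field; lra).
  rewrite RtoC_div by nra. rewrite !RtoC_mult, !RtoC_minus, !RtoC_mult.
  field. auto.
Qed.

(** * Injectivity of the integral near the origin *)


Lemma hypF_real (x : R) : hypF (RtoC x) = RtoC (hyp_d0 x).
Proof.
  unfold hypF, hyp_d0, PSeries, RtoC. f_equal.
  - apply Series_ext. intros n. change (x, 0) with (RtoC x). now rewrite <- RtoC_pow.
  - transitivity (PSeries (fun _ => 0) 0); [|apply PSeries_const_0]. apply Series_ext. intros n.
    change (x, 0) with (RtoC x). rewrite <- RtoC_pow. simpl. ring.
Qed.

Lemma csin_real (x : R) : csin (RtoC x) = RtoC (sin x).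
Proof.
  unfold csin; simpl. unfold sinh, RtoC. rewrite cosh_0, Ropp_0. f_equal; [ring|]. field.
Qed.

Lemma RInt_C (g : R -> C) :
  ex_RInt (fun t => Re (g t)) 0 1 -> ex_RInt (fun t => Im (g t)) 0 1 ->
  @RInt C_R_CompleteNormedModule g 0 1 = cint g.
Proof.
  intros A B. apply (is_RInt_unique (V := C_R_CompleteNormedModule)).
  apply (is_RInt_fct_extend_pair (U := R_NormedModule) (V := R_NormedModule)).
  - apply (RInt_correct (V := R_CompleteNormedModule) _ _ _ A).
  - apply (RInt_correct (V := R_CompleteNormedModule) _ _ _ B).
Qed.

(** On the real axis the integrand is real, and [t = w s] rescales the parameter interval to
    [[0, w]]. *)
Lemma U_real (k w : R) : 0 < k < 1 -> U k (RtoC w) = RtoC (realU k w).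
Proof.
  intros Hk. set (h := fun t => hyp_d0 (k ^ 2 * sin t ^ 2)).
  assert (E : forall s, (RtoC w * hypF (RtoC (k ^ 2) * csin (RtoC s * RtoC w) ^ 2))%C
     = RtoC (w * h (w * s + 0))).
  { intros s. rewrite <- RtoC_mult, csin_real, <- RtoC_pow, <- RtoC_mult, hypF_real, <- RtoC_mult.
    unfold h. do 5 f_equal. f_equal. ring. }
  assert (Ex : ex_RInt h (w * 0 + 0) (w * 1 + 0)).
  { apply (ex_RInt_continuous (V := R_CompleteNormedModule)). intros z _. apply realU_integrand_cont, Hk. }
  unfold U. rewrite RInt_C.
  - unfold cint. transitivity (realU k w, 0); [|reflexivity]. f_equal.
    + rewrite (RInt_ext _ (fun s => scal w (h (w * s + 0)))).
      * etransitivity; [exact (RInt_comp_lin (V := R_CompleteNormedModule) h w 0 0 1 Ex)|]. unfold realU. f_equal; ring.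
      * intros s _. rewrite E. reflexivity.
    + rewrite (RInt_ext _ (fun _ => 0)).
      * rewrite RInt_const. unfold scal; simpl; unfold mult; simpl. ring.
      * intros s _. rewrite E. reflexivity.
  - apply (ex_RInt_ext (fun s => scal w (h (w * s + 0)))).
    + intros s _. rewrite E. reflexivity.
    + exact (ex_RInt_comp_lin (V := R_NormedModule) h w 0 0 1 Ex).
  - apply (ex_RInt_ext (fun _ => 0)).
    + intros s _. rewrite E. reflexivity.
    + apply ex_RInt_const.
Qed.

(** A summable bound whose constant makes the induction close exactly: [1/4 * 4 * (/2)^n + (/2)^n =
    4 * (/2)^(n+1)]. *)
Lemma pow_lip (x y : C) (n : nat) : Cmod x <= 1/4 -> Cmod y <= 1/4 ->
  Cmod (x ^ n - y ^ n) <= 4 * (/2) ^ n * Cmod (x - y).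
Proof.
  intros Hx Hy. assert (D := Cmod_ge_0 (x - y)). assert (Y := Cmod_ge_0 y).
  induction n as [|n IH].
  - simpl. rewrite Cmod_self. lra.
  - rewrite !Cpow_S.
    replace (x * x ^ n - y * y ^ n)%C with (x * (x ^ n - y ^ n) + (x - y) * y ^ n)%C by ring.
    eapply Rle_trans; [apply Cmod_triangle|]. rewrite !Cmod_mult, Cmod_pow. simpl pow.
    assert (P : 0 < (/2) ^ n) by (apply pow_lt; lra).
    assert (Q : Cmod y ^ n <= (/2) ^ n) by (apply pow_incr; lra).
    assert (Cmod x * Cmod (x ^ n - y ^ n) <= 1/4 * (4 * (/2) ^ n * Cmod (x - y))).
    { apply Rmult_le_compat; auto; apply Cmod_ge_0. }
    assert (Cmod (x - y) * Cmod y ^ n <= Cmod (x - y) * (/2) ^ n) by (apply Rmult_le_compat_l; auto).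
    lra.
Qed.

Lemma hyp_term_ex (l : C -> R) (x : C) : (forall z, Rabs (l z) <= Cmod z) -> Cmod x <= 1/4 ->
  ex_series (fun n => hypc n * l (x ^ n)%C).
Proof.
  intros Hl Hx. apply (ex_series_le (K := R_AbsRing) (V := R_CompleteNormedModule) _ (fun n => (1/4) ^ n)).
  - intros n. unfold norm; simpl; unfold abs; simpl. rewrite Rabs_mult.
    assert (B := hypc_bounds n). rewrite (Rabs_pos_eq (hypc n)) by lra.
    assert (L := Hl (x ^ n)%C). rewrite Cmod_pow in L.
    assert (Cmod x ^ n <= (1/4) ^ n) by (apply pow_incr; split; [apply Cmod_ge_0|auto]).
    assert (Z := Rabs_pos (l (x ^ n)%C)). nra.
  - apply ex_series_geom. rewrite Rabs_pos_eq; lra.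
Qed.

(** [l] stands for [Re] or [Im]; 8 is 4 times the sum of [(/2) ^ n]. *)
Lemma hyp_series_lip (l : C -> R) (x y : C) :
  (forall z, Rabs (l z) <= Cmod z) -> (forall a b, l (a - b)%C = l a - l b) ->
  Cmod x <= 1/4 -> Cmod y <= 1/4 ->
  Rabs (Series (fun n => hypc n * l (x ^ n)%C) - Series (fun n => hypc n * l (y ^ n)%C))
    <= 8 * Cmod (x - y).
Proof.
  intros Hl Hadd Hx Hy. rewrite <- Series_minus by (apply hyp_term_ex; auto).
  assert (Hb : forall n, Rabs (hypc n * l (x ^ n)%C - hypc n * l (y ^ n)%C)
      <= (/2) ^ n * (4 * Cmod (x - y))).
  { intros n. rewrite <- Rmult_minus_distr_l, <- Hadd, Rabs_mult.
    assert (B := hypc_bounds n). rewrite (Rabs_pos_eq (hypc n)) by lra.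
    assert (L := Hl (x ^ n - y ^ n)%C). assert (P := pow_lip x y n Hx Hy).
    assert (Z := Rabs_pos (l (x ^ n - y ^ n)%C)). nra. }
  assert (G : ex_series (fun n => (/2) ^ n)) by (apply ex_series_geom; rewrite Rabs_pos_eq; lra).
  assert (G' : ex_series (fun n => (/2) ^ n * (4 * Cmod (x - y)))) by (apply ex_series_scal_r, G).
  eapply Rle_trans; [apply Series_Rabs|].
  - apply (ex_series_le (K := R_AbsRing) (V := R_CompleteNormedModule) _ (fun n => (/2) ^ n * (4 * Cmod (x - y)))); auto.
    intros n. unfold norm; simpl; unfold abs; simpl. rewrite Rabs_Rabsolu. apply Hb.
  - eapply Rle_trans; [apply (Series_le _ (fun n => (/2) ^ n * (4 * Cmod (x - y)))); auto|].
    + intros n. split; [apply Rabs_pos|apply Hb].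
    + rewrite Series_scal_r, Series_geom by (rewrite Rabs_pos_eq; lra). lra.
Qed.

Lemma hypF_lip (x y : C) : Cmod x <= 1/4 -> Cmod y <= 1/4 ->
  Cmod (hypF x - hypF y) <= 16 * Cmod (x - y).
Proof.
  intros Hx Hy. eapply Rle_trans; [apply Cmod_le_ReIm|].
  assert (A := hyp_series_lip Re x y re_le_Cmod (fun a b => eq_refl) Hx Hy).
  assert (B := hyp_series_lip Im x y im_le_Cmod (fun a b => eq_refl) Hx Hy).
  unfold hypF; simpl. unfold Rminus in A, B. lra.
Qed.

(** On [[-1, 1]] both [cosh] and [sinh] are at most 3 in absolute value, so [|ccos| <= 3 + 3] along
    the segment. *)
Lemma csin_lip (a b : C) : Cmod a <= 1 -> Cmod b <= 1 -> Cmod (csin a - csin b) <= 6 * Cmod (a - b).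
Proof.
  intros Ha Hb.
  assert (Ch : forall y, Rabs y <= 1 -> Rabs (cosh y) <= 3 /\ Rabs (sinh y) <= 3).
  { intros y Hy. apply Rabs_le_between in Hy.
    assert (E1 : exp y <= 3) by (eapply Rle_trans; [|apply exp_le_3]; destruct (Rle_lt_or_eq_dec y 1) as [L| ->]; [lra|left; apply exp_increasing, L|lra]).
    assert (E2 : exp (- y) <= 3) by (eapply Rle_trans; [|apply exp_le_3]; destruct (Rle_lt_or_eq_dec (- y) 1) as [L| ->]; [lra|left; apply exp_increasing, L|lra]).
    assert (P1 := exp_pos y). assert (P2 := exp_pos (- y)).
    unfold cosh, sinh. split; apply Rabs_le; lra. }
  set (g := fun t : R => csin (b + RtoC t * (a - b))).
  replace (csin a) with (g 1) by (unfold g; f_equal; ring).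
  replace (csin b) with (g 0) by (unfold g; f_equal; ring).
  replace (6 * Cmod (a - b)) with (6 * Cmod (a - b) * (1 - 0)) by ring.
  apply (mean_value_ineq g (fun t => ccos (b + RtoC t * (a - b)) * (a - b))%C); [lra| |].
  - intros t _. unfold g, csin, ccos. destruct a as [a1 a2], b as [b1 b2]. split; simpl.
    + evar_last; [auto_derive; auto|]. simpl. unfold Rminus. ring.
    + evar_last; [auto_derive; auto|]. simpl. unfold Rminus. ring.
  - intros t Ht. rewrite Cmod_mult. apply Rmult_le_compat_r; [apply Cmod_ge_0|].
    set (z := (b + t * (a - b))%C).
    assert (Hz : Cmod z <= 1).
    { unfold z. replace (b + t * (a - b))%C with (RtoC (1 - t) * b + RtoC t * a)%C by (rewrite RtoC_minus; ring).
      eapply Rle_trans; [apply Cmod_triangle|]. rewrite !Cmod_mult, !Cmod_R, !Rabs_pos_eq by lra.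
      assert ((1 - t) * Cmod b <= (1 - t) * 1) by (apply Rmult_le_compat_l; lra).
      assert (t * Cmod a <= t * 1) by (apply Rmult_le_compat_l; lra). lra. }
    assert (Hi := im_le_Cmod z). destruct (Ch (Im z) ltac:(lra)) as [C1 C2].
    clearbody z. eapply Rle_trans; [apply Cmod_le_ReIm|]. unfold ccos; simpl.
    fold (Re z) (Im z).
    rewrite Rabs_Ropp, !Rabs_mult.
    assert (S1 := SIN_bound (Re z)). assert (S2 := COS_bound (Re z)).
    assert (T1 : Rabs (sin (Re z)) <= 1) by (apply Rabs_le; lra).
    assert (T2 : Rabs (cos (Re z)) <= 1) by (apply Rabs_le; lra).
    assert (Q1 := Rabs_pos (sin (Re z))). assert (Q2 := Rabs_pos (cos (Re z))).
    assert (Q3 := Rabs_pos (cosh (Im z))). assert (Q4 := Rabs_pos (sinh (Im z))).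
    assert (Rabs (cos (Re z)) * Rabs (cosh (Im z)) <= 1 * 3) by (apply Rmult_le_compat; auto).
    assert (Rabs (sin (Re z)) * Rabs (sinh (Im z)) <= 1 * 3) by (apply Rmult_le_compat; auto).
    lra.
Qed.

Lemma csin_0 : csin 0 = 0%C.
Proof. rewrite csin_real, sin_0. reflexivity. Qed.

Definition hyp_arg (k : R) (z : C) : C := (RtoC (k ^ 2) * csin z ^ 2)%C.

(** Difference of squares: 6 from [csin_lip], times [6/100 + 6/100] for the sum of the sines. *)
Lemma hyp_arg_lip (k : R) (a b : C) : 0 < k < 1 -> Cmod a <= 1/100 -> Cmod b <= 1/100 ->
  Cmod (hyp_arg k a - hyp_arg k b) <= 72/100 * Cmod (a - b).
Proof.
  intros Hk Ha Hb. unfold hyp_arg.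
  replace (RtoC (k ^ 2) * csin a ^ 2 - RtoC (k ^ 2) * csin b ^ 2)%C
    with (RtoC (k ^ 2) * ((csin a - csin b) * (csin a + csin b)))%C by ring.
  rewrite !Cmod_mult, Cmod_R, Rabs_pos_eq by (simpl; nra).
  assert (A := csin_lip a b ltac:(lra) ltac:(lra)).
  assert (A0 := csin_lip a 0 ltac:(lra) ltac:(rewrite Cmod_0; lra)).
  assert (B0 := csin_lip b 0 ltac:(lra) ltac:(rewrite Cmod_0; lra)).
  rewrite csin_0 in A0, B0.
  replace (csin a - 0)%C with (csin a) in A0 by ring. replace (csin b - 0)%C with (csin b) in B0 by ring.
  replace (a - 0)%C with a in A0 by ring. replace (b - 0)%C with b in B0 by ring.
  assert (T := Cmod_triangle (csin a) (csin b)).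
  assert (X := Cmod_ge_0 (csin a - csin b)). assert (Y := Cmod_ge_0 (csin a + csin b)).
  assert (K : 0 <= k ^ 2 <= 1) by (simpl; nra).
  assert (Cmod (csin a - csin b) * Cmod (csin a + csin b) <= 6 * Cmod (a - b) * (12/100)).
  { apply Rmult_le_compat; lra. }
  assert (0 <= Cmod (csin a - csin b) * Cmod (csin a + csin b)) by nra. nra.
Qed.

Lemma hyp_arg_small (k : R) (a : C) : 0 < k < 1 -> Cmod a <= 1/100 -> Cmod (hyp_arg k a) <= 72/10000.
Proof.
  intros Hk Ha. assert (H := hyp_arg_lip k a 0 Hk Ha ltac:(rewrite Cmod_0; lra)).
  assert (E : hyp_arg k 0 = 0%C) by (unfold hyp_arg; rewrite csin_0; ring).
  rewrite E in H. replace (hyp_arg k a - 0)%C with (hyp_arg k a) in H by ring.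
  replace (a - 0)%C with a in H by ring. lra.
Qed.

(** Near 0 the integrand is a small Lipschitz perturbation of the identity. This is what identifies
    [phi (realU k w)], a priori only some complex number, with [w]. *)
Lemma U_injective (k : R) (a b : C) : 0 < k < 1 -> Cmod a < 1/100 -> Cmod b < 1/100 ->
  U k a = U k b -> a = b.
Proof.
  intros Hk Ha Hb HU.
  set (G := fun (c : C) (s : R) => (c * hypF (hyp_arg k (RtoC s * c)))%C).
  assert (Sm : forall c s, Cmod c < 1/100 -> 0 <= s <= 1 -> Cmod (RtoC s * c) < 1/100).
  { intros c s Hc Hs. rewrite Cmod_mult, Cmod_R, Rabs_pos_eq by lra. assert (X := Cmod_ge_0 c). nra. }
  assert (HC : forall z, Cmod z < 1/100 -> ccont (fun z => hypF (hyp_arg k z)) z).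
  { intros z Hz e He. exists (Rmin (1/100 - Cmod z) (e / 16)). split; [apply Rmin_pos; lra|].
    intros w Hw. assert (W1 := Rlt_le_trans _ _ _ Hw (Rmin_l _ _)).
    assert (W2 := Rlt_le_trans _ _ _ Hw (Rmin_r _ _)).
    assert (Z := Cmod_ge_sub w z).
    assert (S1 := hyp_arg_small k z Hk ltac:(lra)). assert (S2 := hyp_arg_small k w Hk ltac:(lra)).
    assert (L := hypF_lip (hyp_arg k w) (hyp_arg k z) ltac:(lra) ltac:(lra)).
    assert (L' := hyp_arg_lip k w z Hk ltac:(lra) ltac:(lra)). assert (Q := Cmod_ge_0 (w - z)). lra. }
  assert (Ex : forall c, Cmod c < 1/100 -> ex_RInt (fun s => Re (G c s)) 0 1 /\ ex_RInt (fun s => Im (G c s)) 0 1).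
  { intros c Hc.
    assert (Sg : seg_cont (fun z => c * hypF (hyp_arg k z))%C 0 c).
    { intros t Ht. replace (0 + t * (c - 0))%C with (t * c)%C by ring.
      apply ccont_mult; [apply ccont_const | apply HC; auto]. }
    destruct (seg_ex_RInt _ _ _ Sg) as [A B]. split.
    - eapply ex_RInt_ext; [|exact A]. intros s _. unfold G. replace (0 + s * (c - 0))%C with (s * c)%C by ring. reflexivity.
    - eapply ex_RInt_ext; [|exact B]. intros s _. unfold G. replace (0 + s * (c - 0))%C with (s * c)%C by ring. reflexivity. }
  destruct (Ex a Ha) as [RA IA]. destruct (Ex b Hb) as [RB IB].
  assert (EU : forall c, Cmod c < 1/100 -> U k c = cint (G c)).
  { intros c Hc. destruct (Ex c Hc) as [R1 R2]. unfold U. apply RInt_C; auto. }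
  rewrite !EU in HU by auto.
  (* [16 * 72/10000] from the first term plus [12/100] from the second, with [12 >= 16 * 72/100],
     stay below [1/4]; real and imaginary parts together then give [|a - b| <= |a - b| / 2]. *)
  assert (Est : forall s, 0 <= s <= 1 -> Cmod (G a s - G b s - (a - b)) <= 1/4 * Cmod (a - b)).
  { intros s Hs. unfold G. set (xa := hyp_arg k (s * a)). set (xb := hyp_arg k (s * b)).
    replace (a * hypF xa - b * hypF xb - (a - b))%C
      with ((a - b) * (hypF xa - hypF 0) + b * (hypF xa - hypF xb))%C
      by (rewrite hypF_real, hyp_d0_0; ring).
    assert (A1 := Sm a s Ha Hs). assert (B1 := Sm b s Hb Hs).
    assert (S1 := hyp_arg_small k (s * a) Hk ltac:(lra)). assert (S2 := hyp_arg_small k (s * b) Hk ltac:(lra)).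
    fold xa in S1. fold xb in S2.
    assert (L0 := hypF_lip xa 0 ltac:(lra) ltac:(rewrite Cmod_0; lra)).
    assert (L1 := hypF_lip xa xb ltac:(lra) ltac:(lra)).
    assert (L2 := hyp_arg_lip k (s * a) (s * b) Hk ltac:(lra) ltac:(lra)). fold xa xb in L2.
    replace (s * a - s * b)%C with (s * (a - b))%C in L2 by ring.
    rewrite Cmod_mult, Cmod_R, Rabs_pos_eq in L2 by lra.
    replace (xa - 0)%C with xa in L0 by ring.
    eapply Rle_trans; [apply Cmod_triangle|]. rewrite !Cmod_mult.
    assert (D := Cmod_ge_0 (a - b)). assert (B0 := Cmod_ge_0 b).
    assert (Cmod (a - b) * Cmod (hypF xa - hypF 0) <= Cmod (a - b) * (1152/10000)) by (apply Rmult_le_compat_l; lra).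
    assert (Cmod (hypF xa - hypF xb) <= 12 * Cmod (a - b)) by nra.
    assert (Cmod b * Cmod (hypF xa - hypF xb) <= 1/100 * (12 * Cmod (a - b))).
    { apply Rmult_le_compat; try lra. apply Cmod_ge_0. }
    lra. }
  assert (Comp : forall (l : C -> R), (forall z, Rabs (l z) <= Cmod z) -> (forall x y, l (x - y)%C = l x - l y) ->
     ex_RInt (fun s => l (G a s)) 0 1 -> ex_RInt (fun s => l (G b s)) 0 1 ->
     RInt (fun s => l (G a s)) 0 1 = RInt (fun s => l (G b s)) 0 1 ->
     Rabs (l (a - b)%C) <= 1/4 * Cmod (a - b)).
  { intros l Hl Hadd EA EB E.
    assert (X : RInt (fun s => minus (minus (l (G a s)) (l (G b s))) (l (a - b)%C)) 0 1 = - l (a - b)%C).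
    { rewrite (RInt_minus (V := R_CompleteNormedModule) (fun s => minus (l (G a s)) (l (G b s))) (fun _ => l (a - b)%C)).
      - rewrite (RInt_minus (V := R_CompleteNormedModule)), E, RInt_const by auto.
        unfold minus, plus, opp, scal; simpl; unfold mult; simpl. ring.
      - apply (ex_RInt_minus (V := R_NormedModule)); auto.
      - apply ex_RInt_const. }
    rewrite <- Rabs_Ropp, <- X.
    eapply Rle_trans; [apply (abs_RInt_le_const _ 0 1 (1/4 * Cmod (a - b))); [lra| |]|lra].
    - apply (ex_RInt_minus (V := R_NormedModule) (fun s => minus (l (G a s)) (l (G b s))) (fun _ => l (a - b)%C)).
      + apply (ex_RInt_minus (V := R_NormedModule)); auto.
      + apply ex_RInt_const.
    - intros s Hs. eapply Rle_trans; [|apply (Est s Hs)]. eapply Rle_trans; [|apply Hl].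
      rewrite !Hadd. right. reflexivity. }
  apply Cmod_zero_eq.
  assert (C1 := Comp Re re_le_Cmod (fun x y => eq_refl) RA RB (f_equal fst HU)).
  assert (C2 := Comp Im im_le_Cmod (fun x y => eq_refl) IA IB (f_equal snd HU)).
  assert (C3 := Cmod_le_ReIm (a - b)). lra.
Qed.

Lemma csin_ccos (z : C) : (ccos z ^ 2 = 1 - csin z ^ 2)%C.
Proof.
  assert (S := sin2_cos2 (Re z)). unfold Rsqr in S.
  assert (H : cosh (Im z) * cosh (Im z) - sinh (Im z) * sinh (Im z) = 1).
  { unfold cosh, sinh. assert (E : exp (Im z) * exp (- Im z) = 1) by (rewrite <- exp_plus, Rplus_opp_r; apply exp_0).
    transitivity (exp (Im z) * exp (- Im z)); [field|exact E]. }
  unfold ccos, csin. set (s := sin (Re z)) in *. set (c := cos (Re z)) in *.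
  set (h := cosh (Im z)) in *. set (g := sinh (Im z)) in *.
  apply C_ext; simpl; [|ring].
  assert (h * h = 1 + g * g) by lra. assert (s * s = 1 - c * c) by lra.
  transitivity (c * c * (h * h) - s * s * (g * g)); [ring|].
  transitivity (1 - (s * s * (h * h) - c * c * (g * g))); [|ring].
  replace (h * h) with (1 + g * g) by lra. replace (s * s) with (1 - c * c) by lra. ring.
Qed.

Theorem theorem11 :
  forall (kappa r : R) (phi psi : C -> C),
    0 < kappa < 1 -> 0 < r ->
    phi 0%C = 0%C -> psi 0%C = 0%C ->
    (forall u : C, Cmod u < r ->
       cdiff phi u /\ cdiff psi u /\
       U kappa (phi u) = u /\
       csin (psi u) = (RtoC kappa * csin (phi u))%C) ->
    ~ extends_to_elliptic (fun u => (csin (phi u) ^ 2)%C) /\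
    ~ extends_to_elliptic (fun u => (ccos (phi u) ^ 2)%C) /\
    ~ extends_to_elliptic (fun u => (ccos (psi u) ^ 2)%C).
Proof.
  intros k r phi psi Hk Hr Hphi0 _ H.
  (* Both [phi (realU k w)], by continuity of [phi] at 0, and [w] lie where [U k] is injective, and
     [U k] sends both to [realU k w]. *)
  assert (Hinv : exists d, 0 < d /\ forall w, Rabs w < d -> Cmod (RtoC (realU k w)) < r /\ phi (RtoC (realU k w)) = RtoC w).
  { destruct (H 0%C ltac:(rewrite Cmod_0; auto)) as [Hd _].
    destruct (cderivable_ccont _ _ (cdiff_cderivable _ _ Hd) (1/100) ltac:(lra)) as [d1 [Hd1 K1]]. rewrite Hphi0 in K1.
    assert (D := realU_derive k 0 Hk). rewrite is_derive_eps in D.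
    destruct (D 1 Rlt_0_1) as [d2 [Hd2 K2]].
    rewrite realU_0, sin_0 in K2. replace (k ^ 2 * 0 ^ 2) with 0 in K2 by ring. rewrite hyp_d0_0 in K2.
    exists (Rmin (Rmin (1/100) (d1/2)) (Rmin d2 (r/2))). split; [repeat apply Rmin_pos; lra|].
    intros w Hw. assert (W12 := Rlt_le_trans _ _ _ Hw (Rmin_l _ _)). assert (W34 := Rlt_le_trans _ _ _ Hw (Rmin_r _ _)).
    assert (W1 := Rlt_le_trans _ _ _ W12 (Rmin_l _ _)). assert (W2 := Rlt_le_trans _ _ _ W12 (Rmin_r _ _)).
    assert (W3 := Rlt_le_trans _ _ _ W34 (Rmin_l _ _)). assert (W4 := Rlt_le_trans _ _ _ W34 (Rmin_r _ _)).
    specialize (K2 w). rewrite !Rminus_0_r, !Rmult_1_l in K2. specialize (K2 W3).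
    assert (B : Rabs (realU k w) <= 2 * Rabs w).
    { replace (realU k w) with ((realU k w - w) + w) by ring. eapply Rle_trans; [apply Rabs_triang|]. lra. }
    assert (Vr : Cmod (RtoC (realU k w)) < r) by (rewrite Cmod_R; lra).
    split; auto. destruct (H _ Vr) as [_ [_ [HU _]]].
    apply (U_injective k); auto.
    - specialize (K1 (RtoC (realU k w))). replace (RtoC (realU k w) - 0)%C with (RtoC (realU k w)) in K1 by ring.
      replace (phi (RtoC (realU k w)) - 0)%C with (phi (RtoC (realU k w))) in K1 by ring.
      apply K1. rewrite Cmod_R. lra.
    - rewrite Cmod_R. auto.
    - rewrite HU. symmetry. apply U_real, Hk. }
  destruct Hinv as [d [Hd Hinv]].
  (* All three functions have the form [A + B * csin (phi u) ^ 2], with [B] equal to 1, -1 and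
     [- k ^ 2]. *)
  assert (Main : forall (g : C -> C) (A B : C), B <> 0%C ->
     (forall u, Cmod u < r -> g u = A + B * csin (phi u) ^ 2)%C -> ~ extends_to_elliptic g).
  { intros g A B HB Hg [f [eps [Heps [[P [Hm _]] Hf]]]].
    assert (D := realU_derive k 0 Hk).
    destruct (proj1 (is_derive_eps _ _ _) D 1 Rlt_0_1) as [d2 [Hd2 K2]].
    rewrite realU_0, sin_0 in K2. replace (k ^ 2 * 0 ^ 2) with 0 in K2 by ring. rewrite hyp_d0_0 in K2.
    (* [eps / 2] because [|realU k w| <= 2 |w|] for [|w| < d2]. *)
    apply (no_mero_extension k f P A B (Rmin d (Rmin d2 (eps / 2)))); auto.
    - repeat apply Rmin_pos; lra.
    - intros w Hw. assert (W1 := Rlt_le_trans _ _ _ Hw (Rmin_l _ _)). assert (W34 := Rlt_le_trans _ _ _ Hw (Rmin_r _ _)).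
      assert (W3 := Rlt_le_trans _ _ _ W34 (Rmin_l _ _)). assert (W4 := Rlt_le_trans _ _ _ W34 (Rmin_r _ _)).
      specialize (K2 w). rewrite !Rminus_0_r, !Rmult_1_l in K2. specialize (K2 W3).
      assert (Bd : Rabs (realU k w) <= 2 * Rabs w).
      { replace (realU k w) with ((realU k w - w) + w) by ring. eapply Rle_trans; [apply Rabs_triang|]. lra. }
      destruct (Hinv w W1) as [V1 V2].
      rewrite Hf by (rewrite Cmod_R; lra). rewrite Hg by auto.
      rewrite V2, csin_real, RtoC_pow. reflexivity. }
  assert (N : forall x : R, x <> 0 -> RtoC x <> 0%C) by (intros x Hx E; apply Hx, RtoC_inj, E).
  repeat split.
  - apply (Main _ 0%C 1%C); [apply N; lra|]. intros u _. ring.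
  - apply (Main _ 1%C (RtoC (-1))); [apply N; lra|]. intros u _. rewrite csin_ccos. ring.
  - apply (Main _ 1%C (RtoC (- k ^ 2))); [apply N; simpl; nra|]. intros u Hu.
    destruct (H u Hu) as [_ [_ [_ E]]]. rewrite csin_ccos, E, RtoC_opp, RtoC_pow. ring.
Qed.
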